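(* For every fixed $\varepsilon>0$ there is a constant $C_\varepsilon>0$ such that for all real $x\ge 2$ $$\bigl|\mathcal{N}(x)-c_0x\bigr|\le C_\varepsilon\, x^{7/12+\varepsilon},$$ that is, $\mathcal{N}(x)=c_0x+O_{\varepsilon}(x^{7/12+\varepsilon})$, where $\mathcal{N}(x)$ is the number of positive integers $n\le x$ for which $n^2+1$ is square-free and $$c_0=\prod_{p\equiv 1\bmod 4}\left(1-\frac{2}{p^{2}}\right),$$ the product being over primes $p\equiv 1\pmod 4$.
   Context: An integer is square-free if it is not divisible by the square of any prime. *)

(* Defs.v *)
From HB Require Import structures.
From mathcomp Require Import all_boot all_order all_algebra.
From mathcomp Require Import all_classical all_reals all_analysis.
Set Implicit Arguments.
Unset Strict Implicit.
Unset Printing Implicit Defensive.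
Import Order.TTheory GRing.Theory Num.Theory.
Import numFieldNormedType.Exports.
Local Open Scope classical_set_scope.
Local Open Scope ring_scope.

Definition squarefree (n : nat) : Prop :=
  forall p : nat, prime p -> ~~ (p ^ 2 %| n)%N.

(* [Num.truncn x] is the integer part of [x] when [0 <= x], and [0] when
   [x < 0], so the positive integers [n] with [n%:R <= x] are exactly those
   in [1 <= n < (Num.truncn x).+1]. *)
Definition Ncount (R : realType) (x : R) : nat :=
  (\sum_(1 <= n < (Num.truncn x).+1 | `[< squarefree (n ^ 2 + 1) >]) 1)%N.

(* The factors lie in ]0, 1[, so the partial products converge and the limit
   does not depend on the order in which the primes are taken. *)
Definition c0 (R : realType) : R :=
  limn (fun m : nat =>
    \prod_(0 <= p < m | prime p && (p == 1 %[mod 4])%N)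
      (1 - 2 / p%:R ^+ 2 : R)).

(* Main.v *)
(* A prime whose square divides [n^2 + 1] is [1 mod 4]. Inclusion-exclusion over these primes
   gives the main term from the square divisors [d^2] with [d < M], for [M] about [x^(7/12)];
   it remains to bound the number of pairs [(n, d)] with [n <= x], [d >= M], [d^2 | n^2 + 1].

   Such a pair gives Gaussian integers [w = a + ib], [z = u + iv] with [|w|^2 = d] and
   [w^2 z = n + i]. Cut the range of the slope [a / b] into about [M] intervals. By the
   pigeonhole principle the points of one interval satisfy a relation
   [u L1(a, b) + v L2(a, b) = 0], where [L1], [L2] are fixed nonzero integral binary forms,
   quadratic in general and linear for large [d]. As [(u, v)] is primitive,
   [(L1, L2)(a, b) = g (- v, u)] with [g] dividing a resultant, so [g] takes few values, and
   [im w^2 z = 1] turns into a Thue equation [G(a, b) = - g] of degree at most 4. Moreover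
   the form induced by [G] on the lattice spanned by two solutions is divisible by [g] for
   solutions of one class. If the linear factors of [G] also take close values at the two
   solutions, the quotient is a monic integral polynomial with all its roots near [-1],
   hence a power of [X + 1]. This leaves [x^o(1)] points for each interval, apart from
   explicit exceptions: few values of [n], and points near a line of small height. *)
Require Import Defs.
From HB Require Import structures.
From mathcomp Require Import all_boot all_order all_algebra all_field.
From mathcomp Require Import boolp.
From mathcomp Require Import ring lra zify.
Set Implicit Arguments.
Unset Strict Implicit.
Unset Printing Implicit Defensive.
Import Order.TTheory GRing.Theory Num.Theory.
Local Open Scope ring_scope.

(** * Integral forms with few solutions *)

(** The exponent comes from one balance. With [M = N^th], four scales against four unknowns force
    [be^4 M^3 >= N^3], so linear forms serve only for [d >= be^2], with [be] about
    [N^(3 (1 - th) / 4)]. Below that, quadratic forms are used, and their exceptions lie near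
    primitive vectors of length at most [Em], about [(C V)^(1/2)], where [C = be^2 / M] bounds
    determinants and [V = N / M] bounds [u] and [v]. There are about [C Em be] of them, and
    [C Em be = M] reads [7/2 - 5 th = th], that is [th = 7/12]. Both pigeonhole steps use as many
    linear conditions as unknowns, so the height of the coefficients cancels from the count and may
    be a power of [N]. This is harmless, since the height enters only through a logarithm (the
    number of scales in a colour) and through divisor functions. The obstacle is that equal colours
    are not contradictory by themselves: a pencil can really be a power of [X + 1]. Degree 2
    excludes this by the discriminant, degree 3 turns it into a cubic condition on [n], and degree 4
    into collinearity of three points. *)

Definition homog (A : comNzRingType) (s : nat) (p : {poly A}) (a b : A) : A :=
  \sum_(i < s.+1) p`_i * a ^+ i * b ^+ (s - i).

Lemma homog_mulXsubC (A : comNzRingType) s (q : {poly A}) c a b :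
  (size q <= s.+1)%N ->
  homog s.+1 (('X - c%:P) * q) a b = (a - c * b) * homog s q a b.
Proof.
move=> sq; rewrite /homog mulrBl.
under eq_bigr => i _ do rewrite coefB coefXM coefCM mulrBl mulrBl.
rewrite sumrB mulrBl; congr (_ - _).
  rewrite big_ord_recl /= !mul0r add0r mulr_sumr.
  by apply: eq_bigr => i _; rewrite /= /bump add1n subSS exprS; ring.
rewrite big_ord_recr /= (nth_default _ sq) mulr0 !mul0r addr0 mulr_sumr.
by apply: eq_bigr => i _; rewrite subSn 1?exprS; [ring | rewrite -ltnS].
Qed.

(** A form of degree above that of [q] has roots at infinity, each contributing a factor [b]. This
    lets the degree [s] stay fixed even when leading coefficients of [G] vanish. *)
Lemma homog_Sn (A : comNzRingType) s (q : {poly A}) a b :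
  (size q <= s.+1)%N -> homog s.+1 q a b = b * homog s q a b.
Proof.
move=> sq; rewrite /homog big_ord_recr /= (nth_default _ sq) !mul0r addr0 mulr_sumr.
by apply: eq_bigr => i _; rewrite subSn 1?exprS; [ring | rewrite -ltnS].
Qed.

Lemma homog_prod (A : comNzRingType) (rs : seq A) c a b k :
  homog (size rs + k) (c%:P * \prod_(r <- rs) ('X - r%:P)) a b =
  c * (\prod_(r <- rs) (a - r * b)) * b ^+ k.
Proof.
have sz (l : seq A) : (size (c%:P * \prod_(r <- l) ('X - r%:P))%R <= (size l).+1)%N.
  rewrite -(size_prod_XsubC l (fun r => r)) mul_polyC; exact: size_scale_leq.
elim: rs => [|r rs IH] /=.
  rewrite !big_nil !mulr1 add0n; elim: k => [|k IHk].
    by rewrite /homog big_ord1 coefC /= !expr0 !mulr1.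
  by rewrite homog_Sn ?IHk ?exprS; [ring | rewrite (leq_trans (size_polyC_leq1 _))].
rewrite addSn !big_cons mulrCA homog_mulXsubC ?IH; first by ring.
by rewrite (leq_trans (sz rs)) // ltnS leq_addr.
Qed.

Lemma homog_map (A B : comNzRingType) (f : {rmorphism A -> B}) s (p : {poly A}) a b :
  f (homog s p a b) = homog s (map_poly f p) (f a) (f b).
Proof.
rewrite /homog rmorph_sum; apply: eq_bigr => i _.
by rewrite !rmorphM !rmorphXn coef_map.
Qed.

(* The form [G] restricted to the lattice spanned by [(a, b)] and [(a', b')]. *)
Definition pencil (s : nat) (G : {poly int}) (a b a' b' : int) : {poly int} :=
  homog s (map_poly polyC G) (a *: 'X + a'%:P) (b *: 'X + b'%:P).

Lemma prod_XaddC (A : comNzRingType) (es : seq A) :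
  \prod_(e <- es) ('X + e%:P) = \prod_(e <- [seq - e | e <- es]) ('X - e%:P).
Proof. by rewrite big_map; apply: eq_bigr => e _; rewrite polyCN opprK. Qed.

Lemma size_prod_XaddC (A : comNzRingType) (es : seq A) :
  size (\prod_(e <- es) ('X + e%:P)) = (size es).+1.
Proof. by rewrite prod_XaddC (size_prod_XsubC _ (fun e => e)) size_map. Qed.

Lemma monic_prod_XaddC (A : comNzRingType) (es : seq A) :
  \prod_(e <- es) ('X + e%:P) \is monic.
Proof. by rewrite prod_XaddC; apply: (monic_prod_XsubC _ _ (fun e => e)). Qed.

(** The sum of the absolute values of the coefficients is submultiplicative, and it is at most
    [1 + h] for each factor [X + e]. *)
Lemma sum_norm_coef_prod (es : seq algC) (h : algC) :
  (forall e, e \in es -> `|e| <= h) -> 0 <= h ->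
  \sum_(i < (size es).+1) `|(\prod_(e <- es) ('X + e%:P))`_i| <= (1 + h) ^+ size es.
Proof.
move=> + h0; elim: es => [|e es IH] hes.
  by rewrite big_ord1 big_nil coef1 normr1 expr0.
have IH1 := IH (fun x xin => hes x (mem_behead (s := e :: es) xin)).
have he := hes e (mem_head _ _).
set q := \prod_(e <- es) ('X + e%:P) in IH1.
have sq : (size q <= (size es).+1)%N.
  by rewrite size_prod_XaddC.
rewrite big_cons -/q.
apply: (@le_trans _ _ (\sum_(i < (size es).+2) (`|('X * q)`_i| + `|e| * `|q`_i|))).
  apply: ler_sum => i _; rewrite mulrDl coefD coefCM.
  by rewrite (le_trans (ler_normD _ _)) // normrM.
have -> : \sum_(i < (size es).+2) (`|('X * q)`_i| + `|e| * `|q`_i|) =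
    \sum_(i < (size es).+1) `|q`_i| + \sum_(i < (size es).+2) `|e| * `|q`_i|.
  rewrite big_split /=; congr (_ + _).
  by rewrite big_ord_recl coefXM normr0 add0r; apply: eq_bigr => i _; rewrite coefXM.
rewrite -mulr_sumr [X in _ + _ * X]big_ord_recr /= (nth_default _ sq) normr0 addr0.
rewrite exprS mulrDl mul1r lerD //.
by apply: ler_pM => //; apply: sumr_ge0.
Qed.

Lemma int_norm_lt1 (m : int) : `|m%:~R : algC| < 1 -> m = 0.
Proof. by rewrite -intr_norm (ltr_int _ _ 1) => h; lia. Qed.

(* A monic integral polynomial with all its roots close to [-1]: after the shift
   [X -> X - 1] its lower coefficients are integers of absolute value [< 1]. *)
Lemma monic_cluster (Q : {poly int}) (ys : seq algC) : (size ys <= 4)%N ->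
  map_poly intr Q = \prod_(y <- ys) ('X + y%:P) ->
  (forall y, y \in ys -> `|y - 1| <= 8%:R^-1) ->
  Q = ('X + 1) ^+ size ys.
Proof.
move=> s4 hQ hys.
pose Q1 := Q \Po ('X - 1).
have hQ1 : map_poly (intr : int -> algC) Q1 = \prod_(e <- [seq y - 1 | y <- ys]) ('X + e%:P).
  rewrite /Q1 map_comp_poly hQ rmorphB /= map_polyX rmorph1 big_map.
  rewrite -[LHS]/(comp_poly _ _) rmorph_prod; apply: eq_bigr => y _.
  by rewrite /= rmorphD /= comp_polyX comp_polyC polyCB polyC1; ring.
have h8 : (0 : algC) <= 8%:R^-1 by rewrite invr_ge0.
have hes e : e \in [seq y - 1 | y <- ys] -> `|e| <= 8%:R^-1.
  by case/mapP => y yin ->; apply: hys.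
have := sum_norm_coef_prod hes h8; rewrite -hQ1 size_map.
set n := size ys in s4 *.
have hlead : Q1`_n = 1.
  have : (map_poly intr Q1)`_n = 1 :> algC.
    have := monic_prod_XaddC [seq y - 1 | y <- ys].
    by rewrite monicE lead_coefE size_prod_XaddC size_map hQ1 => /eqP.
  by rewrite coef_map /= => /eqP; rewrite -[1]/(1%:~R) eqr_int => /eqP.
have hsize : (size Q1 <= n.+1)%N.
  rewrite -(size_map_inj_poly (f := (intr : int -> algC))) //; last first.
  - exact: intr_inj.
  by rewrite hQ1 size_prod_XaddC size_map.
rewrite big_ord_recr /= coef_map /= hlead normr1 => hsum.
(* Degree at most 4 and distance [1/8] are matched here: the coefficients of [Q1] sum to less than 2
   in absolute value, and the leading 1 leaves less than 1 for all the others together. *)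
have hpow : (1 + 8%:R^-1) ^+ n < 2 :> algC.
  apply: (@le_lt_trans _ _ ((1 + 8%:R^-1) ^+ 4)).
    by apply: ler_weXn2l => //; rewrite lerDl.
  rewrite -subr_gt0.
  have -> : 2 - (1 + 8%:R^-1) ^+ 4 = 7 * 233 / (64 * 64) :> algC by field.
  by rewrite divr_gt0 ?mulr_gt0 ?ltr0n.
have hlow i : (i < n)%N -> Q1`_i = 0.
  move=> lin; apply: int_norm_lt1.
  apply: (@le_lt_trans _ _ (\sum_(j < n) `|(map_poly intr Q1)`_j : algC|)).
    rewrite (bigD1 (Ordinal lin)) //= coef_map lerDl; exact: sumr_ge0.
  have := le_lt_trans hsum hpow; rewrite -[2]/(1 + 1) ltrD2r; apply.
have -> : Q = Q1 \Po ('X + 1).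
  rewrite /Q1 -comp_polyA rmorphB /= comp_polyX rmorph1.
  by rewrite addrK comp_polyXr.
suff -> : Q1 = 'X^n by rewrite rmorphXn /= comp_polyX.
apply/polyP => i; rewrite coefXn; case: (ltngtP i n) => [/hlow //|lni|->]; last by [].
by rewrite nth_default // (leq_trans hsize).
Qed.

(** * Colours: dyadic scale and rounded position of a complex number *)

Definition scale_index (T : nat) (y : algC) : nat :=
  find (fun e => `|y| * 2 ^+ T < 2 ^+ e.+1) (iota 0 (2 * T)).

(** Squares of side [r / 16]. For [|x| <= 2 r] the floor lies between -32 and 32, so the shift by 32
    gives 65 values; this is the 65 in [colour]. *)
Definition cell (r x : algC) : nat := absz (Num.floor (16 * x / r) + 32).

Definition colour (T : nat) (y : algC) : 'I_(2 * T).+1 * 'I_65 * 'I_65 :=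
  let e := scale_index T y in let r := 2 ^+ e / 2 ^+ T in
  (inord e, inord (cell r ('Re y)), inord (cell r ('Im y))).

Lemma scale_indexP T y : 2 ^- T <= `|y| -> `|y| < 2 ^+ T ->
  let r := 2 ^+ scale_index T y / 2 ^+ T in
  [/\ (scale_index T y < 2 * T)%N, r <= `|y| & `|y| < 2 * r].
Proof.
move=> ylo yhi r; set e := scale_index T y in r *.
have p2 n : (0 : algC) < 2 ^+ n by rewrite exprn_gt0.
have Tpos : (0 < T)%N.
  by case: T ylo yhi {r e} => // h1 h2; have := le_lt_trans h1 h2; rewrite !expr0 invr1 ltxx.
have hhas : has (fun e => `|y| * 2 ^+ T < 2 ^+ e.+1) (iota 0 (2 * T)).
  apply/hasP; exists (2 * T).-1; first by rewrite mem_iota; lia.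
  rewrite prednK; last lia.
  by rewrite mul2n -addnn exprD ltr_pM2r.
have elt : (e < 2 * T)%N by move: hhas; rewrite has_find size_iota.
split => //.
  rewrite ler_pdivrMr //; case: (posnP e) => [->|epos].
    by rewrite expr0 -ler_pdivrMr // div1r.
  have := @before_find _ 0%N (fun e => `|y| * 2 ^+ T < 2 ^+ e.+1) (iota 0 (2 * T)) e.-1.
  rewrite -/(scale_index T y) -/e prednK // leqnn nth_iota; last lia.
  rewrite add0n => /(_ isT) /negbT; rewrite -real_leNgt ?prednK //.
  - by rewrite ger0_real // ltW.
  - by rewrite ger0_real // mulr_ge0 // ltW.
rewrite mulrA -exprS ltr_pdivlMr //.
have := nth_find 0%N hhas; rewrite -/(scale_index T y) -/e nth_iota //.
Qed.

Lemma cell_lt r x : 0 < r -> x \is Num.real -> `|x| <= 2 * r -> (cell r x < 65)%N.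
Proof.
move=> r0 xr; rewrite real_ler_norml // => /andP[h1 h2].
have xrr : 16 * x / r \is Num.real.
  by rewrite !realM // ?realV ?gtr0_real // ger0_real.
have /andP[f1 f2] := real_floor_itv xrr.
have : (Num.floor (16 * x / r))%:~R <= (32%:~R : algC).
  rewrite (le_trans f1) // ler_pdivrMr //.
  have -> : (32%:~R : algC) * r = 16 * (2 * r) by ring.
  by rewrite ler_pM2l.
have : (-33)%:~R < (Num.floor (16 * x / r))%:~R :> algC.
  rewrite -(ltrD2r 1) -[X in _ < _ + X]/(1%:~R) -intrD (le_lt_trans _ f2) //.
  rewrite ler_pdivlMr //.
  have -> : ((-33)%:~R + 1) * r = 16 * (- (2 * r)) :> algC by ring.
  by rewrite ler_pM2l.
rewrite ler_int ltr_int /cell; set f := Num.floor _; clearbody f; clear; lia.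
Qed.

Lemma cell_close r x y : 0 < r -> x \is Num.real -> y \is Num.real ->
  `|x| <= 2 * r -> `|y| <= 2 * r -> cell r x = cell r y -> `|x - y| <= r / 16.
Proof.
move=> r0 xr yr.
have aux z : z \is Num.real -> `|z| <= 2 * r ->
    16 * z / r - 1 < (Num.floor (16 * z / r))%:~R /\
    (Num.floor (16 * z / r))%:~R <= 16 * z / r /\
    (0 <= Num.floor (16 * z / r) + 32).
  move=> zr; rewrite real_ler_norml // => /andP[h1 h2].
  have zrr : 16 * z / r \is Num.real.
    by rewrite !realM // ?realV ?gtr0_real // ger0_real.
  have /andP[f1 f2] := real_floor_itv zrr.
  split; first by rewrite ltrBlDr -[X in _ < _ + X]/(1%:~R) -intrD.
  split=> //.
  have : (-33)%:~R < (Num.floor (16 * z / r))%:~R :> algC.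
    rewrite -(ltrD2r 1) -[X in _ < _ + X]/(1%:~R) -intrD (le_lt_trans _ f2) //.
    rewrite ler_pdivlMr //.
    have -> : ((-33)%:~R + 1) * r = 16 * (- (2 * r)) :> algC by ring.
    by rewrite ler_pM2l.
  by rewrite ltr_int; move: (Num.floor _); clear; lia.
move=> hx hy; have [x1 [x2 x3]] := aux x xr hx; have [y1 [y2 y3]] := aux y yr hy.
rewrite /cell => hc.
have fe : Num.floor (16 * x / r) = Num.floor (16 * y / r).
  move: (Num.floor _) (Num.floor _) x3 y3 hc; clear; lia.
have key u v : 16 * u / r - 1 < (Num.floor (16 * x / r))%:~R ->
    (Num.floor (16 * x / r))%:~R <= 16 * v / r -> u - v <= r / 16.
  move=> h1 h2; have := lt_le_trans h1 h2; rewrite ltrBlDr => /ltW.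
  have -> : 16 * v / r + 1 = (16 * v + r) / r by field; rewrite gt_eqF.
  rewrite ler_pM2r ?invr_gt0 // => h.
  have -> : u - v = (16 * u - 16 * v) / 16 by field.
  by rewrite ler_pM2r ?invr_gt0 // lerBlDr addrC.
rewrite real_ler_norml ?realB //; apply/andP; split.
  by rewrite lerNl opprB; apply: key => //; rewrite fe.
by apply: key => //; rewrite fe.
Qed.

(** Both points lie in one square of side [r / 16] with [r <= |y|], so they differ by at most
    [r / 16] in each coordinate and hence by at most [|y| / 8]. *)
Lemma colour_close T y y' : 2 ^- T <= `|y| -> `|y| < 2 ^+ T ->
  2 ^- T <= `|y'| -> `|y'| < 2 ^+ T ->
  colour T y = colour T y' -> `|y' / y - 1| <= 8%:R^-1.
Proof.
move=> a1 a2 b1 b2.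
have [e1 r1 s1] := scale_indexP a1 a2; have [e2 r2 s2] := scale_indexP b1 b2.
rewrite /colour => -[] /(congr1 val) /=.
rewrite !inordK ?ltnS ?(ltnW e1) ?(ltnW e2) // => ee.
rewrite -ee in r2 s2 *; set r := 2 ^+ _ / 2 ^+ T in r1 s1 r2 s2 *.
have r0 : 0 < r by rewrite divr_gt0 ?exprn_gt0.
have bnd z : `|z| < 2 * r -> `|'Re z| <= 2 * r /\ `|'Im z| <= 2 * r.
  move=> hz; split; apply: le_trans (ltW hz).
    exact: (leif_normC_Re_Creal z).1.
  rewrite -(@ler_pXn2r _ 2) // ?nnegrE // real_normK ?Creal_Im //.
  by rewrite normC2_Re_Im lerDr -real_normK ?Creal_Re // exprn_ge0.
have [yR yI] := bnd y s1; have [y'R y'I] := bnd y' s2.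
move=> /(congr1 val) /=; rewrite !inordK ?cell_lt ?Creal_Re // => hR.
move=> /(congr1 val) /=; rewrite !inordK ?cell_lt ?Creal_Im // => hI.
have cR := cell_close r0 (Creal_Re y') (Creal_Re y) y'R yR (esym hR).
have cI := cell_close r0 (Creal_Im y') (Creal_Im y) y'I yI (esym hI).
have y0 : 0 < `|y| by apply: lt_le_trans r1.
have -> : y' / y - 1 = (y' - y) / y by field; rewrite -normr_gt0.
rewrite normrM normfV ler_pdivrMr //.
have -> : y' - y = ('Re y' - 'Re y) + 'i * ('Im y' - 'Im y).
  by rewrite {1}(Crect y') {1}(Crect y); ring.
apply: le_trans (ler_normD _ _) _; rewrite normrM normCi mul1r.
apply: (@le_trans _ _ (r / 16 + r / 16)); first exact: lerD.
have -> : r / 16 + r / 16 = 8%:R^-1 * r by field.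
by rewrite ler_pM2l // invr_gt0.
Qed.

(** Indices beyond [size rs] stand for the roots at infinity, so that a form of degree [s] always
    has exactly [s] factors to colour. *)
Definition linear_factor (A : comNzRingType) (rs : seq A) (i : nat) (x y : A) : A :=
  if (i < size rs)%N then x - rs`_i * y else y.

Lemma homog_linear_factors (A : comNzRingType) (rs : seq A) s c a b :
  (size rs <= s)%N ->
  homog s (c%:P * \prod_(r <- rs) ('X - r%:P)) a b =
  c * \prod_(i < s) linear_factor rs i a b.
Proof.
move=> ls; rewrite -{1}(subnKC ls) homog_prod -mulrA; congr (_ * _).
rewrite -(big_mkord xpredT (fun i => linear_factor rs i a b)).
rewrite (big_cat_nat (n := size rs)) //=; congr (_ * _).
  rewrite (big_nth 0) !big_mkord; apply: eq_bigr => i _.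
  by rewrite /linear_factor ltn_ord.
rewrite (eq_big_nat _ _ (F2 := fun=> b)); last first.
  by move=> i /andP[h _]; rewrite /linear_factor ltnNge h.
by rewrite prodr_const_nat.
Qed.

(** Cauchy's bound: if [|z| - 1 > H], the leading term exceeds [H] times the geometric sum of the
    lower powers of [|z|]. *)
Lemma root_norm_bound (p : {poly algC}) (H : nat) (z : algC) :
  (forall i, `|p`_i| <= H%:R) -> 1 <= `|lead_coef p| -> root p z ->
  `|z| <= H.+1%:R.
Proof.
move=> hp hl /eqP pz; rewrite real_leNgt ?ger0_real //; apply/negP => hz.
have p0 : p != 0 by apply/eqP => p0; move: hl; rewrite p0 lead_coef0 normr0 ler10.
have sp : size p = (size p).-1.+1 by rewrite prednK // lt0n size_poly_eq0.
move: pz; rewrite horner_coef sp big_ord_recr /= => /eqP.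
rewrite addrC addr_eq0 => /eqP /(congr1 Num.norm).
set n := (size p).-1; set x := `|z|; rewrite normrN normrM normrX -/x => E.
have x0 : 0 <= x by apply: normr_ge0.
have : x ^+ n <= H%:R * \sum_(i < n) x ^+ i.
  apply: (@le_trans _ _ (`|p`_n| * x ^+ n)).
    by rewrite ler_peMl ?exprn_ge0 // -lead_coefE.
  rewrite E mulr_sumr; apply: le_trans (ler_norm_sum _ _ _) _.
  by apply: ler_sum => i _; rewrite normrM normrX ler_wpM2r // exprn_ge0.
have S0 : 0 <= \sum_(i < n) x ^+ i by apply: sumr_ge0 => i _; rewrite exprn_ge0.
apply/negP; rewrite -real_ltNge ?realM ?ger0_real // ?exprn_ge0 //.
apply: (@le_lt_trans _ _ ((x - 1) * \sum_(i < n) x ^+ i)).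
  apply: ler_wpM2r => //; rewrite lerBrDr; apply: ltW; apply: le_lt_trans hz.
  by rewrite -natr1.
by rewrite -subrX1 ltrBlDr ltrDl.
Qed.

(** The exponent 8 covers both ends in [thue_colour]: the linear factors are at most [(H + 2)^2],
    and at least [(H + 2)^-7] where the form takes a nonzero integer value. *)
Definition log_range (H : nat) : nat := 8 * up_log 2 (H + 2).

Lemma log_rangeP H : ((H + 2) ^ 8 <= 2 ^ log_range H)%N.
Proof. by rewrite /log_range mulnC expnM leq_exp2r // up_logP. Qed.

(* The colour of [(a, b)] records the scale and the rounded value of each complex
   linear factor of [G] at [(a, b)]; equal colours force every root of [Q] to be
   within [1/8] of [-1], so that [monic_cluster] applies. *)
Lemma thue_colour (s H : nat) (G : {poly int}) :
  (s <= 4)%N -> (size G <= s.+1)%N -> G != 0 -> (0 < H)%N ->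
  (forall i, `|G`_i| <= H%:Z) ->
  exists col : int -> int ->
      {ffun 'I_s -> 'I_(2 * log_range H).+1 * 'I_65 * 'I_65},
    forall a b a' b' g (Q : {poly int}), g != 0 ->
      `|a| <= H%:Z -> `|b| <= H%:Z -> `|a'| <= H%:Z -> `|b'| <= H%:Z ->
      homog s G a b = g -> homog s G a' b' = g ->
      pencil s G a b a' b' = g *: Q -> col a b = col a' b' ->
      Q = ('X + 1) ^+ s.
Proof.
move=> s4 sG G0 H0 hG.
pose p := map_poly (intr : int -> algC) G.
have sp : size p = size G by apply: size_map_inj_poly => //; apply: intr_inj.
have [rs hp] := closed_field_poly_normal p.
set c := lead_coef p in hp.
have cE : c = (lead_coef G)%:~R.
  by rewrite /c lead_coefE sp coef_map /= -lead_coefE.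
have c1 : 1 <= `|c|.
  rewrite cE -intr_norm ler1z; move: G0; rewrite -lead_coef_eq0; lia.
have cH : `|c| <= H%:R.
  by rewrite cE -intr_norm -[H%:R]/(H%:Z%:~R) ler_int lead_coefE hG.
have c0 : c != 0 by rewrite -normr_gt0 (lt_le_trans _ c1).
have srs : size p = (size rs).+1.
  by rewrite hp size_scale // (size_prod_XsubC _ (fun r => r)).
have ls : (size rs <= s)%N by rewrite -ltnS -srs sp.
have hrs r : r \in rs -> `|r| <= H.+1%:R.
  move=> rin; apply: (@root_norm_bound p) => //.
    by move=> i; rewrite coef_map /= -intr_norm -[H%:R]/(H%:Z%:~R) ler_int.
  by rewrite hp rootZ // root_prod_XsubC.
pose ell i (a b : int) : algC := linear_factor rs i a%:~R b%:~R.
have homE a b : (homog s G a b)%:~R = c * \prod_(i < s) ell i a b.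
  by rewrite (homog_map (intr : int -> algC)) -/p hp -mul_polyC homog_linear_factors.
pose T := log_range H.
have HT : ((H.+2)%:R ^+ 8 <= 2 ^+ T :> algC).
  by rewrite -!natrX ler_nat -addn2; exact: log_rangeP.
have H1 : (1 : algC) <= H.+2%:R by rewrite ler1n.
have U i a b : `|a| <= H%:Z -> `|b| <= H%:Z -> `|ell i a b| <= H.+2%:R ^+ 2.
  move=> ha hb.
  have ha' : `|a%:~R : algC| <= H%:R by rewrite -intr_norm -[H%:R]/(H%:Z%:~R) ler_int.
  have hb' : `|b%:~R : algC| <= H%:R by rewrite -intr_norm -[H%:R]/(H%:Z%:~R) ler_int.
  rewrite /ell /linear_factor; case: ifP => hi.
    apply: le_trans (ler_normB _ _) _; rewrite normrM.
    apply: (@le_trans _ _ (H%:R + H.+1%:R * H%:R)).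
      by apply: lerD => //; apply: ler_pM => //; apply: hrs; apply: mem_nth.
    by rewrite -!natrX -natrM -natrD ler_nat; lia.
  by apply: le_trans hb' _; rewrite -natrX ler_nat; lia.
have hi_lt i a b : `|a| <= H%:Z -> `|b| <= H%:Z -> `|ell i a b| < 2 ^+ T.
  move=> ha hb; apply: le_lt_trans (U i a b ha hb) _; apply: lt_le_trans HT.
  by rewrite ltr_eXn2l // ltr1n.
(* A nonzero integer is at least 1 in absolute value; dividing by the leading coefficient (at most
   [H]) and by at most three other factors (each at most [(H + 2)^2]) bounds the remaining one from
   below. *)
have lo_le (i : 'I_s) a b : `|a| <= H%:Z -> `|b| <= H%:Z -> homog s G a b != 0 ->
    2 ^- T <= `|ell i a b|.
  move=> ha hb hg.
  have := homE a b; rewrite (bigD1 i) //= => /(congr1 Num.norm).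
  rewrite !normrM -intr_norm normr_prod => E.
  have g1 : (1 : algC) <= (`|homog s G a b|)%:~R by rewrite ler1z; lia.
  rewrite E in g1.
  have T0 : (0 : algC) < 2 ^+ T by rewrite exprn_gt0.
  rewrite -[2 ^- T]mul1r ler_pdivrMr //.
  apply: le_trans g1 _; rewrite mulrCA ler_wpM2l //; apply: le_trans HT.
  apply: (@le_trans _ _ (H.+2%:R * (H.+2%:R ^+ 2) ^+ 3)); last first.
    by rewrite -exprM -exprS ler_weXn2l.
  apply: ler_pM => //; first exact: prodr_ge0.
    by rewrite (le_trans cH) // ler_nat; lia.
  apply: (@le_trans _ _ (\prod_(j < s | j != i) H.+2%:R ^+ 2)).
    by apply: ler_prod => j _; rewrite normr_ge0 U.
  rewrite prodr_const ler_weXn2l // ?exprn_ege1 //.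
  rewrite (_ : #|_| = s.-1); first by clear -s4; lia.
  by rewrite -[in RHS](card_ord s) -(cardC1 i); apply: eq_card.
exists (fun a b => [ffun i : 'I_s => colour T (ell i a b)]).
move=> a b a' b' g Q g0 ha hb ha' hb' hw hw' hpen hcol.
have lw (i : 'I_s) : ell i a b != 0.
  rewrite -normr_gt0; apply: lt_le_trans (lo_le i a b ha hb _); last by rewrite hw.
  by rewrite invr_gt0 exprn_gt0.
have pencilE : map_poly (intr : int -> algC) (pencil s G a b a' b') =
    c *: \prod_(i < s) (ell i a b *: 'X + (ell i a' b')%:P).
  rewrite /pencil (homog_map (map_poly (intr : int -> algC))).
  have -> : map_poly (map_poly (intr : int -> algC)) (map_poly polyC G) =
            (map_poly polyC p).
    by rewrite -!map_poly_comp; apply: eq_map_poly => x /=; rewrite map_polyC.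
  have -> : map_poly polyC p = c%:P%:P * \prod_(r <- map polyC rs) ('X - r%:P).
    rewrite hp map_polyZ /= mul_polyC big_map rmorph_prod; congr (_ *: _).
    by apply: eq_bigr => r _; rewrite rmorphB /= map_polyX map_polyC.
  rewrite homog_linear_factors ?size_map // mul_polyC; congr (_ *: _).
  apply: eq_bigr => i _.
  rewrite /ell /linear_factor size_map !rmorphD /= -!mul_polyC !rmorphM /=.
  rewrite !map_polyC !map_polyX /=.
  case: ifP => hi //.
  by rewrite (nth_map 0) // !rmorphB !rmorphM /=; ring.
pose ys := [seq ell i a' b' / ell i a b | i : 'I_s].
have sys : size ys = s by rewrite size_map -cardE card_ord.
rewrite -sys; apply: monic_cluster; first by rewrite sys.
- have gE : (g%:~R : algC) != 0 by rewrite intr_eq0.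
  apply: (scalerI gE).
  have := pencilE; rewrite hpen map_polyZ /= => ->.
  rewrite -hw homE -scalerA; congr (_ *: _).
  rewrite /ys big_map big_enum /= -scaler_prod.
  apply: eq_bigr => i _; rewrite scalerDr -!mul_polyC -polyCM; congr (_ + _%:P).
  by rewrite mulrC divfK.
- move=> y /mapP[i _ ->]; apply: (@colour_close T); rewrite ?hi_lt ?lo_le ?hw ?hw' //.
  by move/ffunP/(_ i): hcol; rewrite !ffunE.
Qed.

(** * Points on a relation *)

(** Imaginary part of [(a + ib)^2 (u + iv)]; [re_form] is the real part. *)
Definition im_form (A : comNzRingType) (a b u v : A) : A :=
  2 * a * b * u + (a ^+ 2 - b ^+ 2) * v.
Definition re_form (A : comNzRingType) (a b u v : A) : A :=
  (a ^+ 2 - b ^+ 2) * u - 2 * a * b * v.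

Lemma intmul_eq1 (x y : int) : x * y = 1 -> y = 1 \/ y = -1.
Proof. by move/(congr1 absz); rewrite abszM => /eqP; rewrite muln_eq1; lia. Qed.

Lemma card_fibers (T : finType) (F : eqType) (f : T -> F) (cs : seq F)
    (S : {set T}) (B : nat) :
  (forall x, x \in S -> f x \in cs) ->
  (forall c, c \in cs -> (#|[set x in S | f x == c]| <= B)%N) ->
  (#|S| <= B * size cs)%N.
Proof.
elim: cs S => [|c cs IH] S hcs hB.
  rewrite muln0 leqn0 cards_eq0; apply/eqP/setP => x; rewrite inE.
  by apply/negP => /hcs.
rewrite -(cardsID [set x in S | f x == c] S) /= mulnS leq_add //.
  apply: leq_trans (hB c (mem_head _ _)); apply: subset_leq_card.
  by apply/subsetP => x; rewrite !inE => /andP[_].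
apply: IH => [x|c' hc'].
  rewrite !inE => /andP[h xS]; have := hcs x xS.
  by rewrite inE; move: h; rewrite xS /= => /negPf ->.
apply: leq_trans (hB c' _); last by rewrite inE hc' orbT.
apply: subset_leq_card; apply/subsetP => x; rewrite !inE.
by case/andP => /andP[_ -> ->].
Qed.

Lemma card_le2 (T : finType) (S : {set T}) :
  (forall x y z, x \in S -> y \in S -> z \in S ->
     x != y -> y != z -> z != x -> False) -> (#|S| <= 2)%N.
Proof.
move=> h; rewrite leqNgt; apply/negP => /card_gt2P[x [y [z [[xS yS zS] [xy yz zx]]]]].
exact: (h x y z).
Qed.

Definition signed_divisors (m : int) : seq int :=
  [seq d%:Z | d <- divisors `|m|] ++ [seq - d%:Z | d <- divisors `|m|].

Lemma mem_signed_divisors (m d : int) : m != 0 -> (d %| m)%Z -> d \in signed_divisors m.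
Proof.
move=> m0 dm; rewrite mem_cat.
have hd : `|d|%N \in divisors `|m| by rewrite -dvdn_divisors ?absz_gt0.
case: (lerP 0 d) => hd0; [have -> : d = `|d|%N by lia | have -> : d = - `|d|%N%:Z by lia].
  by rewrite map_f.
by rewrite (map_f (fun d : nat => - d%:Z)) ?orbT.
Qed.

Definition num_div (m : int) : nat := size (divisors `|m|).

Lemma size_signed_divisors m : size (signed_divisors m) = (2 * num_div m)%N.
Proof. by rewrite size_cat !size_map mul2n addnn. Qed.

Lemma horner_pencil s G a b a' b' (t : int) :
  (pencil s G a b a' b').[t] = homog s G (a * t + a') (b * t + b').
Proof.
rewrite /pencil -/(horner_eval t _) (homog_map (horner_eval t)).
rewrite -map_poly_comp map_poly_id => [|x _]; last by rewrite /= /horner_eval hornerC.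
by congr homog; rewrite /= /horner_eval !hornerE.
Qed.

Lemma homog_poly2 (A : comNzRingType) (c : int -> A) (c0 c1 c2 : int) (x y : A) : c 0 = 0 ->
  homog 2 (map_poly c (Poly [:: c0; c1; c2])) x y =
  c c0 * y ^+ 2 + c c1 * x * y + c c2 * x ^+ 2.
Proof.
move=> h0; rewrite /homog !big_ord_recl big_ord0 !coef_map_id0 // !coef_Poly /=.
by rewrite /bump /= !subn0 /=; ring.
Qed.

Lemma homog_poly3 (A : comNzRingType) (c : int -> A) (c0 c1 c2 c3 : int) (x y : A) : c 0 = 0 ->
  homog 3 (map_poly c (Poly [:: c0; c1; c2; c3])) x y =
  c c0 * y ^+ 3 + c c1 * x * y ^+ 2 + c c2 * x ^+ 2 * y + c c3 * x ^+ 3.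
Proof.
move=> h0; rewrite /homog !big_ord_recl big_ord0 !coef_map_id0 // !coef_Poly /=.
by rewrite /bump /= !subn0 /=; ring.
Qed.

Lemma homog_poly4 (A : comNzRingType) (c : int -> A) (c0 c1 c2 c3 c4 : int) (x y : A) :
  c 0 = 0 ->
  homog 4 (map_poly c (Poly [:: c0; c1; c2; c3; c4])) x y =
  c c0 * y ^+ 4 + c c1 * x * y ^+ 3 + c c2 * x ^+ 2 * y ^+ 2 + c c3 * x ^+ 3 * y
  + c c4 * x ^+ 4.
Proof.
move=> h0; rewrite /homog !big_ord_recl big_ord0 !coef_map_id0 // !coef_Poly /=.
by rewrite /bump /= !subn0 /=; ring.
Qed.

(* These values of [n] are the exceptions in the cubic case: [n] takes this shape
   when [im_form] restricted to a pencil is [(X + 1)^3]. *)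
Definition cubic_value (n : int) : Prop := exists r : int, 2 * n = r ^+ 3 + 3 * r.

(** With [h / m = h' / m'] in lowest terms, the equation makes [m'] divide [h'^3], so [m'] is 1 or
    -1 and the rational [r = h / m] is an integer. *)
Lemma cubic_valueP (h m n : int) : m != 0 ->
  2 * m ^+ 3 * n = h ^+ 3 + 3 * h * m ^+ 2 -> cubic_value n.
Proof.
move=> m0; set g := gcdz h m.
have g0 : g != 0 by rewrite gcdz_eq0 (negPf m0) andbF.
have [[h' eh] [m' em]] : (exists h', h = h' * g) /\ (exists m', m = m' * g).
  by split; apply/dvdzP; [apply: dvdz_gcdl | apply: dvdz_gcdr].
have m'0 : m' != 0 by apply: contraNneq m0 => m'0; rewrite em m'0 mul0r.
have cop : coprimez h' m'.
  have [x [y hxy]] := Bezoutz h m.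
  apply/coprimezP; exists (x, y); apply: (mulfI g0); rewrite mulr1 /= -[RHS]hxy.
  by rewrite [in RHS]eh [in RHS]em; ring.
rewrite eh em => E.
have E' : 2 * m' ^+ 3 * n = h' ^+ 3 + 3 * h' * m' ^+ 2.
  by apply: (mulfI (expf_neq0 3 g0)); transitivity (2 * (m' * g) ^+ 3 * n); [ring | rewrite E; ring].
have : (m' %| h' ^+ 3)%Z.
  have -> : h' ^+ 3 = m' * (2 * m' ^+ 2 * n - 3 * h' * m').
    by apply: (addIr (3 * h' * m' ^+ 2)); rewrite -E'; ring.
  exact: dvdz_mulr.
move=> d3.
have d1 : (m' %| 1)%Z.
  have c3 : coprimez m' (h' ^+ 3) by rewrite coprimezXr // coprimez_sym.
  by have := dvdz_gcd m' m' (h' ^+ 3); rewrite dvdzz d3 (eqP c3).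
have [k /esym hk] := dvdzP d1.
case: (intmul_eq1 hk) => m1; rewrite m1 in E'.
  by exists h'; move: E'; rewrite !expr1n !mulr1.
exists (- h'); have -> : 2 * n = - (2 * (-1) ^+ 3 * n) by ring.
by rewrite E'; ring.
Qed.

(** The hypotheses are the values of a binary cubic at [(1, 0)], [(0, 1)], [(1, 1)] and [(-1, 1)],
    which identify it as [(X + Y)^3]. For [w = a + ib] and [w' = a' + ib'], the number [h + i mu] is
    [w] times the conjugate of [w'], and [m = |w|^2]; the resulting [r] is [(h - m) / mu]. *)
Lemma cubic_value_of_pencil (a b u v a' b' u' v' : int) :
  im_form a b u v = 1 -> im_form a' b' u' v' = 1 ->
  im_form (a + a') (b + b') (u + u') (v + v') = 8 ->
  im_form (a' - a) (b' - b) (u' - u) (v' - v) = 0 ->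
  b * a' - a * b' != 0 -> cubic_value (re_form a b u v).
Proof.
move=> E1 E4 Ep Em mu0.
pose E2 := 2 * a * b * u' + (a ^+ 2 - b ^+ 2) * v'
           + 2 * (a * b' + a' * b) * u + 2 * (a * a' - b * b') * v.
pose E3 := 2 * a' * b' * u + (a' ^+ 2 - b' ^+ 2) * v
           + 2 * (a * b' + a' * b) * u' + 2 * (a * a' - b * b') * v'.
have e2 : E2 = 3.
  have : 2 * E2 = im_form (a + a') (b + b') (u + u') (v + v')
      + im_form (a' - a) (b' - b) (u' - u) (v' - v) - 2 * im_form a' b' u' v'.
    by rewrite /E2 /im_form; ring.
  by rewrite E4 Ep Em; lia.
have e3 : E3 = 3.
  have : 2 * E3 = im_form (a + a') (b + b') (u + u') (v + v')
      - im_form (a' - a) (b' - b) (u' - u) (v' - v) - 2 * im_form a b u v.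
    by rewrite /E3 /im_form; ring.
  by rewrite E1 Ep Em; lia.
pose h := a * a' + b * b'; pose m := a ^+ 2 + b ^+ 2; pose mu := b * a' - a * b'.
apply: (@cubic_valueP (h - m) mu) => //.
(* With [w = a + ib], [z = u + iv] and [F(X, Y) = im_form (X w + Y w') (X z + Y z')],
   evaluating [F] and [dF/dX] at [X = conj w'], [Y = - conj w] expresses
   [4 mu^3 w^2 z] through the coefficients [1, E2, E3, 1] of [F]. *)
have key : 4 * mu ^+ 3 * re_form a b u v =
    (2 * h ^+ 3 + 6 * h * mu ^+ 2) * im_form a b u v
    - 2 * m * (h ^+ 2 + mu ^+ 2) * E2 + 2 * h * m ^+ 2 * E3
    - 2 * m ^+ 3 * im_form a' b' u' v'.
  by rewrite /mu /re_form /h /m /im_form /E2 /E3; ring.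
apply: (mulfI (isT : (2 : int) != 0)).
transitivity (4 * mu ^+ 3 * re_form a b u v); first by ring.
by rewrite key E1 E4 e2 e3; ring.
Qed.

Definition quad (A B C x y : int) : int := A * x ^+ 2 + B * x * y + C * y ^+ 2.
Definition polar (A B C x y x' y' : int) : int :=
  2 * A * x * x' + B * (x * y' + x' * y) + 2 * C * y * y'.
Definition Mac (A1 C1 A2 C2 : int) : int := A1 * C2 - A2 * C1.

(* The resultant of the two quadratic forms. *)
Definition resq (A1 B1 C1 A2 B2 C2 : int) : int :=
  Mac A1 C1 A2 C2 ^+ 2 - Mac A1 B1 A2 B2 * Mac B1 C1 B2 C2.

(** Cofactor identities: with [resultant_mul_x3] they put the resultant times [x^3] and times [y^3]
    into the ideal of the two forms. So a common divisor of both values at a primitive vector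
    divides the resultant, and a nonzero resultant excludes a common zero. *)
Lemma resultant_mul_y3 A1 B1 C1 A2 B2 C2 x y :
  resq A1 B1 C1 A2 B2 C2 * y ^+ 3 =
  (Mac A1 C1 A2 C2 * y - Mac A1 B1 A2 B2 * x)
    * (A1 * quad A2 B2 C2 x y - A2 * quad A1 B1 C1 x y)
  + Mac A1 B1 A2 B2 * y * (B2 * quad A1 B1 C1 x y - B1 * quad A2 B2 C2 x y).
Proof. by rewrite /resq /Mac /quad; ring. Qed.

Lemma resultant_mul_x3 A1 B1 C1 A2 B2 C2 x y :
  resq A1 B1 C1 A2 B2 C2 * x ^+ 3 =
  (Mac B1 C1 B2 C2 * y - Mac A1 C1 A2 C2 * x)
    * (C1 * quad A2 B2 C2 x y - C2 * quad A1 B1 C1 x y)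
  + - Mac B1 C1 B2 C2 * x * (B2 * quad A1 B1 C1 x y - B1 * quad A2 B2 C2 x y).
Proof. by rewrite /resq /Mac /quad; ring. Qed.

(* In a basis [w1, e] of [Z^2] both [w2 = p2 w1 + d2 e] and [w3 = p3 w1 + d3 e] satisfy
   [d (p B(w1, e) + d q(e)) = 0 mod g], and the hypothesis on the gcds allows
   the factors [d2] and [d3] to be exchanged. *)
Lemma polar_dvd (g A B C a1 b1 a2 b2 a3 b3 c f : int) : a1 * f - b1 * c = 1 ->
  (g %| quad A B C a1 b1)%Z -> (g %| quad A B C a2 b2)%Z -> (g %| quad A B C a3 b3)%Z ->
  gcdz (a1 * b2 - b1 * a2) g = gcdz (a1 * b3 - b1 * a3) g ->
  (g %| polar A B C a2 b2 a3 b3)%Z.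
Proof.
move=> hcf d1 d2 d3; set D2 := a1 * b2 - b1 * a2; set D3 := a1 * b3 - b1 * a3 => hj.
pose p2 := a2 * f - b2 * c; pose p3 := a3 * f - b3 * c.
have w2 : a2 = p2 * a1 + D2 * c /\ b2 = p2 * b1 + D2 * f.
  by split; [rewrite -[LHS]mulr1 | rewrite -[LHS]mulr1]; rewrite -hcf /p2 /D2; ring.
have w3 : a3 = p3 * a1 + D3 * c /\ b3 = p3 * b1 + D3 * f.
  by split; [rewrite -[LHS]mulr1 | rewrite -[LHS]mulr1]; rewrite -hcf /p3 /D3; ring.
set l := quad A B C a1 b1 in d1; pose eb := polar A B C a1 b1 c f; pose le := quad A B C c f.
have q2 : quad A B C a2 b2 = p2 ^+ 2 * l + D2 * (p2 * eb + D2 * le).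
  by rewrite /quad w2.1 w2.2 /l /eb /le /quad /polar; ring.
have q3 : quad A B C a3 b3 = p3 ^+ 2 * l + D3 * (p3 * eb + D3 * le).
  by rewrite /quad w3.1 w3.2 /l /eb /le /quad /polar; ring.
have -> : polar A B C a2 b2 a3 b3 =
    2 * p2 * p3 * l + (D3 * (p2 * eb + D2 * le) + D2 * (p3 * eb + D3 * le)).
  by rewrite /polar w2.1 w2.2 w3.1 w3.2 /l /eb /le /quad /polar; ring.
have ex (D D' X : int) : gcdz D g = gcdz D' g -> (g %| D * X)%Z -> (g %| D' * X)%Z.
  move=> hh hd; have [s [t hst]] := Bezoutz D g.
  have /dvdzP[k hk] : (gcdz D g %| D')%Z by rewrite hh dvdz_gcdl.
  rewrite hk -hst.
  have -> : k * (s * D + t * g) * X = k * s * (D * X) + k * t * X * g by ring.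
  by apply: rpredD; [apply: dvdz_mull | apply: dvdz_mull].
apply: rpredD; first exact: dvdz_mull.
apply: rpredD.
  apply: (ex D2) => //; move: d2; rewrite q2 rpredDl //; exact: dvdz_mull.
apply: (ex D3) => //; move: d3; rewrite q3 rpredDl //; exact: dvdz_mull.
Qed.

(* The exceptions in the quartic case: points within a bounded determinant of a short
   primitive vector [e]. *)
Definition near_line (E C x y : int) : Prop :=
  exists e1 e2, [/\ coprimez e1 e2, e1 ^+ 2 + e2 ^+ 2 <= E, x * e2 - y * e1 != 0
                 & `|x * e2 - y * e1| <= C].

Lemma primitive_vector (k1 k2 : int) : (k1 != 0) || (k2 != 0) ->
  exists m e1 e2, [/\ m != 0, k1 = e1 * m, k2 = e2 * m & coprimez e1 e2].
Proof.
move=> k0; pose g := gcdz k1 k2.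
have g0 : g != 0 by rewrite gcdz_eq0 negb_and.
have /dvdzP[e1 h1] : (g %| k1)%Z by apply: dvdz_gcdl.
have /dvdzP[e2 h2] : (g %| k2)%Z by apply: dvdz_gcdr.
exists g, e1, e2; split => //.
have [x [y hxy]] := Bezoutz k1 k2.
apply/coprimezP; exists (x, y); apply: (mulfI g0); rewrite mulr1 /= -[RHS]hxy.
by rewrite [in RHS]h1 [in RHS]h2; ring.
Qed.

(** The relation says that [P2 + i P1] is parallel to [(e1 + i e2)^2]. As [(e1, e2)] is primitive
    the ratio is half an integer [k], so [|e|^2 <= 2 |P|], and [|P1|, |P2| <= 3 D] give
    [|e|^4 <= 72 D^2 <= 81 D^2]. *)
Lemma square_direction_bound (e1 e2 P1 P2 D : int) : coprimez e1 e2 ->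
  (e1 ^+ 2 - e2 ^+ 2) * P1 = 2 * e1 * e2 * P2 -> (P1 != 0) || (P2 != 0) ->
  `|P1| <= 3 * D -> `|P2| <= 3 * D -> 0 < D -> e1 ^+ 2 + e2 ^+ 2 <= 9 * D.
Proof.
move=> cop E P0 hP1 hP2 D0.
have [/eqP|e0] := boolP (e1 * e2 == 0).
  move/eqP; rewrite mulf_eq0 => /orP[] /eqP ez; move: cop; rewrite ez.
    rewrite /coprimez gcd0z => /eqP h.
    by have [->|->] : e2 = 1 \/ e2 = -1; clear -h D0; lia.
  rewrite /coprimez gcdz0 => /eqP h.
  by have [->|->] : e1 = 1 \/ e1 = -1; clear -h D0; lia.
have d1 : (e1 %| P1)%Z.
  have c1 : coprimez e1 (e2 ^+ 2) by rewrite coprimezXr.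
  rewrite -(Gauss_dvdzr P1 c1); apply/dvdzP; exists (e1 * P1 - 2 * e2 * P2).
  by transitivity (e1 ^+ 2 * P1 - (e1 ^+ 2 - e2 ^+ 2) * P1); [ring | rewrite E; ring].
have d2 : (e2 %| P1)%Z.
  have c1 : coprimez e2 (e1 ^+ 2) by rewrite coprimezXr // coprimez_sym.
  rewrite -(Gauss_dvdzr P1 c1); apply/dvdzP; exists (e2 * P1 + 2 * e1 * P2).
  by transitivity (e2 ^+ 2 * P1 + (e1 ^+ 2 - e2 ^+ 2) * P1); [ring | rewrite E; ring].
have /dvdzP[k hk] : (e1 * e2 %| P1)%Z by rewrite Gauss_dvdz // d1 d2.
have h2 : 2 * P2 = k * (e1 ^+ 2 - e2 ^+ 2).
  apply: (mulfI e0); transitivity (2 * e1 * e2 * P2); first ring.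
  by rewrite -E hk; ring.
have k0 : k != 0.
  apply: contraTneq P0 => kz; rewrite hk kz mul0r eqxx /=.
  by move: h2; rewrite kz mul0r => /eqP; rewrite mulf_eq0 => /orP[//|/eqP ->].
have key : (k * (e1 ^+ 2 + e2 ^+ 2)) ^+ 2 = (2 * P1) ^+ 2 + (2 * P2) ^+ 2.
  by rewrite h2 hk; ring.
have sq (P : int) : `|P| <= 3 * D -> (2 * P) ^+ 2 <= 36 * D ^+ 2.
  move=> hP; have -> : (2 * P) ^+ 2 = 4 * `|P| ^+ 2 by rewrite real_normK ?num_real; ring.
  have -> : 36 * D ^+ 2 = 4 * (3 * D) ^+ 2 by ring.
  by rewrite ler_pM2l // ler_pXn2r ?nnegrE ?normr_ge0 // mulr_ge0 // ltW.
have E0 : 0 <= e1 ^+ 2 + e2 ^+ 2 by rewrite addr_ge0 // sqr_ge0.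
rewrite -(@ler_pXn2r _ 2) ?nnegrE ?mulr_ge0 ?(ltW D0) //.
apply: (@le_trans _ _ ((k * (e1 ^+ 2 + e2 ^+ 2)) ^+ 2)).
  rewrite [X in _ <= X]exprMn ler_peMl ?sqr_ge0 // -[k ^+ 2]real_normK ?num_real //.
  by rewrite exprn_ege1 //; move: k0; clear; lia.
rewrite key; have := sq _ hP1; have := sq _ hP2 => s2 s1.
have -> : (9 * D) ^+ 2 = 36 * D ^+ 2 + 36 * D ^+ 2 + 9 * D ^+ 2 by ring.
by rewrite ler_wpDr ?lerD // mulr_ge0 // sqr_ge0.
Qed.

(** * Points [(a, b)] with companions [(u, v)] satisfying one relation *)

Section Points.
Variables (T : finType) (a b u v : T -> int) (H : nat).
Hypothesis b_gt0 : forall x, 0 < b x.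
Hypothesis im1 : forall x, im_form (a x) (b x) (u x) (v x) = 1.
Hypothesis inj_ab : forall x y, a x = a y -> b x = b y -> x = y.
Hypothesis (aH : forall x, `|a x| <= H%:Z) (bH : forall x, `|b x| <= H%:Z).
Hypothesis H_gt0 : (0 < H)%N.

Definition dt (x y : T) : int := a x * b y - b x * a y.

(** [im_form = 1] makes [(a, b)] primitive, so parallel points agree up to sign, and [b > 0] fixes
    the sign. *)
Lemma dt0_eq x y : dt x y = 0 -> x = y.
Proof.
rewrite /dt => /eqP; rewrite subr_eq0 => /eqP h.
have dv z t : a z * b t = b z * a t -> (b z %| b t)%Z.
  move=> e; have i1 := im1 z; rewrite /im_form in i1.
  apply/dvdzP; exists (2 * a z * u z * b t + a z * v z * a t - b z * v z * b t).
  apply: (etrans (esym (mulr1 _))); rewrite -{1}i1.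
  have -> : b t * (2 * a z * b z * u z + (a z ^+ 2 - b z ^+ 2) * v z) =
    2 * a z * b z * u z * b t + a z * v z * (a z * b t) - b z ^+ 2 * v z * b t by ring.
  rewrite e; ring.
have d1 := dv _ _ h.
have d2 : (b y %| b x)%Z by apply: dv; lia.
have hb : b x = b y.
  have h1 := b_gt0 x; have h2 := b_gt0 y.
  move: d1 d2 => /dvdzP[k e1] /dvdzP[l e2].
  have : b x * (l * k) = b x * 1 by rewrite mulr1 {2}e2 e1; ring.
  move/(mulfI (lt0r_neq0 h1)) => lk; have [k1|k1] := intmul_eq1 lk.
    by rewrite e1 k1 mul1r.
  by move: h2; rewrite e1 k1; lia.
apply: inj_ab => //; move: h; rewrite hb mulrC => /mulfI; apply.
by rewrite gt_eqF.
Qed.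

Definition ncol (s : nat) : nat := ((2 * log_range H).+1 * 65 * 65) ^ s.

Lemma card_colours s :
  #|{: {ffun 'I_s -> 'I_(2 * log_range H).+1 * 'I_65 * 'I_65}}| = ncol s.
Proof. by rewrite card_ffun !card_prod !card_ord. Qed.

(** With [(u, v)] fixed, [im_form] is a binary quadratic form of discriminant [4 (u^2 + v^2)]. Equal
    colours make its restriction to the lattice of the two points [(X + 1)^2], of discriminant zero;
    but that discriminant is [4 (u^2 + v^2)] times the square of the determinant of the points. *)
Lemma fixed_uv_count (S : {set T}) (u0 v0 : int) :
  `|u0| *+ 2 <= H%:Z -> `|v0| <= H%:Z ->
  (forall x, x \in S -> u x = u0 /\ v x = v0) -> (#|S| <= ncol 2)%N.
Proof.
move=> hu hv hS.
case: (set_0Vmem S) => [->|[x0 x0S]]; first by rewrite cards0.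
have [eu ev] := hS _ x0S.
have uv0 : (u0 != 0) || (v0 != 0).
  rewrite -negb_and; apply/negP => /andP[/eqP z1 /eqP z2].
  by have := im1 x0; rewrite eu ev z1 z2 /im_form !mulr0 addr0.
pose G := Poly [:: - v0; 2 * u0; v0].
have GE x y : homog 2 G x y = im_form x y u0 v0.
  by rewrite -[G](@map_poly_id _ id) ?homog_poly2 //= /im_form; ring.
have G0 : G != 0.
  apply/eqP => G0; have := congr1 (fun p : {poly int} => p`_1) G0.
  have := congr1 (fun p : {poly int} => p`_2) G0.
  rewrite /G !coef_Poly !coef0 /= => z1 z2; case/orP: uv0; rewrite ?z1 ?eqxx //.
  by move: z2; lia.
have hG i : `|G`_i| <= H%:Z.
  rewrite /G coef_Poly; case: i => [|[|[|i]]] /=; rewrite ?nth_nil ?normr0; lia.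
have sG : (size G <= 3)%N by apply: size_Poly.
have [//|col hcol] := @thue_colour 2 H G _ sG G0 H_gt0 hG.
rewrite -card_colours -cardsT.
apply: (@leq_trans #|[set col (a x) (b x) | x in S]|); last exact/subset_leq_card/subsetT.
rewrite card_in_imset // => x y xS yS hc.
have [ux vx] := hS _ xS; have [uy vy] := hS _ yS.
have hx : homog 2 G (a x) (b x) = 1 by rewrite GE -ux -vx.
have hy : homog 2 G (a y) (b y) = 1 by rewrite GE -uy -vy.
have := hcol _ _ _ _ 1 (pencil 2 G (a x) (b x) (a y) (b y)) isT
  (aH x) (bH x) (aH y) (bH y) hx hy (esym (scale1r _)) hc.
move/(congr1 (fun p : {poly int} => p.[-1])); rewrite horner_pencil horner_exp !hornerE /=.
rewrite addNr expr0n /= => h0; apply: dt0_eq.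
rewrite !GE in hx hy h0.
have : (u0 ^+ 2 + v0 ^+ 2) * dt x y ^+ 2 = 0.
  have e1 : 4 * ((u0 ^+ 2 + v0 ^+ 2) * dt x y ^+ 2) =
    (im_form (a x) (b x) u0 v0 + im_form (a y) (b y) u0 v0
      - im_form (a x * -1 + a y) (b x * -1 + b y) u0 v0) ^+ 2
    - 4 * im_form (a x) (b x) u0 v0 * im_form (a y) (b y) u0 v0.
    by rewrite /dt /im_form; ring.
  by move: e1; rewrite hx hy h0; lia.
move/eqP; rewrite mulf_eq0 => /orP[|]; last by rewrite sqrf_eq0 => /eqP.
by rewrite paddr_eq0 ?sqr_ge0 // !sqrf_eq0 => /andP[z1 z2]; move: uv0; rewrite z1 z2.
Qed.

(** [im_form = 1] also makes [(u, v)] primitive, so points with parallel [(u, v)] share it up to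
    sign. *)
Lemma fixed_direction_count (S : {set T}) (m1 m2 : int) :
  (m1 != 0) || (m2 != 0) ->
  (forall x, `|u x| *+ 2 <= H%:Z) -> (forall x, `|v x| <= H%:Z) ->
  (forall x, x \in S -> m1 * u x + m2 * v x = 0) -> (#|S| <= 2 * ncol 2)%N.
Proof.
move=> m0 uH vH hS.
case: (set_0Vmem S) => [->|[x0 x0S]]; first by rewrite cards0.
have par x : x \in S -> exists2 k, u x = u x0 * k & v x = v x0 * k.
  move=> xS; have h1 := hS _ xS; have h0 := hS _ x0S.
  have par0 : u x0 * v x = u x * v x0.
    have [/eqP m1z|m1z] := boolP (m1 == 0).
      have m2z : m2 != 0 by move: m0; rewrite m1z eqxx.
      have vx : v x = 0.
        by apply: (mulfI m2z); rewrite mulr0; move: h1; rewrite m1z mul0r add0r.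
      have vx0 : v x0 = 0.
        by apply: (mulfI m2z); rewrite mulr0; move: h0; rewrite m1z mul0r add0r.
      by rewrite vx vx0 !mulr0.
    apply: (mulfI m1z).
    have e1 : m1 * u x = - (m2 * v x) by lia.
    have e0 : m1 * u x0 = - (m2 * v x0) by lia.
    by rewrite !mulrA e1 e0; ring.
  have i0 := im1 x0; rewrite /im_form in i0.
  exists (2 * a x0 * b x0 * u x + (a x0 ^+ 2 - b x0 ^+ 2) * v x).
    transitivity (u x * (2 * a x0 * b x0 * u x0 + (a x0 ^+ 2 - b x0 ^+ 2) * v x0)).
      by rewrite i0 mulr1.
    transitivity (2 * a x0 * b x0 * u x * u x0 + (a x0 ^+ 2 - b x0 ^+ 2) * (u x * v x0)).
      by ring.
    by rewrite -par0; ring.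
  transitivity (v x * (2 * a x0 * b x0 * u x0 + (a x0 ^+ 2 - b x0 ^+ 2) * v x0)).
    by rewrite i0 mulr1.
  transitivity (2 * a x0 * b x0 * (u x0 * v x) + (a x0 ^+ 2 - b x0 ^+ 2) * (v x * v x0)).
    by ring.
  by rewrite par0; ring.
pose cs := [:: (u x0, v x0); (- u x0, - v x0)].
rewrite mulnC; apply: (@card_fibers _ _ (fun x => (u x, v x)) cs).
  move=> x xS; have [k uk vk] := par x xS.
  have := im1 x; rewrite uk vk /im_form.
  have -> : 2 * a x * b x * (u x0 * k) + (a x ^+ 2 - b x ^+ 2) * (v x0 * k) =
    (2 * a x * b x * u x0 + (a x ^+ 2 - b x ^+ 2) * v x0) * k by ring.
  case/intmul_eq1 => ->.
    by rewrite !mulr1 !inE eqxx.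
  by rewrite !mulrN1 !inE eqxx orbT.
move=> [c1 c2] hc; apply: (@fixed_uv_count _ c1 c2).
- by move: hc; rewrite !inE => /orP[] /eqP[-> _]; rewrite ?normrN.
- by move: hc; rewrite !inE => /orP[] /eqP[_ ->]; rewrite ?normrN.
- by move=> x; rewrite inE => /andP[_ /eqP[-> ->]].
Qed.

(* If [u l1 + v l2 = 0] then [(l1, l2)] is this multiple of [(- v, u)], because
   [(u, v)] is primitive. *)
Definition gmult (l1 l2 : int) (x : T) : int :=
  2 * a x * b x * l2 - (a x ^+ 2 - b x ^+ 2) * l1.

Lemma gmultP (l1 l2 : int) x : u x * l1 + v x * l2 = 0 ->
  l1 = - v x * gmult l1 l2 x /\ l2 = u x * gmult l1 l2 x.
Proof.
move=> h0; have h1 := im1 x; rewrite /im_form in h1; split.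
  have -> : - v x * gmult l1 l2 x =
      (2 * a x * b x * u x + (a x ^+ 2 - b x ^+ 2) * v x) * l1
      - 2 * a x * b x * (u x * l1 + v x * l2) by rewrite /gmult; ring.
  by rewrite h1 h0; ring.
have -> : u x * gmult l1 l2 x = (2 * a x * b x * u x + (a x ^+ 2 - b x ^+ 2) * v x) * l2
      - (a x ^+ 2 - b x ^+ 2) * (u x * l1 + v x * l2) by rewrite /gmult; ring.
by rewrite h1 h0; ring.
Qed.

(** The relation is linear in [(a, b)], so [(l1, l2) = g (- v, u)] persists along the whole pencil
    of two points with the same [g], and divisibility by [g] comes for free. The quotient is
    [im_form] on the pencil, so equal colours give [(t + 1)^3] and the exceptional shape of [n]. *)
Lemma cubic_count (S : {set T}) (p1 q1 p2 q2 : int) :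
  p1 * q2 - p2 * q1 != 0 ->
  `|p1| *+ 4 <= H%:Z -> `|q1| *+ 4 <= H%:Z -> `|p2| *+ 4 <= H%:Z -> `|q2| *+ 4 <= H%:Z ->
  (forall x, x \in S -> u x * (p1 * a x + q1 * b x) + v x * (p2 * a x + q2 * b x) = 0) ->
  (forall x, x \in S -> ~ cubic_value (re_form (a x) (b x) (u x) (v x))) ->
  (#|S| <= ncol 3 * (2 * num_div (p1 * q2 - p2 * q1)%R))%N.
Proof.
set D := p1 * q2 - p2 * q1 => D0 hp1 hq1 hp2 hq2 hS hbad.
pose l1 x := p1 * a x + q1 * b x; pose l2 x := p2 * a x + q2 * b x.
pose g x := gmult (l1 x) (l2 x) x.
have gl x : x \in S -> l1 x = - v x * g x /\ l2 x = u x * g x.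
  by move=> xS; apply: gmultP; apply: hS.
have gD x : x \in S -> (g x %| D)%Z.
  move=> xS; have [h1 h2] := gl x xS; have i1 := im1 x; rewrite /im_form in i1.
  have d1 : (g x %| D * a x)%Z.
    apply/dvdzP; exists (- q2 * v x - q1 * u x).
    have -> : D * a x = q2 * l1 x - q1 * l2 x by rewrite /D /l1 /l2; ring.
    by rewrite h1 h2; ring.
  have d2 : (g x %| D * b x)%Z.
    apply/dvdzP; exists (p1 * u x + p2 * v x).
    have -> : D * b x = p1 * l2 x - p2 * l1 x by rewrite /D /l1 /l2; ring.
    by rewrite h1 h2; ring.
  have -> : D = D * a x * (2 * b x * u x + a x * v x) - D * b x * (b x * v x).
    transitivity (D * (2 * a x * b x * u x + (a x ^+ 2 - b x ^+ 2) * v x)); last ring.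
    by rewrite i1 mulr1.
  by apply: rpredB; apply: dvdz_mulr.
rewrite -size_signed_divisors; apply: (@card_fibers _ _ g).
  by move=> x xS; apply: mem_signed_divisors => //; apply: gD.
move=> g0 hg0; set S' := [set x in S | g x == g0].
have hS' x : x \in S' -> [/\ x \in S, l1 x = - v x * g0 & l2 x = u x * g0].
  by rewrite inE => /andP[xS /eqP <-]; have [] := gl x xS.
case: (set_0Vmem S') => [->|[x0 x0S]]; first by rewrite cards0.
have [x0S1 _ _] := hS' _ x0S.
have gn0 : g0 != 0.
  have := gD _ x0S1; move: x0S; rewrite inE => /andP[_ /eqP ->].
  by apply: contraTneq => ->; rewrite dvd0z.
pose G := Poly [:: - q1; - p1 - 2 * q2; q1 - 2 * p2; p1].
have GE x y : homog 3 G x y =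
    (x ^+ 2 - y ^+ 2) * (p1 * x + q1 * y) - 2 * x * y * (p2 * x + q2 * y).
  by rewrite -[G](@map_poly_id _ id) ?homog_poly3 //=; ring.
have G0 x : x \in S' -> homog 3 G (a x) (b x) = - g0.
  move=> xS; have [xS1 h1 h2] := hS' x xS; have i1 := im1 x; rewrite /im_form in i1.
  rewrite GE -/(l1 x) -/(l2 x) h1 h2.
  transitivity (- (g0 * (2 * a x * b x * u x + (a x ^+ 2 - b x ^+ 2) * v x))); first ring.
  by rewrite i1 mulr1.
have Gn0 : G != 0.
  apply: contraNneq gn0 => Gz; have := G0 _ x0S; rewrite Gz /homog.
  by rewrite big1 => [/esym/eqP|i _]; rewrite ?oppr_eq0 // coef0 !mul0r.
have hG i : `|G`_i| <= H%:Z.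
  rewrite /G coef_Poly; case: i => [|[|[|[|i]]]] /=; rewrite ?nth_nil ?normr0; lia.
have sG : (size G <= 4)%N by apply: size_Poly.
have [//|col hcol] := @thue_colour 3 H G _ sG Gn0 H_gt0 hG.
rewrite -card_colours -cardsT.
apply: (@leq_trans #|[set col (a x) (b x) | x in S']|); last exact/subset_leq_card/subsetT.
rewrite card_in_imset // => x y xS yS hc.
have [xS1 x1 x2] := hS' _ xS; have [yS1 y1 y2] := hS' _ yS.
pose A : {poly int} := a x *: 'X + (a y)%:P; pose B : {poly int} := b x *: 'X + (b y)%:P.
pose U : {poly int} := u x *: 'X + (u y)%:P; pose V : {poly int} := v x *: 'X + (v y)%:P.
have hpen : pencil 3 G (a x) (b x) (a y) (b y) = (- g0) *: im_form A B U V.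
  rewrite /pencil homog_poly3 // -/A -/B.
  have e1 : p1%:P * A + q1%:P * B = - g0%:P * V.
    rewrite /A /B /V -!mul_polyC !mulrDr !mulrA -!polyCN -!polyCM addrACA -mulrDl -!polyCD.
    rewrite -/(l1 x) -/(l1 y) x1 y1 !polyCM !polyCN; ring.
  have e2 : p2%:P * A + q2%:P * B = g0%:P * U.
    rewrite /A /B /U -!mul_polyC !mulrDr !mulrA -!polyCM addrACA -mulrDl -!polyCD.
    rewrite -/(l2 x) -/(l2 y) x2 y2 !polyCM; ring.
  transitivity ((A ^+ 2 - B ^+ 2) * (p1%:P * A + q1%:P * B)
      - 2 * A * B * (p2%:P * A + q2%:P * B)).
    by rewrite !polyCB !polyCN !polyCM; ring.
  by rewrite e1 e2 -mul_polyC polyCN /im_form; ring.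
have hh := hcol _ _ _ _ (- g0) _ _ (aH x) (bH x) (aH y) (bH y) (G0 _ xS) (G0 _ yS) hpen hc.
rewrite oppr_eq0 in hh; have {}hh := hh gn0.
apply: dt0_eq; apply/eqP; apply/negPn/negP => dn0.
apply: (hbad x xS1).
have ev t : im_form (a x * t + a y) (b x * t + b y) (u x * t + u y) (v x * t + v y) = (t + 1) ^+ 3.
  have := congr1 (fun p : {poly int} => p.[t]) hh.
  by rewrite /im_form /A /B /U /V !hornerE.
apply: (cubic_value_of_pencil (im1 x) (im1 y)).
- by have := ev 1; rewrite !mulr1.
- by have := ev (-1); rewrite !mulrN1 addNr expr0n /= ![- _ + _]addrC.
- by apply: contraNneq dn0 => h; rewrite /dt -oppr_eq0; apply/eqP; rewrite -h; ring.
Qed.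

(* Three points of one colour lie on a line by [thue_colour]; if its primitive direction
   is [e], the quartic form vanishes at [e], which makes [e] short, so the three
   points are [near_line]. *)
Lemma quartic_key_count (S : {set T}) (A1 B1 C1 A2 B2 C2 g : int) (C V : int) (x0 : T) (j : int) :
  resq A1 B1 C1 A2 B2 C2 != 0 ->
  `|A1| *+ 4 <= H%:Z -> `|B1| *+ 4 <= H%:Z -> `|C1| *+ 4 <= H%:Z ->
  `|A2| *+ 4 <= H%:Z -> `|B2| *+ 4 <= H%:Z -> `|C2| *+ 4 <= H%:Z ->
  g != 0 ->
  (forall x, x \in S -> quad A1 B1 C1 (a x) (b x) = - v x * g /\
                        quad A2 B2 C2 (a x) (b x) = u x * g) ->
  (g %| quad A1 B1 C1 (a x0) (b x0))%Z -> (g %| quad A2 B2 C2 (a x0) (b x0))%Z ->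
  (forall x, x \in S -> gcdz (dt x0 x) g = j) ->
  (forall x y, x \in S -> y \in S -> `|dt x y| <= C) ->
  (forall x, x \in S -> `|u x| <= V) -> (forall x, x \in S -> `|v x| <= V) ->
  0 < C -> 0 < V ->
  (forall x, x \in S -> ~ near_line (9 * C * V) C (a x) (b x)) ->
  (#|S| <= 2 * ncol 4)%N.
Proof.
move=> R0 hA1 hB1 hC1 hA2 hB2 hC2 g0 hS h01 h02 hj hC hu hv C0 V0 hbad.
case: (set_0Vmem S) => [->|[x1 x1S]]; first by rewrite cards0.
pose G := Poly [:: - C1; - B1 - 2 * C2; C1 - A1 - 2 * B2; B1 - 2 * A2; A1].
have GE x y : homog 4 G x y =
    (x ^+ 2 - y ^+ 2) * quad A1 B1 C1 x y - 2 * x * y * quad A2 B2 C2 x y.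
  by rewrite -[G](@map_poly_id _ id) ?homog_poly4 //= /quad; ring.
have Gg x : x \in S -> homog 4 G (a x) (b x) = - g.
  move=> xS; have [h1 h2] := hS x xS; have i1 := im1 x; rewrite /im_form in i1.
  rewrite GE h1 h2.
  transitivity (- (g * (2 * a x * b x * u x + (a x ^+ 2 - b x ^+ 2) * v x))); first ring.
  by rewrite i1 mulr1.
have Gn0 : G != 0.
  apply: contraNneq g0 => Gz; have := Gg _ x1S; rewrite Gz /homog.
  by rewrite big1 => [/esym/eqP|i _]; rewrite ?oppr_eq0 // coef0 !mul0r.
have hG i : `|G`_i| <= H%:Z.
  rewrite /G coef_Poly; clear -hA1 hB1 hC1 hA2 hB2 hC2.
  case: i => [|[|[|[|[|i]]]]] /=; rewrite ?nth_nil ?normr0; lia.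
have sG : (size G <= 5)%N by apply: size_Poly.
have [//|col hcol] := @thue_colour 4 H G _ sG Gn0 H_gt0 hG.
have bez x : exists c f, a x * f - b x * c = 1.
  exists (- (2 * a x * u x - b x * v x)), (a x * v x).
  by have i1 := im1 x; rewrite /im_form in i1; rewrite -[RHS]i1; ring.
(* The common gcd [j] with [g] is what lets [polar_dvd], in a basis containing [x0], divide the
   mixed terms by [g]. *)
have pol x y : x \in S -> y \in S ->
    (exists k, polar A1 B1 C1 (a x) (b x) (a y) (b y) = k * g) /\
    (exists k, polar A2 B2 C2 (a x) (b x) (a y) (b y) = k * g).
  move=> xS yS; have [c [f hcf]] := bez x0.
  have [hx1 hx2] := hS _ xS; have [hy1 hy2] := hS _ yS.
  by split; apply/dvdzP; apply: (polar_dvd hcf); rewrite ?hx1 ?hx2 ?hy1 ?hy2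
     ?dvdz_mull //; rewrite [LHS](hj x xS) [RHS](hj y yS).
have ev x y t : x \in S -> y \in S -> col (a x) (b x) = col (a y) (b y) ->
    homog 4 G (a x * t + a y) (b x * t + b y) = - g * (t + 1) ^+ 4.
  move=> xS yS hc; have [[k1 hk1] [k2 hk2]] := pol x y xS yS.
  have [hx1 hx2] := hS _ xS; have [hy1 hy2] := hS _ yS.
  pose A : {poly int} := (a x)%:P * 'X + (a y)%:P.
  pose B : {poly int} := (b x)%:P * 'X + (b y)%:P.
  (* [L1] and [L2] are the two quadratic forms on the pencil divided by [g]. *)
  pose L1 : {poly int} := - (v x)%:P * 'X ^+ 2 + k1%:P * 'X - (v y)%:P.
  pose L2 : {poly int} := (u x)%:P * 'X ^+ 2 + k2%:P * 'X + (u y)%:P.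
  have e1 : A1%:P * A ^+ 2 + B1%:P * A * B + C1%:P * B ^+ 2 = g%:P * L1.
    transitivity ((quad A1 B1 C1 (a x) (b x))%:P * 'X ^+ 2
      + (polar A1 B1 C1 (a x) (b x) (a y) (b y))%:P * 'X + (quad A1 B1 C1 (a y) (b y))%:P).
      by rewrite /A /B /quad /polar !polyCD !polyCM; ring.
    by rewrite hx1 hy1 hk1 /L1 !polyCM !polyCN; ring.
  have e2 : A2%:P * A ^+ 2 + B2%:P * A * B + C2%:P * B ^+ 2 = g%:P * L2.
    transitivity ((quad A2 B2 C2 (a x) (b x))%:P * 'X ^+ 2
      + (polar A2 B2 C2 (a x) (b x) (a y) (b y))%:P * 'X + (quad A2 B2 C2 (a y) (b y))%:P).
      by rewrite /A /B /quad /polar !polyCD !polyCM; ring.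
    by rewrite hx2 hy2 hk2 /L2 !polyCM; ring.
  have hpen : pencil 4 G (a x) (b x) (a y) (b y) =
      (- g) *: (2 * A * B * L2 - (A ^+ 2 - B ^+ 2) * L1).
    rewrite /pencil homog_poly4 // -!mul_polyC -/A -/B.
    transitivity ((A ^+ 2 - B ^+ 2) * (A1%:P * A ^+ 2 + B1%:P * A * B + C1%:P * B ^+ 2)
      - 2 * A * B * (A2%:P * A ^+ 2 + B2%:P * A * B + C2%:P * B ^+ 2)).
      by rewrite !polyCB !polyCN !polyCM; ring.
    by rewrite e1 e2 polyCN; ring.
  have hh := hcol _ _ _ _ (- g) _ _ (aH x) (bH x) (aH y) (bH y) (Gg _ xS) (Gg _ yS) hpen hc.
  rewrite oppr_eq0 in hh; have {}hh := hh g0.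
  by rewrite -horner_pencil hpen hh hornerZ horner_exp !hornerE.
have -> : ncol 4 = size (enum (setT : {set {ffun 'I_4 ->
    'I_(2 * log_range H).+1 * 'I_65 * 'I_65}})) by rewrite -cardE cardsT card_colours.
apply: (@card_fibers _ _ (fun x => col (a x) (b x))) => [x _|k _]; first by rewrite mem_enum inE.
apply: card_le2 => x y z; rewrite !inE.
case/andP=> xS /eqP cx /andP[yS /eqP cy] /andP[zS /eqP cz] xy yz zx.
have cxy : col (a x) (b x) = col (a y) (b y) by rewrite cx cy.
have cxz : col (a x) (b x) = col (a z) (b z) by rewrite cx cz.
pose k1 := a y - a x; pose k2 := b y - b x; pose l1 := a z - a x; pose l2 := b z - b x.
(* the partial derivatives of the form [G] at [x] *)
pose D1 := 4 * A1 * a x ^+ 3 + 3 * (B1 - 2 * A2) * a x ^+ 2 * b x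
  + 2 * (C1 - A1 - 2 * B2) * a x * b x ^+ 2 + (- B1 - 2 * C2) * b x ^+ 3.
pose D2 := (B1 - 2 * A2) * a x ^+ 3 + 2 * (C1 - A1 - 2 * B2) * a x ^+ 2 * b x
  + 3 * (- B1 - 2 * C2) * a x * b x ^+ 2 - 4 * C1 * b x ^+ 3.
have Dx : D1 * a x + D2 * b x = - 4 * g.
  transitivity (4 * homog 4 G (a x) (b x)); last by rewrite Gg //; ring.
  by rewrite GE /D1 /D2 /quad; ring.
have D0 t : t \in S -> col (a x) (b x) = col (a t) (b t) -> D1 * (a t - a x) + D2 * (b t - b x) = 0.
  move=> tS ct; suff E : D1 * a t + D2 * b t = - 4 * g.
    by transitivity (D1 * a t + D2 * b t - (D1 * a x + D2 * b x)); [ring | rewrite E Dx subrr].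
  (* This combination of values at 2, -2, 1 and -1 isolates 12 times the coefficient of the cube of
     the parameter, which is the derivative of [G] at [x] in the direction of the point [t]. *)
  apply: (mulfI (isT : (12 : int) != 0)).
  transitivity (homog 4 G (a x * 2 + a t) (b x * 2 + b t)
     - homog 4 G (a x * -2 + a t) (b x * -2 + b t)
     - 2 * (homog 4 G (a x * 1 + a t) (b x * 1 + b t)
     - homog 4 G (a x * -1 + a t) (b x * -1 + b t))).
    by rewrite !GE /D1 /D2 /quad; ring.
  by rewrite !(ev x t) //; ring.
(* By Euler's identity the gradient at [x] is nonzero, and it kills both differences, so the three
   points are collinear. *)
have par : k1 * l2 = k2 * l1.
  have d1 := D0 y yS cxy; have d2 := D0 z zS cxz.
  have z1 : D1 * (k1 * l2 - k2 * l1) = 0.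
    transitivity ((D1 * (a y - a x) + D2 * (b y - b x)) * l2
      - (D1 * (a z - a x) + D2 * (b z - b x)) * k2); first by rewrite /k1 /k2 /l1 /l2; ring.
    by rewrite d1 d2; ring.
  have z2 : D2 * (k1 * l2 - k2 * l1) = 0.
    transitivity ((D1 * (a z - a x) + D2 * (b z - b x)) * k1
      - (D1 * (a y - a x) + D2 * (b y - b x)) * l1); first by rewrite /k1 /k2 /l1 /l2; ring.
    by rewrite d1 d2; ring.
  apply/eqP; rewrite -subr_eq0; apply: contraNT g0 => hne.
  have D1z : D1 = 0 by apply/eqP; move/eqP: z1; rewrite mulf_eq0 (negPf hne) orbF.
  have D2z : D2 = 0 by apply/eqP; move/eqP: z2; rewrite mulf_eq0 (negPf hne) orbF.
  by move/esym/eqP: Dx; rewrite D1z D2z !mul0r addr0 mulf_eq0.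
have k0 : (k1 != 0) || (k2 != 0).
  rewrite -negb_and; apply/negP => /andP[/eqP z1 /eqP z2]; case/eqP: xy.
  by apply: inj_ab; apply/esym/subr0_eq.
have [m2 [e1 [e2 [m20 hk1 hk2 cop]]]] := primitive_vector k0.
have [s1 [s2 hs]] : exists s1 s2, s1 * e1 + s2 * e2 = 1.
  by have /coprimezP[[s1 s2] /= hs] := cop; exists s1, s2.
have par' : e1 * l2 = e2 * l1.
  by apply: (mulfI m20); rewrite !mulrA ![m2 * _]mulrC -hk1 -hk2.
pose m3 := s1 * l1 + s2 * l2.
have hl1 : l1 = e1 * m3.
  transitivity (l1 * (s1 * e1 + s2 * e2)); first by rewrite hs mulr1.
  by transitivity (s1 * e1 * l1 + s2 * (e2 * l1)); [ring | rewrite -par' /m3; ring].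
have hl2 : l2 = e2 * m3.
  transitivity (l2 * (s1 * e1 + s2 * e2)); first by rewrite hs mulr1.
  by transitivity (s2 * e2 * l2 + s1 * (e1 * l2)); [ring | rewrite par' /m3; ring].
have ay : a y = a x + e1 * m2 by rewrite -hk1 /k1; ring.
have by_ : b y = b x + e2 * m2 by rewrite -hk2 /k2; ring.
have az : a z = a x + e1 * m3 by rewrite -hl1 /l1; ring.
have bz : b z = b x + e2 * m3 by rewrite -hl2 /l2; ring.
have m30 : m3 != 0.
  by apply: contraNneq zx => m3z; apply/eqP; apply: inj_ab; rewrite ?az ?bz m3z mulr0 addr0.
have m320 : m3 - m2 != 0.
  apply: contraNneq yz => /eqP; rewrite subr_eq0 => /eqP m3z.
  by apply/eqP; apply: inj_ab; rewrite ?az ?bz ?ay ?by_ m3z.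
pose c := a x * e2 - b x * e1.
have dxy : dt x y = m2 * c by rewrite /dt ay by_ /c; ring.
have dxz : dt x z = m3 * c by rewrite /dt az bz /c; ring.
have dyz : dt y z = (m3 - m2) * c by rewrite /dt ay by_ az bz /c; ring.
have c0 : c != 0.
  apply: contraNneq xy => cz0; apply/eqP; apply: dt0_eq; by rewrite dxy cz0 mulr0.
have le_mul (p q : int) : q != 0 -> `|p * q| <= C -> `|p| <= C.
  move=> q0; apply: le_trans; rewrite normrM ler_peMr //; move: q0; clear; lia.
have m2C : `|m2| <= C by apply: le_mul c0 _; rewrite -dxy hC.
have m3C : `|m3| <= C by apply: le_mul c0 _; rewrite -dxz hC.
have m32C : `|m3 - m2| <= C by apply: le_mul c0 _; rewrite -dyz hC.
have cC : `|c| <= C by apply: le_mul m20 _; rewrite mulrC -dxy hC.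
apply: (hbad x xS); exists e1, e2; split => //.
(* At parameter -1 the pencil is the difference of the two points, so [(t + 1)^4] makes [G] vanish
   in the direction of the line. *)
have Ge : (e1 ^+ 2 - e2 ^+ 2) * quad A1 B1 C1 e1 e2 - 2 * e1 * e2 * quad A2 B2 C2 e1 e2 = 0.
  apply: (mulfI (expf_neq0 4 m20)); rewrite mulr0.
  transitivity (homog 4 G (a x * -1 + a y) (b x * -1 + b y)); last by rewrite ev // addNr; ring.
  by rewrite GE ay by_ /quad; ring.
(* The second divided difference of a quadratic form along the line is its value at [e]. Hence the
   two values at [e] are [g / M] times the small integers [P1] and [P2], and the vanishing of [G] at
   [e] fixes their ratio. *)
pose P1 := - (m2 * v z - m3 * v y + (m3 - m2) * v x).
pose P2 := m2 * u z - m3 * u y + (m3 - m2) * u x.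
have [hx1 hx2] := hS _ xS; have [hy1 hy2] := hS _ yS; have [hz1 hz2] := hS _ zS.
pose M := m2 * m3 * (m3 - m2).
have M0 : M != 0 by rewrite !mulf_neq0.
have eP1 : M * quad A1 B1 C1 e1 e2 = g * P1.
  transitivity (m2 * quad A1 B1 C1 (a z) (b z) - m3 * quad A1 B1 C1 (a y) (b y)
     + (m3 - m2) * quad A1 B1 C1 (a x) (b x)).
    by rewrite ay by_ az bz /quad /M; ring.
  by rewrite hx1 hy1 hz1 /P1; ring.
have eP2 : M * quad A2 B2 C2 e1 e2 = g * P2.
  transitivity (m2 * quad A2 B2 C2 (a z) (b z) - m3 * quad A2 B2 C2 (a y) (b y)
     + (m3 - m2) * quad A2 B2 C2 (a x) (b x)).
    by rewrite ay by_ az bz /quad /M; ring.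
  by rewrite hx2 hy2 hz2 /P2; ring.
have eP : (e1 ^+ 2 - e2 ^+ 2) * P1 = 2 * e1 * e2 * P2.
  apply: (mulfI g0).
  transitivity ((e1 ^+ 2 - e2 ^+ 2) * (g * P1)); first ring.
  transitivity (2 * e1 * e2 * (g * P2)); last ring.
  rewrite -eP1 -eP2; apply/eqP; rewrite -subr_eq0; apply/eqP.
  transitivity (M * 0); last by rewrite mulr0.
  by rewrite -Ge; ring.
have P0 : (P1 != 0) || (P2 != 0).
  rewrite -negb_and; apply/negP => /andP[/eqP z1 /eqP z2].
  have q1 : quad A1 B1 C1 e1 e2 = 0 by apply: (mulfI M0); rewrite eP1 z1 !mulr0.
  have q2 : quad A2 B2 C2 e1 e2 = 0 by apply: (mulfI M0); rewrite eP2 z2 !mulr0.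
  have r1 := resultant_mul_x3 A1 B1 C1 A2 B2 C2 e1 e2.
  have r2 := resultant_mul_y3 A1 B1 C1 A2 B2 C2 e1 e2.
  rewrite q1 q2 !(mulr0, subrr, addr0) in r1 r2.
  move/eqP: r1; rewrite mulf_eq0 (negPf R0) /= expf_eq0 /= => /eqP e10.
  move/eqP: r2; rewrite mulf_eq0 (negPf R0) /= expf_eq0 /= => /eqP e20.
  by move: hs; rewrite e10 e20 !mulr0.
have PB (q : T -> int) : (forall t, t \in S -> `|q t| <= V) ->
    `|m2 * q z - m3 * q y + (m3 - m2) * q x| <= 3 * (C * V).
  move=> hq; apply: le_trans (ler_normD _ _) _.
  have -> : 3 * (C * V) = C * V + C * V + C * V by ring.
  apply: lerD; last by rewrite normrM ler_pM // hq.
  apply: le_trans (ler_normB _ _) _.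
  by apply: lerD; rewrite normrM ler_pM // hq.
have P1B : `|P1| <= 3 * (C * V) by rewrite /P1 normrN; apply: PB.
have P2B : `|P2| <= 3 * (C * V) by apply: PB.
have CV0 : 0 < C * V by rewrite mulr_gt0.
have -> : 9 * C * V = 9 * (C * V) by rewrite mulrA.
exact: (square_direction_bound cop eP P0 P1B P2B CV0).
Qed.

(** Points are sorted by [g], a divisor of the resultant, and then by the gcd of [g] with the
    determinant against a reference point [x0]; within one such class [quartic_key_count]
    applies. *)
Lemma quartic_count (S : {set T}) (A1 B1 C1 A2 B2 C2 : int) (C V : int) :
  resq A1 B1 C1 A2 B2 C2 != 0 ->
  `|A1| *+ 4 <= H%:Z -> `|B1| *+ 4 <= H%:Z -> `|C1| *+ 4 <= H%:Z ->
  `|A2| *+ 4 <= H%:Z -> `|B2| *+ 4 <= H%:Z -> `|C2| *+ 4 <= H%:Z ->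
  (forall x, x \in S ->
     u x * quad A1 B1 C1 (a x) (b x) + v x * quad A2 B2 C2 (a x) (b x) = 0) ->
  (forall x y, x \in S -> y \in S -> `|dt x y| <= C) ->
  (forall x, x \in S -> `|u x| <= V) -> (forall x, x \in S -> `|v x| <= V) ->
  0 < C -> 0 < V ->
  (forall x, x \in S -> ~ near_line (9 * C * V) C (a x) (b x)) ->
  (#|S| <= 2 * ncol 4 * num_div (resq A1 B1 C1 A2 B2 C2)
           * (2 * num_div (resq A1 B1 C1 A2 B2 C2)))%N.
Proof.
set R := resq A1 B1 C1 A2 B2 C2 => R0 hA1 hB1 hC1 hA2 hB2 hC2 hS hC hu hv C0 V0 hbad.
pose g x := gmult (quad A1 B1 C1 (a x) (b x)) (quad A2 B2 C2 (a x) (b x)) x.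
have gl x : x \in S -> quad A1 B1 C1 (a x) (b x) = - v x * g x /\
                       quad A2 B2 C2 (a x) (b x) = u x * g x.
  by move=> xS; apply: gmultP; apply: hS.
have gR x : x \in S -> (g x %| R)%Z.
  move=> xS; have [h1 h2] := gl x xS.
  have i1 := im1 x; rewrite /im_form in i1.
  have d1 : (g x %| R * a x ^+ 3)%Z.
    rewrite /R (resultant_mul_x3 _ _ _ _ _ _ (a x) (b x)) h1 h2.
    by apply: rpredD; apply: dvdz_mull; apply: rpredB; rewrite mulrA dvdz_mull.
  have d2 : (g x %| R * b x ^+ 3)%Z.
    rewrite /R (resultant_mul_y3 _ _ _ _ _ _ (a x) (b x)) h1 h2.
    by apply: rpredD; apply: dvdz_mull; apply: rpredB; rewrite mulrA dvdz_mull.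
  pose i2 := 2 * a x * b x * u x; pose r2 := (a x ^+ 2 - b x ^+ 2) * v x.
  have cop : coprimez (a x ^+ 3) (b x ^+ 3).
    rewrite coprimezXl // coprimezXr //; apply/coprimezP.
    exists (2 * b x * u x + a x * v x, - b x * v x); rewrite /= -[RHS]i1; ring.
  have /coprimezP[[s t] /= hst] := cop.
  have -> : R = s * (R * a x ^+ 3) + t * (R * b x ^+ 3).
    by transitivity (R * (s * a x ^+ 3 + t * b x ^+ 3)); [rewrite hst mulr1 | ring].
  by apply: rpredD; apply: dvdz_mull.
rewrite -size_signed_divisors; apply: (@card_fibers _ _ g).
  by move=> x xS; apply: mem_signed_divisors => //; apply: gR.
move=> g0 hg0; set S1 := [set x in S | g x == g0].
case: (set_0Vmem S1) => [->|[x0 x0S]]; first by rewrite cards0.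
have S1S x : x \in S1 -> x \in S by rewrite inE => /andP[].
have g0R : (g0 %| R)%Z by have := gR _ (S1S _ x0S); move: x0S; rewrite inE => /andP[_ /eqP ->].
have gn0 : g0 != 0 by apply: contraTneq g0R => ->; rewrite dvd0z.
have -> : num_div R = size [seq d%:Z | d <- divisors `|R|] by rewrite size_map.
apply: (@card_fibers _ _ (fun x => gcdz (dt x0 x) g0)).
  move=> x xS1; have /dvdzP[k hk] := dvdz_gcdr (dt x0 x) g0.
  rewrite /gcdz map_f // -dvdn_divisors ?absz_gt0 //.
  exact: dvdn_trans (dvdn_gcdr _ _) g0R.
move=> j _; set S2 := [set x in S1 | gcdz (dt x0 x) g0 == j].
have S2S x : x \in S2 -> x \in S by rewrite inE => /andP[/S1S].
have [L1x0 L2x0] := gl x0 (S1S _ x0S).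
have gx0 : g x0 = g0 by move: x0S; rewrite inE => /andP[_ /eqP].
apply: (@quartic_key_count S2 A1 B1 C1 A2 B2 C2 g0 C V x0 j) => //.
- move=> x xS2; have [h1 h2] := gl x (S2S _ xS2).
  by move: xS2; rewrite !inE => /andP[/andP[_ /eqP gx] _]; rewrite h1 h2 gx.
- by rewrite L1x0 gx0 dvdz_mull.
- by rewrite L2x0 gx0 dvdz_mull.
- by move=> x; rewrite inE => /andP[_ /eqP].
- by move=> x y xS yS; apply: hC; apply: S2S.
- by move=> x xS; apply: hu; apply: S2S.
- by move=> x xS; apply: hv; apply: S2S.
- by move=> x xS; apply: hbad; apply: S2S.
Qed.

(** Two independent zeros leave only the polar term of a quadratic form; a third zero, independent
    of each, kills the polar value and then all coefficients. *)
Lemma three_roots (A B C : int) x y z :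
  x != y -> y != z -> z != x ->
  quad A B C (a x) (b x) = 0 -> quad A B C (a y) (b y) = 0 -> quad A B C (a z) (b z) = 0 ->
  [/\ A = 0, B = 0 & C = 0].
Proof.
move=> xy yz zx qx qy qz.
have d0 s t : s != t -> dt s t != 0 by apply: contraNneq => /dt0_eq ->.
pose p := polar A B C (a x) (b x) (a y) (b y).
have p0 : p = 0.
  have : dt x z * dt z y * p = 0.
    transitivity (quad A B C (a z) (b z) * dt x y ^+ 2 - quad A B C (a x) (b x) * dt z y ^+ 2
       - quad A B C (a y) (b y) * dt x z ^+ 2); last by rewrite qx qy qz !mul0r !subr0.
    by rewrite /p /dt /polar /quad; ring.
  have xz : x != z by rewrite eq_sym.
  have zy : z != y by rewrite eq_sym.
  by move/eqP; rewrite !mulf_eq0 (negPf (d0 _ _ xz)) (negPf (d0 _ _ zy)) => /eqP.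
have D0 := d0 _ _ xy.
have A0 : A * dt x y ^+ 2 = 0.
  transitivity (b y ^+ 2 * quad A B C (a x) (b x) - b x * b y * p
    + b x ^+ 2 * quad A B C (a y) (b y)); last by rewrite qx qy p0 !mulr0 subr0 addr0.
  by rewrite /p /dt /polar /quad; ring.
have C0 : C * dt x y ^+ 2 = 0.
  transitivity (a y ^+ 2 * quad A B C (a x) (b x) - a x * a y * p
    + a x ^+ 2 * quad A B C (a y) (b y)); last by rewrite qx qy p0 !mulr0 subr0 addr0.
  by rewrite /p /dt /polar /quad; ring.
have B0 : B * dt x y ^+ 2 = 0.
  transitivity (- 2 * a y * b y * quad A B C (a x) (b x) + (a x * b y + b x * a y) * p
    - 2 * a x * b x * quad A B C (a y) (b y)); last by rewrite qx qy p0 !mulr0 subr0 addr0.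
  by rewrite /p /dt /polar /quad; ring.
have cancel X : X * dt x y ^+ 2 = 0 -> X = 0.
  by move/eqP; rewrite mulf_eq0 expf_eq0 (negPf D0) andbF orbF => /eqP.
by split; apply: cancel.
Qed.

(* According to the rank of the pencil of the two quadratic forms the relation
   is quartic, factors through a linear form, or determines a direction of [(u, v)]. *)
Lemma relation_count (S : {set T}) (A1 B1 C1 A2 B2 C2 X : int) (tb : nat) (C V : int) :
  ~~ [&& A1 == 0, B1 == 0, C1 == 0, A2 == 0, B2 == 0 & C2 == 0] ->
  0 < X ->
  [/\ `|A1| <= X, `|B1| <= X & `|C1| <= X] -> [/\ `|A2| <= X, `|B2| <= X & `|C2| <= X] ->
  8 * X ^+ 3 <= H%:Z ->
  (forall x, `|u x| *+ 2 <= H%:Z) -> (forall x, `|v x| <= H%:Z) ->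
  (forall m : int, m != 0 -> `|m| <= 8 * X ^+ 6 -> (num_div m <= tb)%N) ->
  (forall x, x \in S ->
     u x * quad A1 B1 C1 (a x) (b x) + v x * quad A2 B2 C2 (a x) (b x) = 0) ->
  (forall x, x \in S -> ~ cubic_value (re_form (a x) (b x) (u x) (v x))) ->
  (resq A1 B1 C1 A2 B2 C2 != 0 ->
    [/\ (forall x y, x \in S -> y \in S -> `|dt x y| <= C),
        (forall x, x \in S -> `|u x| <= V), (forall x, x \in S -> `|v x| <= V),
        0 < C /\ 0 < V &
        (forall x, x \in S -> ~ near_line (9 * C * V) C (a x) (b x))]) ->
  (#|S| <= 2 + (2 * ncol 2 + ncol 3 * (2 * tb) + 2 * ncol 4 * tb * (2 * tb)))%N.
Proof.
move=> nz X0 [hA1 hB1 hC1] [hA2 hB2 hC2] HX uH vH htb hS hcub hres.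
have X1 : 1 <= X by [].
have Xle m n : (m <= n)%N -> X ^+ m <= X ^+ n by move=> mn; apply: ler_weXn2l.
have hX4 : 4 * X <= H%:Z.
  apply: le_trans HX; have := Xle 1%N 3%N isT; rewrite expr1; move: (X ^+ 3) X0; clear; lia.
pose L1 x := quad A1 B1 C1 (a x) (b x); pose L2 x := quad A2 B2 C2 (a x) (b x).
(* Where both forms vanish [gmult] is zero and the relation carries no information; [three_roots]
   leaves at most two such points. *)
pose Z := [set x : T | (L1 x == 0) && (L2 x == 0)].
rewrite -(cardsID Z S) leq_add //.
  apply: card_le2 => x y z; rewrite !inE => /andP[_ /andP[/eqP x1 /eqP x2]].
  move=> /andP[_ /andP[/eqP y1 /eqP y2]] /andP[_ /andP[/eqP z1 /eqP z2]] xy yz zx.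
  have [a1 b1 c1] := three_roots xy yz zx x1 y1 z1.
  have [a2 b2 c2] := three_roots xy yz zx x2 y2 z2.
  by move: nz; rewrite a1 b1 c1 a2 b2 c2 eqxx.
set S' := S :\: Z.
have S'S x : x \in S' -> x \in S by rewrite inE => /andP[].
pose g x := gmult (L1 x) (L2 x) x.
have gl x : x \in S' -> [/\ g x != 0, L1 x = - v x * g x & L2 x = u x * g x].
  move=> xS; have [h1 h2] := gmultP (hS x (S'S x xS)); split => //.
  move: xS; rewrite !inE => /andP[+ _]; apply: contraNneq => gz.
  have -> : L1 x = - v x * g x := h1.
  have -> : L2 x = u x * g x := h2.
  by rewrite gz !mulr0 eqxx.
have hM (x1 y1 x2 y2 : int) : `|x1| <= X -> `|y1| <= X -> `|x2| <= X -> `|y2| <= X ->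
    `|Mac x1 y1 x2 y2| <= 2 * X ^+ 2.
  move=> h1 h2 h3 h4; apply: le_trans (ler_normB _ _) _; rewrite !normrM.
  have -> : 2 * X ^+ 2 = X * X + X * X by ring.
  by rewrite lerD // ler_pM.
pose ab := Mac A1 B1 A2 B2; pose ac := Mac A1 C1 A2 C2; pose bc := Mac B1 C1 B2 C2.
have hab : `|ab| <= 2 * X ^+ 2 by apply: hM.
have hac : `|ac| <= 2 * X ^+ 2 by apply: hM.
have hbc : `|bc| <= 2 * X ^+ 2 by apply: hM.
set K2 := (2 * ncol 2)%N; set K3 := (ncol 3 * (2 * tb))%N.
set K4 := (2 * ncol 4 * tb * (2 * tb))%N.
have [R0|R0] := eqVneq (resq A1 B1 C1 A2 B2 C2) 0; last first.
  have [hC hu hv [C0 V0] hbad] := hres R0.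
  have hR : (num_div (resq A1 B1 C1 A2 B2 C2) <= tb)%N.
    apply: htb => //; apply: le_trans (ler_normB _ _) _; rewrite normrX normrM.
    apply: (@le_trans _ _ (8 * X ^+ 4)); last by rewrite ler_pM2l // Xle.
    have -> : 8 * X ^+ 4 = (2 * X ^+ 2) * (2 * X ^+ 2) + (2 * X ^+ 2) * (2 * X ^+ 2) by ring.
    by rewrite expr2 lerD // ler_pM.
  apply: (@leq_trans K4); last by rewrite leq_addl.
  have H4 (m : int) : `|m| <= X -> `|m| *+ 4 <= H%:Z.
    by move: (`|m|) hX4; clear; lia.
  apply: leq_trans (quartic_count R0 (H4 _ hA1) (H4 _ hB1) (H4 _ hC1) (H4 _ hA2)
    (H4 _ hB2) (H4 _ hC2) (S := S') _ _ _ _ C0 V0 _) _.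
  - by move=> x /S'S; apply: hS.
  - by move=> x y /S'S xS /S'S yS; apply: hC.
  - by move=> x /S'S; apply: hu.
  - by move=> x /S'S; apply: hv.
  - by move=> x /S'S; apply: hbad.
  - by rewrite leq_mul // ?leq_mul.
have RE : ac ^+ 2 = ab * bc by apply/eqP; rewrite -subr_eq0; apply/eqP.
have cub (p1 q1 p2 q2 : int) : p1 * q2 - p2 * q1 != 0 ->
    `|p1| <= 2 * X ^+ 3 -> `|q1| <= 2 * X ^+ 3 -> `|p2| <= 2 * X ^+ 3 -> `|q2| <= 2 * X ^+ 3 ->
    (forall x, x \in S' -> u x * (p1 * a x + q1 * b x) + v x * (p2 * a x + q2 * b x) = 0) ->
    (#|S'| <= K2 + K3 + K4)%N.
  move=> D0 h1 h2 h3 h4 hrel; apply: (@leq_trans K3); last by rewrite -addnA addnCA leq_addr.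
  have hD : (num_div (p1 * q2 - p2 * q1) <= tb)%N.
    apply: htb => //; apply: le_trans (ler_normB _ _) _; rewrite !normrM.
    have -> : 8 * X ^+ 6 = (2 * X ^+ 3) * (2 * X ^+ 3) + (2 * X ^+ 3) * (2 * X ^+ 3) by ring.
    by rewrite lerD // ler_pM.
  have H3 (m : int) : `|m| <= 2 * X ^+ 3 -> `|m| *+ 4 <= H%:Z.
    by move: (`|m|) (X ^+ 3) HX; clear; lia.
  apply: leq_trans (cubic_count D0 (H3 _ h1) (H3 _ h2) (H3 _ h3) (H3 _ h4) hrel _) _.
    by move=> x /S'S; apply: hcub.
  by rewrite leq_mul // leq_mul.
have leX3 m : `|m| <= X -> `|m| <= 2 * X ^+ 3.
  move=> h; apply: le_trans h _; have := Xle 1%N 3%N isT; rewrite expr1.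
  by move: (X ^+ 3) X0; clear; lia.
have leX3M (m n : int) : `|m| <= 2 * X ^+ 2 -> `|n| <= X -> `|m * n| <= 2 * X ^+ 3.
  by move=> h1 h2; rewrite normrM exprSr mulrA ler_pM.
(* The resultant vanishes, so the forms share the factor [ab x + ac y]; up to the constant [ab ac]
   the cofactors are [ac A1 x + ab C1 y] and [ac A2 x + ab C2 y], which give a linear relation. *)
have [ac0|acn0] := eqVneq ac 0; last first.
  apply: (cub (ac * A1) (ab * C1) (ac * A2) (ab * C2)); rewrite ?leX3M //.
    have -> : ac * A1 * (ab * C2) - ac * A2 * (ab * C1) = ac ^+ 2 * ab.
      by rewrite /ac /Mac; ring.
    rewrite mulf_neq0 ?expf_neq0 //; apply: contraNneq acn0 => abz.
    by move/eqP: RE; rewrite abz mul0r expf_eq0.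
  move=> x xS; have [gn0 h1 h2] := gl x xS; apply: (mulfI gn0); rewrite mulr0.
  transitivity ((ac * A1 * a x + ab * C1 * b x) * L2 x - (ac * A2 * a x + ab * C2 * b x) * L1 x).
    by rewrite h1 h2; ring.
  transitivity (a x * b x ^+ 2 * (ac ^+ 2 - ab * bc)); last by rewrite RE subrr mulr0.
  by rewrite /L1 /L2 /ab /ac /bc /Mac /quad; ring.
(* If [ab] is nonzero, both forms are divisible by [x], and the cofactors give the linear
   relation. *)
have [ab0|abn0] := eqVneq ab 0; last first.
  have bc0 : bc = 0.
    by apply: (mulfI abn0); rewrite -RE ac0 mulr0 expr0n.
  have C10 : C1 = 0.
    apply: (mulfI abn0); transitivity (ac * B1 - A1 * bc); last by rewrite ac0 bc0; ring.
    by rewrite /ab /ac /bc /Mac; ring.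
  have C20 : C2 = 0.
    apply: (mulfI abn0); transitivity (ac * B2 - A2 * bc); last by rewrite ac0 bc0; ring.
    by rewrite /ab /ac /bc /Mac; ring.
  apply: (cub A1 B1 A2 B2); rewrite ?leX3 //.
  move=> x xS; have [gn0 h1 h2] := gl x xS.
  have ax0 : a x != 0.
    apply: contraNneq gn0 => ax0; rewrite /g /gmult /L1 /L2 /quad ax0 C10 C20.
    by apply/eqP; ring.
  apply: (mulfI ax0); rewrite mulr0 -(hS x (S'S x xS)) /quad C10 C20; ring.
(* If [bc] is nonzero, both forms are divisible by [y]. *)
have [bc0|bcn0] := eqVneq bc 0; last first.
  have A10 : A1 = 0.
    apply: (mulfI bcn0); transitivity (ac * B1 - C1 * ab); last by rewrite ac0 ab0; ring.
    by rewrite /ab /ac /bc /Mac; ring.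
  have A20 : A2 = 0.
    apply: (mulfI bcn0); transitivity (ac * B2 - C2 * ab); last by rewrite ac0 ab0; ring.
    by rewrite /ab /ac /bc /Mac; ring.
  apply: (cub B1 C1 B2 C2); rewrite ?leX3 //.
  move=> x xS; have bx0 : b x != 0 by rewrite gt_eqF.
  apply: (mulfI bx0); rewrite mulr0 -(hS x (S'S x xS)) /quad A10 A20; ring.
(* All minors vanish: the forms are proportional, so [(u, v)] has a constant direction. *)
have fix_ (m1 m2 : int) : (m1 != 0) || (m2 != 0) ->
    (forall x, x \in S' -> m1 * L2 x - m2 * L1 x = 0) -> (#|S'| <= K2 + K3 + K4)%N.
  move=> m0 hm; apply: (@leq_trans K2); last by rewrite -addnA leq_addr.
  apply: (fixed_direction_count m0 uH vH) => x xS; have [gn0 h1 h2] := gl x xS.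
  by apply: (mulfI gn0); rewrite mulr0 -(hm x xS) h1 h2; ring.
have [hA|hA] := boolP ((A1 != 0) || (A2 != 0)).
  apply: (fix_ A1 A2 hA) => x _.
  transitivity (a x * b x * ab + b x ^+ 2 * ac); last by rewrite ab0 ac0 !mulr0 addr0.
  by rewrite /L1 /L2 /ab /ac /Mac /quad; ring.
have [hB|hB] := boolP ((B1 != 0) || (B2 != 0)).
  apply: (fix_ B1 B2 hB) => x _.
  transitivity (- a x ^+ 2 * ab + b x ^+ 2 * bc); last by rewrite ab0 bc0 !mulr0 addr0.
  by rewrite /L1 /L2 /ab /bc /Mac /quad; ring.
have [hC|hC] := boolP ((C1 != 0) || (C2 != 0)).
  apply: (fix_ C1 C2 hC) => x _.
  transitivity (- a x ^+ 2 * ac - a x * b x * bc); last by rewrite ac0 bc0 !mulr0 subr0.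
  by rewrite /L1 /L2 /ac /bc /Mac /quad; ring.
move: hA hB hC nz; rewrite !negb_or !negbK.
by move=> /andP[/eqP-> /eqP->] /andP[/eqP-> /eqP->] /andP[/eqP-> /eqP->]; rewrite eqxx.
Qed.

End Points.

(** * Parametrisation of square divisors *)

(* Reduction of the positive definite form [A x^2 + 2 n x y + B y^2] of determinant 1. *)
Lemma form_reduction (A B n : int) : 0 < A -> A * B = n ^+ 2 + 1 ->
  exists p q r s, [/\ A = p ^+ 2 + q ^+ 2, B = r ^+ 2 + s ^+ 2,
                      n = p * r + q * s & p * s - q * r = 1].
Proof.
have [m] := ubnP `|n|; elim: m A B n => // m IH A B n nm A0 AB.
have n2 : 0 <= n ^+ 2 by apply: sqr_ge0.
have B0 : 0 < B by rewrite -(pmulr_rgt0 _ A0) AB ltr_wpDl.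
wlog le_AB : A B A0 B0 AB / A <= B.
  move=> W; case: (lerP A B) => [h|/ltW h]; first exact: W.
  have [] := W B A B0 A0 _ h; first by rewrite mulrC.
  move=> p [q [r [s [e1 e2 e3 e4]]]]; exists r, (- s), p, (- q); split; rewrite ?sqrrN //.
    by rewrite e3; ring.
  by rewrite -[RHS]e4; ring.
case: (eqVneq n 0) => [n0|nn0].
  have A1 : A = 1.
    by move: AB; rewrite n0 expr0n add0r => /[dup] h /intmul_eq1[]; move: h A0 B0; clear; nia.
  have B1 : B = 1 by move: AB; rewrite n0 A1 expr0n add0r mul1r.
  by exists 1, 0, 0, 1; rewrite n0 A1 B1; split.
have An : A <= `|n|.
  rewrite leNgt; apply/negP => h.
  have h1 : `|n| + 1 <= A by move: h; clear; lia.
  have : (`|n| + 1) * (`|n| + 1) <= A * B.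
    by apply: ler_pM => //; rewrite ?addr_ge0 // (le_trans h1).
  rewrite AB -[n ^+ 2]real_normK ?num_real // expr2 mulrDl mulrDr !mulr1 mul1r.
  by move: nn0; clear; move: (`|n| * `|n|); lia.
pose sg : int := if 0 <= n then 1 else -1.
have sgn : n = sg * `|n|.
  by rewrite /sg; case: (lerP 0 n) => h; [rewrite mul1r ger0_norm | rewrite mulN1r ltr0_norm ?opprK].
have sg2 : sg * sg = 1 by rewrite /sg; case: ifP.
have [||p [q [r [s [e1 e2 e3 e4]]]]] := IH A (B - 2 * sg * n + A) (n - sg * A) _ A0.
- have : `|n - sg * A| = `|n| - A.
    have -> : n - sg * A = sg * (`|n| - A) by rewrite mulrBr -sgn.
    have -> : `|sg * (`|n| - A)| = 1 * `| `|n| - A|.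
      by rewrite normrM; congr (_ * _); rewrite /sg; case: ifP.
    by rewrite mul1r ger0_norm ?subr_ge0.
  by move: nm A0 An; clear; lia.
- have -> : A * (B - 2 * sg * n + A) = A * B - 2 * sg * n * A + A ^+ 2 by ring.
  have -> : (n - sg * A) ^+ 2 = n ^+ 2 - 2 * sg * n * A + (sg * sg) * A ^+ 2 by ring.
  by rewrite AB sg2; ring.
exists p, q, (r + sg * p), (s + sg * q); split => //.
- transitivity (B + A - (sg * sg) * A); first by rewrite sg2; ring.
  transitivity ((B - 2 * sg * n + A) + 2 * sg * (n - sg * A) + sg * sg * A); first ring.
  by rewrite e2 e3 e1; ring.
- by transitivity ((n - sg * A) + sg * A); [ring | rewrite e3 e1; ring].
- by rewrite -[RHS]e4; ring.
Qed.

(** The witness is [gcd(m, k)]: its square is [gcd(m^2, m n) = m gcd(m, n) = m]. *)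
Lemma coprime_mul_square (m n k : nat) : coprime m n -> (m * n = k ^ 2)%N ->
  exists r, (m = r ^ 2)%N.
Proof.
move=> cop E; exists (gcdn m k).
have : (gcdn m k ^ 2 = gcdn (m ^ 2) (k ^ 2))%N.
  case: (posnP m) => [->|m0]; first by rewrite gcd0n exp0n // gcd0n.
  set g := gcdn m k; have g0 : (0 < g)%N by rewrite gcdn_gt0 m0.
  have [m' em] : exists m', m = (m' * g)%N by apply/dvdnP/dvdn_gcdl.
  have [k' ek] : exists k', k = (k' * g)%N by apply/dvdnP/dvdn_gcdr.
  have c : coprime m' k'.
    by rewrite /coprime -(eqn_pmul2r g0) muln_gcdl -em -ek mul1n.
  rewrite {1}em {1}ek !expnMn -muln_gcdl.
  have /eqP -> : coprime (m' ^ 2) (k' ^ 2) by rewrite coprimeXl // coprimeXr.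
  by rewrite mul1n.
by rewrite -E expnS expn1 -muln_gcdr (eqP cop) muln1 => ->.
Qed.

Lemma dvd2_sqr (x : int) : (2 %| x ^+ 2)%Z = (2 %| x)%Z.
Proof. by rewrite !dvdzE abszX Euclid_dvdX ?andbT. Qed.

Lemma pythagorean (p q d : int) : 0 < d -> coprimez p q -> ~~ (2 %| p)%Z -> (2 %| q)%Z ->
  p ^+ 2 + q ^+ 2 = d ^+ 2 ->
  exists a b, [/\ p = a ^+ 2 - b ^+ 2, - q = 2 * a * b & d = a ^+ 2 + b ^+ 2].
Proof.
move=> d0 cop podd /dvdzP[q' eq] E.
have dodd : ~~ (2 %| d)%Z.
  apply: contra podd => h; have : (2 %| p ^+ 2)%Z.
    have -> : p ^+ 2 = d ^+ 2 - q ^+ 2 by rewrite -E; ring.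
    by apply: rpredB; rewrite expr2; [exact: dvdz_mulr | rewrite eq mulrA dvdz_mull].
  by rewrite dvd2_sqr.
have [s es] : exists s, d + p = s * 2 by apply/dvdzP; move: dodd podd; clear; lia.
have [t et] : exists t, d - p = t * 2 by apply/dvdzP; move: dodd podd; clear; lia.
have st : s * t = q' ^+ 2.
  have : (d + p) * (d - p) = q ^+ 2.
    by transitivity (d ^+ 2 - p ^+ 2); [ring | rewrite -E; ring].
  by rewrite es et eq => h; apply: (mulfI (isT : (4 : int) != 0));
    transitivity (s * 2 * (t * 2)); [ring | rewrite h; ring].
have ds : d = s + t by move: es et; clear; lia.
have ps : p = s - t by move: es et; clear; lia.
have pd : `|p| <= d.
  rewrite -(@ler_pXn2r _ 2) ?nnegrE ?(ltW d0) // real_normK ?num_real // -E lerDl.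
  exact: sqr_ge0.
have s0 : 0 <= s by move: pd es; clear; lia.
have t0 : 0 <= t by move: pd et; clear; lia.
have cst : coprimez s t.
  have /coprimezP[[x y] /= hxy] : coprimez (p) (q' ^+ 2).
    apply: coprimezXr; move: cop; rewrite eq coprimezMr => /andP[//].
  apply/coprimezP; exists (x + y * t, - x); rewrite /= -hxy -st ps; ring.
have [a ea] : exists a : nat, s = (a : int) ^+ 2.
  have [|a ha] := @coprime_mul_square `|s| `|t| `|q'| cst.
    by rewrite -abszM st abszX.
  by exists a; rewrite -[s]gez0_abs // ha -mulnn PoszM expr2.
have [b eb] : exists b : nat, t = (b : int) ^+ 2.
  have [||b hb] := @coprime_mul_square `|t| `|s| `|q'|; first by rewrite coprime_sym.
    by rewrite -abszM mulrC st abszX.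
  by exists b; rewrite -[t]gez0_abs // hb -mulnn PoszM expr2.
have : (q' - a%:Z * b%:Z) * (q' + a%:Z * b%:Z) = 0.
  by transitivity (q' ^+ 2 - a%:Z ^+ 2 * b%:Z ^+ 2); [ring | rewrite -st ea eb; ring].
move/eqP; rewrite mulf_eq0 subr_eq0 addr_eq0 => /orP[] /eqP hq.
  by exists a%:Z, (- b%:Z); split; rewrite ?sqrrN ?ps ?ds ?eq ?hq ?ea ?eb //; ring.
by exists a%:Z, b%:Z; split; rewrite ?ps ?ds ?eq ?hq ?ea ?eb //; ring.
Qed.

(** Reducing the form [d^2 x^2 + 2 n x y + e y^2] of determinant 1 factors [n + i] as
    [(p - iq) (r + is)] with [p^2 + q^2 = d^2]. Up to a unit the primitive Gaussian integer
    [p - iq], of odd square norm, is a square [(a + ib)^2], by the parametrisation of Pythagorean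
    triples. *)
Lemma square_divisor_param (n d : int) : 0 < d -> (d ^+ 2 %| n ^+ 2 + 1)%Z ->
  exists a b u v, [/\ d = a ^+ 2 + b ^+ 2, im_form a b u v = 1, re_form a b u v = n,
                      `|a| <= b & 0 < b].
Proof.
move=> d0 /dvdzP[e he].
have d20 : 0 < d ^+ 2 by rewrite exprn_gt0.
have [||p [q [r [s [e1 e2 e3 e4]]]]] := @form_reduction (d ^+ 2) e n => //.
  by rewrite mulrC -he.
have cop : coprimez p q.
  by apply/coprimezP; exists (s, - r); rewrite /= -[RHS]e4; ring.
have dodd : ~~ (2 %| d)%Z.
  apply/negP => /dvdzP[k ek]; move: he; rewrite ek.
  have -> : e * (k * 2) ^+ 2 = 4 * (e * k ^+ 2) by ring.
  have [m [->|->]] : exists m, n = m * 2 \/ n = m * 2 + 1.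
    by exists (n %/ 2)%Z; clear; lia.
  - by rewrite exprMn (_ : 2 ^+ 2 = 4 :> int) //; move: (m ^+ 2) (e * _); clear; lia.
  - have -> : (m * 2 + 1) ^+ 2 = 4 * (m ^+ 2 + m) + 1 by ring.
    by move: (_ + m) (e * _); clear; lia.
have parity := dvd2_sqr.
have podd : (2 %| p)%Z != (2 %| q)%Z.
  rewrite -(parity p) -(parity q); move: dodd; rewrite -parity e1.
  by move: (p ^+ 2) (q ^+ 2); clear; lia.
have [a [b [u [v [E1 E2 E3]]]]] : exists a b u v, [/\ d = a ^+ 2 + b ^+ 2,
    im_form a b u v = 1 & re_form a b u v = n].
  case: (boolP (2 %| p)%Z) podd => hp hq.
    have [||||a [b [h1 h2 h3]]] := @pythagorean q (- p) d d0.
    - by rewrite coprimezN coprimez_sym.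
    - by move: hq; case: (2 %| q)%Z.
    - by rewrite dvdzE abszN -dvdzE.
    - by rewrite sqrrN addrC -e1.
    exists a, b, s, (- r); rewrite opprK in h2; split => //.
      by rewrite /im_form -h2 -h1 -e4; ring.
    by rewrite /re_form -h2 -h1 e3; ring.
  have [|a [b [h1 h2 h3]]] := @pythagorean p q d d0 cop hp _ (esym e1).
    by move: hq; case: (2 %| q)%Z.
  exists a, b, r, s; split => //.
    by rewrite /im_form -h2 -h1 -e4; ring.
  by rewrite /re_form -h2 -h1 e3; ring.
have W (a' b' u' v' : int) : d = a' ^+ 2 + b' ^+ 2 -> im_form a' b' u' v' = 1 ->
    re_form a' b' u' v' = n -> `|a'| <= `|b'| ->
    exists a b u v, [/\ d = a ^+ 2 + b ^+ 2, im_form a b u v = 1, re_form a b u v = n,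
                      `|a| <= b & 0 < b].
  move=> h1 h2 h3 h4.
  have b0 : b' != 0.
    apply: contraTneq d0 => bz; rewrite h1; move: h4; rewrite bz normr0 normr_le0 => /eqP ->.
    by rewrite expr0n.
  case: (ltrP 0 b') => hb; first by exists a', b', u', v'; split => //; rewrite -(gtr0_norm hb).
  exists (- a'), (- b'), u', v'; split; rewrite ?sqrrN ?normrN //.
  - by rewrite -[RHS]h2 /im_form; ring.
  - by rewrite -h3 /re_form; ring.
  - by rewrite (le_trans h4) // ler0_norm.
  - by rewrite oppr_gt0 lt_def eq_sym b0.
case: (lerP `|a| `|b|) => [|/ltW] hab; first exact: (W a b u v).
(* Replacing [a + ib] by [i (a + ib)] changes the sign of its square, which [(u, v)] absorbs. *)
apply: (W (- b) a (- u) (- v)); rewrite ?normrN //.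
- by rewrite E1; ring.
- by rewrite -[RHS]E2 /im_form; ring.
- by rewrite -E3 /re_form; ring.
Qed.

(** * The divisor bound *)

Section DivisorBound.
Local Open Scope nat_scope.

(** This is [e + 1 <= k 2^(e/k)], which already holds with the integer quotient [e %/ k] because
    [n + 1 <= 2^n]. *)
Lemma expSn_le_exp2 k e : 0 < k -> e.+1 ^ k <= k ^ k * 2 ^ e.
Proof.
move=> k0; have h : e.+1 <= k * 2 ^ (e %/ k).
  apply: (@leq_trans (k * (e %/ k).+1)); first by rewrite mulnC ltn_ceil.
  by rewrite leq_mul2l ltn_expl ?orbT.
apply: (@leq_trans ((k * 2 ^ (e %/ k)) ^ k)); first by rewrite leq_exp2r.
by rewrite expnMn leq_mul2l -expnM leq_exp2l // leq_trunc_div orbT.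
Qed.

Lemma size_divisors_part p n : prime p -> 0 < n ->
  size (divisors n) <= (logn p n).+1 * size (divisors n`_p^').
Proof.
move=> pp n0.
pose s := [seq (i, d) | i <- iota 0 (logn p n).+1, d <- divisors n`_p^'].
have -> : (logn p n).+1 * size (divisors n`_p^') = size s.
  by rewrite size_allpairs size_iota.
rewrite -(size_map (fun d => (logn p d, d`_p^'))); apply: uniq_leq_size.
  rewrite map_inj_in_uniq ?divisors_uniq // => d d'.
  rewrite -!dvdn_divisors // => dn d'n [el ed].
  have d0 := dvdn_gt0 n0 dn; have d'0 := dvdn_gt0 n0 d'n.
  by rewrite -(partnC p d0) -(partnC p d'0) !p_part el ed.
move=> x /mapP[d]; rewrite -dvdn_divisors // => dn ->.
apply: allpairs_f; first by rewrite mem_iota /= add0n ltnS dvdn_leq_log.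
by rewrite -dvdn_divisors ?part_gt0 // partn_dvd.
Qed.

(** Induction removing one prime [p], of exponent [e], at a time. For [p >= 2^k] the factor
    [(e + 1)^k] is at most [p^e]; each smaller prime costs at most an extra [k^k]. *)
Lemma divisor_bound_primes k n : 0 < k -> 0 < n ->
  size (divisors n) ^ k <= (k ^ k) ^ count (fun p => p < 2 ^ k) (primes n) * n.
Proof.
move=> k0; have [m] := ubnP n; elim: m n => // m IH n nm n0.
case: (leqP n 1) => n1.
  by have -> : n = 1 by [move: n0 n1; lia]; rewrite (_ : divisors 1 = [:: 1]) ?exp1n /= ?exp1n ?expn0.
set p := pdiv n; have pp : prime p by apply: pdiv_prime.
have m0 : 0 < n`_p^' := part_gt0 _ _.
have nE : n = p ^ logn p n * n`_p^' by rewrite -{1}(partnC p n0) p_part.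
have lp : 0 < logn p n by rewrite logn_gt0 mem_primes pp n0 pdiv_dvd.
have mn : n`_p^' < n.
  rewrite {2}nE -[X in X < _]mul1n ltn_pmul2r //.
  by rewrite -(exp1n (logn p n)) ltn_exp2r // prime_gt1.
have IHm := IH _ (leq_trans mn nm) m0.
apply: (@leq_trans (((logn p n).+1 * size (divisors n`_p^')) ^ k)).
  by rewrite leq_exp2r // size_divisors_part.
rewrite expnMn.
have cnt : count (fun q => q < 2 ^ k) (primes n) =
    (p < 2 ^ k) + count (fun q => q < 2 ^ k) (primes n`_p^').
  rewrite primes_part; have pin : p \in primes n by rewrite mem_primes pp n0 pdiv_dvd.
  have := perm_to_rem pin => /permP ->; rewrite /= rem_filter ?primes_uniq //.
rewrite cnt expnD [X in _ <= _ * X]nE mulnACA leq_mul //.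
case: ltnP => hp.
  rewrite expn1; apply: leq_trans (expSn_le_exp2 _ k0) _.
  by rewrite leq_mul2l leq_exp2r // prime_gt1 ?orbT.
rewrite expn0 mul1n; apply: (@leq_trans ((2 ^ k) ^ logn p n)).
  by rewrite -expnM mulnC expnM leq_exp2r // ltn_expl.
by rewrite leq_exp2r.
Qed.

Lemma divisor_bound k : 0 < k -> exists2 C, 0 < C &
  forall n, 0 < n -> size (divisors n) ^ k <= C * n.
Proof.
move=> k0; exists ((k ^ k) ^ (2 ^ k)); first by rewrite !expn_gt0 k0.
move=> n n0; apply: leq_trans (divisor_bound_primes k0 n0) _.
rewrite leq_mul2r; apply/orP; right; apply: leq_pexp2l; first by rewrite expn_gt0 k0.
rewrite -size_filter -[X in _ <= X](size_iota 0); apply: uniq_leq_size.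
  by rewrite filter_uniq ?primes_uniq.
by move=> q; rewrite mem_filter mem_iota => /andP[].
Qed.

Lemma log_bound k : 0 < k -> exists2 C, 0 < C &
  forall n, 0 < n -> (up_log 2 n).+1 ^ k <= C * n.
Proof.
move=> k0; exists (2 ^ k * (k ^ k * 2)); first by rewrite !muln_gt0 !expn_gt0 k0.
move=> n n0; case: (leqP n 1) => n1.
  have -> : n = 1 by [move: n0 n1; lia].
  by rewrite up_log1 exp1n muln1 !muln_gt0 !expn_gt0 k0.
have := up_log_gtn (isT : 1 < 2) n1; set l := up_log 2 n => hl.
have l0 : 0 < l by rewrite up_log_gt0.
apply: leq_trans (expSn_le_exp2 _ k0) _.
rewrite -(prednK l0) expnS mulnA; apply: leq_mul (ltnW hl).
by rewrite leq_pmull // expn_gt0.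
Qed.

End DivisorBound.

(** * Relations from the pigeonhole principle *)

(** The images of the [(X + 1)^n] integer vectors with entries in [[0, X]] are placed in boxes of
    side [s i], of which there are at most [X^n]. Since conditions and unknowns are equal in number,
    [X] cancels from the hypothesis on the product. *)
Lemma small_values_pigeonhole (F : archiRealFieldType) (n X : nat)
    (lam : 'I_n -> 'I_n -> F) (s : 'I_n -> F) (c : F) :
  (0 < n)%N -> (0 < X)%N -> 0 < c -> (forall i, 0 < s i) -> (forall i, \sum_j `|lam i j| <= c) ->
  (forall i, s i <= c * X%:R) -> (5 * c) ^+ n <= \prod_i s i ->
  exists v : 'I_n -> int, [/\ exists j, v j != 0, forall j, `|v j| <= X%:Z
    & forall i, `|\sum_j lam i j * (v j)%:~R| < s i].
Proof.
move=> n0 X0 c0 s0 hlam hs hprod.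
have XR : (0 : F) < X%:R by rewrite ltr0n.
pose K i := (Num.truncn (c * X%:R / s i)).+1.
pose val_ (v : {ffun 'I_n -> 'I_X.+1}) i := \sum_j lam i j * (v j)%:R.
have q0 i : 0 <= c * X%:R / s i by rewrite divr_ge0 ?mulr_ge0 // ltW.
have hval v i : `|val_ v i| <= c * X%:R.
  apply: le_trans (ler_norm_sum _ _ _) _.
  apply: (@le_trans _ _ (\sum_j `|lam i j| * X%:R)).
    apply: ler_sum => j _; rewrite normrM ler_wpM2l // normr_nat ler_nat.
    by rewrite -ltnS ltn_ord.
  by rewrite -mulr_suml ler_wpM2r.
have hKv v i : - (K i)%:R <= val_ v i / s i < (K i)%:R.
  have h : `|val_ v i / s i| < (K i)%:R.
    rewrite normrM normfV (gtr0_norm (s0 i)).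
    apply: (@le_lt_trans _ _ (c * X%:R / s i)); first by rewrite ler_wpM2r ?invr_ge0 // ltW.
    by have /andP[] := truncn_itv (q0 i).
  by move: h; rewrite ltr_norml => /andP[/ltW -> ->].
pose cell_ v i := Num.truncn (val_ v i / s i + (K i)%:R).
have hpos v i : 0 <= val_ v i / s i + (K i)%:R.
  by have /andP[h _] := hKv v i; rewrite -lerBlDr sub0r.
have hcell v i : (cell_ v i < 2 * K i)%N.
  rewrite -(ltr_nat F); apply: le_lt_trans (_ : _ <= val_ v i / s i + (K i)%:R) _.
    by have /andP[] := truncn_itv (hpos v i).
  by rewrite mul2n -addnn natrD ltrD2r; have /andP[] := hKv v i.
pose f v : {dffun forall i : 'I_n, 'I_(2 * K i)} := [ffun i => Ordinal (hcell v i)].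
have lt_card : (#|{: {dffun forall i : 'I_n, 'I_(2 * K i)}}| < #|{: {ffun 'I_n -> 'I_X.+1}}|)%N.
  rewrite card_ffun !card_ord card_dep_ffun foldrE big_map big_enum /=.
  under eq_bigr do rewrite card_ord.
  rewrite -(ltr_nat F) natr_prod natrX.
  have P0 : 0 < \prod_i s i by apply: prodr_gt0.
  (* With [q = c X / s i >= 1], the number [2 K i] of boxes in direction [i] is at most
     [2 (q + 1) <= 4 q]. *)
  apply: (@le_lt_trans _ _ (\prod_i (5 * c * X%:R / s i))).
    apply: ler_prod => i _; rewrite ler0n /=.
    have q1 : 1 <= c * X%:R / s i by rewrite ler_pdivlMr // mul1r.
    have /andP[h _] := truncn_itv (q0 i).
    rewrite natrM -[(K i)]addn1 natrD -!mulrA; move: h q1; rewrite -!mulrA; lra.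
  rewrite big_split /= prodr_const card_ord prodfV exprMn.
  apply: (@le_lt_trans _ _ (X%:R ^+ n)).
    by rewrite mulrAC ler_piMl ?exprn_ge0 ?(ltW XR) // ler_pdivrMr // mul1r.
  by rewrite ltrXn2r -?lt0n // ltr_nat.
have : ~~ injectiveb f.
  apply/negP => /injectiveP /leq_card; by rewrite leqNgt lt_card.
case/injectivePn => v [w vw fvw].
exists (fun j => (v j)%:Z - (w j)%:Z); split.
- have [j hj] : exists j, v j != w j.
    apply/existsP; apply: contraNT vw; rewrite negb_exists => /forallP h.
    by apply/eqP/ffunP => j; apply/eqP; have := h j; rewrite negbK.
  by exists j; rewrite subr_eq0.
- by move=> j; have := ltn_ord (v j); have := ltn_ord (w j); lia.
- move=> i; have : cell_ v i = cell_ w i.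
    by move/ffunP/(_ i): fvw; rewrite !ffunE => /(congr1 val).
  rewrite /cell_ => e.
  have /andP[v1 v2] := truncn_itv (hpos v i); have /andP[w1 w2] := truncn_itv (hpos w i).
  rewrite e in v1 v2.
  have -> : \sum_j lam i j * ((v j)%:Z - (w j)%:Z)%:~R = val_ v i - val_ w i.
    by rewrite /val_ -sumrB; apply: eq_bigr => j _; rewrite intrB mulrBr.
  have key : `|(val_ v i / s i + (K i)%:R) - (val_ w i / s i + (K i)%:R)| < 1.
    by rewrite ltr_norml; move: v1 v2 w1 w2; rewrite -[(Num.truncn _).+1]addn1 natrD; lra.
  have -> : val_ v i - val_ w i =
     ((val_ v i / s i + (K i)%:R) - (val_ w i / s i + (K i)%:R)) * s i.
    by field; rewrite gt_eqF.
  by rewrite normrM (gtr0_norm (s0 i)) gtr_pMl.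
Qed.

Lemma norm_mul_exp_le (F : realFieldType) (x h c M : F) (i : nat) : 0 < M -> 0 <= h -> h <= M^-1 ->
  `|x| <= c * M ^+ i -> `|x * h ^+ i| <= c.
Proof.
move=> M0 h0 hM hx; rewrite normrM normrX (ger0_norm h0).
have Mi : 0 < M ^+ i by rewrite exprn_gt0.
apply: (@le_trans _ _ (c * M ^+ i * M^-1 ^+ i)); last by rewrite exprVn mulfK // gt_eqF.
apply: ler_pM => //; first by rewrite exprn_ge0.
by apply: lerXn2r; rewrite ?nnegrE // invr_ge0 ltW.
Qed.

Lemma slope_offset (F : realFieldType) (a b k M : int) : 0 < b -> 0 < M ->
  k * b <= a * M -> a * M < (k + 1) * b ->
  let h := a%:~R / b%:~R - k%:~R / M%:~R : F in
  [/\ 0 <= h, h <= (M%:~R)^-1 & a%:~R = b%:~R * (k%:~R / M%:~R + h) :> F].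
Proof.
move=> b0 M0 h1 h2 h.
have bR : (0 : F) < b%:~R by rewrite ltr0z.
have MR : (0 : F) < M%:~R by rewrite ltr0z.
have h1' : k%:~R * b%:~R <= a%:~R * M%:~R :> F by rewrite -!intrM ler_int.
have h2' : a%:~R * M%:~R <= (k%:~R + 1) * b%:~R :> F.
  by rewrite -[1 in X in _ <= X]/(1%:~R) -intrD -!intrM ler_int ltW.
split.
- rewrite /h subr_ge0 ler_pdivrMr // mulrAC ler_pdivlMr //.
- rewrite /h lerBlDr -[X in X + _]mul1r -mulrDl addrC ler_pdivrMr // mulrAC ler_pdivlMr //.
- by rewrite /h; field; rewrite !gt_eqF.
Qed.

Lemma ler_norm_add3 (F : numDomainType) (x1 x2 x3 c1 c2 c3 : F) :
  `|x1| <= c1 -> `|x2| <= c2 -> `|x3| <= c3 -> `|x1 + x2 + x3| <= c1 + c2 + c3.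
Proof.
move=> h1 h2 h3; apply: le_trans (ler_normD _ _) _; apply: lerD => //.
by apply: le_trans (ler_normD _ _) _; apply: lerD.
Qed.

Lemma ler_norm_add5 (F : numDomainType) (x1 x2 x3 x4 x5 c1 c2 c3 c4 c5 : F) :
  `|x1| <= c1 -> `|x2| <= c2 -> `|x3| <= c3 -> `|x4| <= c4 -> `|x5| <= c5 ->
  `|x1 + x2 + x3 + x4 + x5| <= c1 + c2 + c3 + c4 + c5.
Proof. by move=> h1 h2 h3 h4 h5; apply: ler_norm_add3 => //; apply: ler_norm_add3. Qed.

Lemma int_small_eq0 (F : archiRealFieldType) (P : int) (D : F) : 0 < D -> `|P%:~R * D| < D -> P = 0.
Proof.
move=> D0; rewrite normrM (gtr0_norm D0) gtr_pMl // -intr_norm (ltr_int _ _ 1).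
by clear; lia.
Qed.

Lemma slope_pow_bounds (F : realFieldType) (t : F) : `|t| <= 1 ->
  [/\ -1 <= t <= 1, 0 <= t ^+ 2 <= 1, -1 <= t ^+ 3 <= 1 & 0 <= t ^+ 4 <= 1].
Proof.
move=> ht.
have hX i : `|t ^+ i| <= 1 by rewrite normrX exprn_ile1.
split; rewrite -?ler_norml ?hX // ?real_exprn_even_ge0 ?num_real //=.
  by have := hX 2%N; rewrite ler_norml => /andP[].
by have := hX 4%N; rewrite ler_norml => /andP[].
Qed.

(* With [w = a + ib], [G = (a^2 - b^2) L1 - 2 a b L2] and [K = 2 a b L1 + (a^2 - b^2) L2]
   one has [|w|^4 (u L1 + v L2) = n G + K]. The rows are the Taylor coefficients at the
   slope [t = a / b] of [G] (degrees 0 to 3) and of [K] (degrees 0 and 1), as linear forms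
   in the six coefficients of [L1] and [L2]. *)
Definition rows6 (F : realFieldType) (t : F) : seq (seq F) :=
 [:: [:: t ^+ 4 - t ^+ 2; t ^+ 3 - t; t ^+ 2 - 1; - 2 * t ^+ 3; - 2 * t ^+ 2; - 2 * t];
     [:: 4 * t ^+ 3 - 2 * t; 3 * t ^+ 2 - 1; 2 * t; - 6 * t ^+ 2; - 4 * t; - 2];
     [:: 6 * t ^+ 2 - 1; 3 * t; 1; - 6 * t; - 2; 0];
     [:: 4 * t; 1; 0; - 2; 0; 0];
     [:: 2 * t ^+ 3; 2 * t ^+ 2; 2 * t; t ^+ 4 - t ^+ 2; t ^+ 3 - t; t ^+ 2 - 1];
     [:: 6 * t ^+ 2; 4 * t; 2; 4 * t ^+ 3 - 2 * t; 3 * t ^+ 2 - 1; 2 * t]].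

Lemma rows6_bound (F : realFieldType) (t : F) (i j : 'I_6) : `|t| <= 1 ->
  `|nth 0 (nth [::] (rows6 t) i) j| <= 7.
Proof.
case/slope_pow_bounds; rewrite /rows6.
move: (t ^+ 4) (t ^+ 3) (t ^+ 2) => t4 t3 t2.
move=> /andP[? ?] /andP[? ?] /andP[? ?] /andP[? ?].
case: i => -[|[|[|[|[|[|i]]]]]] //= _;
  by case: j => -[|[|[|[|[|[|j]]]]]] //= _; rewrite ler_norml; apply/andP; split; lra.
Qed.

(** Every Taylor term of [n G + K] must be small: degree [i] of [G] gets the scale [M^i / (16 N)]
    and degree [i] of [K] the scale [M^i / 16]. The six scales multiply to a constant times
    [M^7 / N^4]. The remaining terms, degree 4 of [G] and degrees 2 to 4 of [K], are small for all
    coefficients of size [N] because [216 N <= M^2]. *)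
Lemma quadratic_relation (F : archiRealFieldType) (N M : nat) (k : int) :
  (0 < N)%N -> (0 < M)%N -> `|k| <= M%:Z ->
  (5 * 42 * 16) ^+ 6 * N%:R ^+ 4 <= M%:R ^+ 7 :> F -> 216 * N%:R <= M%:R ^+ 2 :> F ->
  M%:R ^+ 3 <= N%:R ^+ 2 :> F ->
  exists A1 B1 C1 A2 B2 C2 : int,
    [/\ ~~ [&& A1 == 0, B1 == 0, C1 == 0, A2 == 0, B2 == 0 & C2 == 0],
        [/\ `|A1| <= N%:Z, `|B1| <= N%:Z & `|C1| <= N%:Z],
        [/\ `|A2| <= N%:Z, `|B2| <= N%:Z & `|C2| <= N%:Z] &
    forall a b u v : int, 0 < b -> im_form a b u v = 1 -> `|re_form a b u v| <= N%:Z ->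
      k * b <= a * M%:Z -> a * M%:Z < (k + 1) * b ->
      u * quad A1 B1 C1 a b + v * quad A2 B2 C2 a b = 0].
Proof.
move=> N0 M0 kM hM7 NM h3.
pose t : F := k%:~R / (M%:Z)%:~R.
have MR : (0 : F) < (M%:Z)%:~R by rewrite ltr0z.
have NR : (0 : F) < N%:R by rewrite ltr0n.
have ht : `|t| <= 1.
  by rewrite normrM normfV (gtr0_norm MR) ler_pdivrMr // mul1r -intr_norm ler_int.
have [t1 t2 t3 t4] := slope_pow_bounds ht.
have N1 : (1 : F) <= N%:R by rewrite ler1n.
have M1 : (1 : F) <= M%:R by rewrite ler1n.
pose sc : seq F := [:: (16 * N%:R)^-1; M%:R / (16 * N%:R); M%:R ^+ 2 / (16 * N%:R);
  M%:R ^+ 3 / (16 * N%:R); 16^-1; M%:R / 16].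
pose lam (i j : 'I_6) := nth 0 (nth [::] (rows6 t) i) j.
have c42 : (0 : F) < 42 by rewrite ltr0n.
have M0' : (0 : F) < M%:R by [].
have N16 : (0 : F) < 16 * N%:R by rewrite mulr_gt0.
have [||||v [[j0 vj0] vN vs]] := @small_values_pigeonhole F 6 N lam (fun i => sc`_i) 42 isT N0 c42.
- by case=> -[|[|[|[|[|[|i]]]]]] //= _; rewrite ?invr_gt0 ?divr_gt0 ?exprn_gt0.
- move=> i; apply: (@le_trans _ _ (\sum_(j < 6) 7)).
    by apply: ler_sum => j _; exact: rows6_bound.
  by rewrite sumr_const card_ord -mulr_natr; lra.
- have h2 : M%:R ^+ 2 <= N%:R ^+ 2 :> F.
    by apply: le_trans h3; rewrite [in X in _ <= X]exprS ler_peMl // exprn_ge0 // ltW.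
  have h1 : M%:R <= N%:R :> F by rewrite -(@ler_pXn2r _ 2) ?nnegrE // ltW.
  have hN2 : N%:R ^+ 2 / (16 * N%:R) <= 42 * N%:R :> F.
    by rewrite ler_pdivrMr //; move: N1; rewrite expr2; nra.
  case=> -[|[|[|[|[|[|i]]]]]] //= _; try by move: N1 M1 h1; clear; lra.
  + apply: le_trans (_ : _ <= 1) _; last by move: N1; clear; lra.
    by rewrite invf_le1 //; move: N1; clear; lra.
  + apply: le_trans (_ : _ <= 1) _; last by move: N1; clear; lra.
    by rewrite ler_pdivrMr //; move: N1 h1; clear; lra.
  + by apply: le_trans hN2; rewrite ler_wpM2r // invr_ge0 ltW.
  + by apply: le_trans hN2; rewrite ler_wpM2r // invr_ge0 ltW.
- rewrite !big_ord_recl big_ord0 /= /bump /=.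
  have -> : (16 * N%:R)^-1 * (M%:R / (16 * N%:R) * (M%:R ^+ 2 / (16 * N%:R) *
     (M%:R ^+ 3 / (16 * N%:R) * (16^-1 * (M%:R / 16 * 1))))) =
     M%:R ^+ 7 / (16 ^+ 6 * N%:R ^+ 4) :> F by field; rewrite gt_eqF.
  by rewrite ler_pdivlMr ?mulr_gt0 ?exprn_gt0 // mulrA -exprMn.
pose A1 := v ord0; pose B1 := v (lift ord0 ord0); pose C1 := v (lift ord0 (lift ord0 ord0)).
pose A2 := v (lift ord0 (lift ord0 (lift ord0 ord0))).
pose B2 := v (lift ord0 (lift ord0 (lift ord0 (lift ord0 ord0)))).
pose C2 := v (lift ord0 (lift ord0 (lift ord0 (lift ord0 (lift ord0 ord0))))).
exists A1, B1, C1, A2, B2, C2; split; [| by split; apply: vN | by split; apply: vN |].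
  apply/negP => /and5P[z1 z2 z3 z4 /andP[z5 z6]]; case/negP: vj0.
  case: j0 => -[|[|[|[|[|[|i]]]]]] // hi.
  - by rewrite (_ : Ordinal hi = ord0) //; apply: val_inj.
  - by rewrite (_ : Ordinal hi = lift ord0 ord0) //; apply: val_inj.
  - by rewrite (_ : Ordinal hi = lift ord0 (lift ord0 ord0)) //; apply: val_inj.
  - by rewrite (_ : Ordinal hi = lift ord0 (lift ord0 (lift ord0 ord0))) //; apply: val_inj.
  - rewrite (_ : Ordinal hi = lift ord0 (lift ord0 (lift ord0 (lift ord0 ord0)))) //.
    exact: val_inj.
  - rewrite (_ : Ordinal hi = lift ord0 (lift ord0 (lift ord0 (lift ord0 (lift ord0 ord0))))) //.
    exact: val_inj.
move=> a b u w b0 him hre hk1 hk2.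
have Mz : 0 < M%:Z by [].
have [h0 hM aE] := slope_offset F b0 Mz hk1 hk2.
set h := a%:~R / b%:~R - _ in h0 hM aE; rewrite -/t in aE.
have bR : (0 : F) < b%:~R by rewrite ltr0z.
pose g (i : 'I_6) : F := \sum_j lam i j * (v j)%:~R.
pose i0 : 'I_6 := ord0; pose i1 : 'I_6 := lift ord0 ord0.
pose i2 : 'I_6 := lift ord0 (lift ord0 ord0).
pose i3 : 'I_6 := lift ord0 (lift ord0 (lift ord0 ord0)).
pose i4 : 'I_6 := lift ord0 (lift ord0 (lift ord0 (lift ord0 ord0))).
pose i5 : 'I_6 := lift ord0 (lift ord0 (lift ord0 (lift ord0 (lift ord0 ord0)))).
pose r2 : F := 6 * t * A1%:~R + 2 * B1%:~R + (6 * t ^+ 2 - 1) * A2%:~R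
  + 3 * t * B2%:~R + 1 * C2%:~R.
pose r3 : F := 2 * A1%:~R + 4 * t * A2%:~R + 1 * B2%:~R.
pose Gt : F := g i0 * h ^+ 0 + g i1 * h ^+ 1 + g i2 * h ^+ 2 + g i3 * h ^+ 3 + A1%:~R * h ^+ 4.
pose Ct : F := g i4 * h ^+ 0 + g i5 * h ^+ 1 + r2 * h ^+ 2 + r3 * h ^+ 3 + A2%:~R * h ^+ 4.
set P := u * _ + w * _; set n := re_form a b u w in hre.
have E : P%:~R * ((a ^+ 2 + b ^+ 2)%:~R) ^+ 2 = b%:~R ^+ 4 * (n%:~R * Gt + Ct) :> F.
  have EZ : P * (a ^+ 2 + b ^+ 2) ^+ 2 =
     n * ((a ^+ 2 - b ^+ 2) * quad A1 B1 C1 a b - 2 * a * b * quad A2 B2 C2 a b)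
     + im_form a b u w * (2 * a * b * quad A1 B1 C1 a b + (a ^+ 2 - b ^+ 2) * quad A2 B2 C2 a b).
    by rewrite /P /n /im_form /re_form; ring.
  rewrite him mul1r in EZ.
  move/(congr1 (fun x : int => x%:~R : F)): EZ.
  rewrite intrM rmorphXn /= => ->.
  rewrite /Gt /Ct /g !big_ord_recl !big_ord0 /lam /rows6 /= /r2 /r3 /quad.
  rewrite !(rmorphD, rmorphB, rmorphM, rmorphXn, rmorphN) /= aE /A1 /B1 /C1 /A2 /B2 /C2.
  by ring.
pose e : F := (16 * N%:R)^-1.
have nb (x : F) (A : int) (c : F) : `|x| <= c -> `|A| <= N%:Z -> `|x * A%:~R| <= c * N%:R.
  move=> h1 h2; rewrite normrM ler_pM // -intr_norm -[N%:R]/((N%:Z)%:~R) ler_int //.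
have n216 : N%:R <= M%:R ^+ 2 / 216 :> F by rewrite ler_pdivlMr // mulrC.
have M2 : (1 : F) <= M%:R ^+ 2 by rewrite exprn_ege1.
have M3 : M%:R ^+ 2 <= M%:R ^+ 3 :> F by rewrite [X in _ <= X]exprS ler_peMl // exprn_ge0 // ltW.
have M4 : M%:R ^+ 2 <= M%:R ^+ 4 :> F.
  by apply: le_trans M3 _; rewrite [X in _ <= X]exprS ler_peMl // exprn_ge0 // ltW.
have gb (i : nat) (j : 'I_6) : sc`_j = e * M%:R ^+ i -> `|g j * h ^+ i| <= e.
  move=> hs; apply: (norm_mul_exp_le M0') => //; rewrite -hs; exact: ltW (vs j).
have gb' (i : nat) (j : 'I_6) : sc`_j = 16^-1 * M%:R ^+ i -> `|g j * h ^+ i| <= 16^-1.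
  move=> hs; apply: (norm_mul_exp_le M0') => //; rewrite -hs; exact: ltW (vs j).
have tt1 : `|t| <= 1 by rewrite ler_norml.
have tt2 : `|t ^+ 2| <= 1 by rewrite normrX exprn_ile1.
have hr2 : `|r2| <= 19 * N%:R.
  apply: (@le_trans _ _ (6 * N%:R + 2 * N%:R + 7 * N%:R + 3 * N%:R + 1 * N%:R)); last by move: NR; clear; lra.
  rewrite /r2; apply: ler_norm_add5;
    apply: nb; rewrite ?vN //; rewrite ler_norml; apply/andP; split; move: t1 t2; clear; lra.
have hr3 : `|r3| <= 7 * N%:R.
  apply: (@le_trans _ _ (2 * N%:R + 4 * N%:R + 1 * N%:R)); last by move: NR; clear; lra.
  rewrite /r3; apply: ler_norm_add3;
    apply: nb; rewrite ?vN //; rewrite ler_norml; apply/andP; split; move: t1 t2; clear; lra.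
have hA (A : int) : `|A| <= N%:Z -> `|A%:~R| <= N%:R :> F.
  by move=> hA; rewrite -intr_norm -[N%:R]/((N%:Z)%:~R) ler_int.
have B4 : `|A1%:~R * h ^+ 4| <= (216 * N%:R)^-1.
  apply: (norm_mul_exp_le M0') => //; apply: le_trans (hA _ (vN _)) _.
  rewrite mulrC ler_pdivlMr ?mulr_gt0 //.
  apply: (@le_trans _ _ ((216 * N%:R) ^+ 2)).
    by move: NR; clear; rewrite exprMn !expr2; nra.
  by rewrite (_ : 4 = 2 * 2)%N // exprM lerXn2r ?nnegrE ?mulr_ge0 ?exprn_ge0 ?(ltW NR) ?(ltW M0').
have B2' : `|r2 * h ^+ 2| <= 19 / 216.
  by apply: (norm_mul_exp_le M0') => //; move: hr2 n216; clear; lra.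
have B3' : `|r3 * h ^+ 3| <= 7 / 216.
  by apply: (norm_mul_exp_le M0') => //; move: hr3 n216 M3; clear; lra.
have B4' : `|A2%:~R * h ^+ 4| <= 1 / 216.
  by apply: (norm_mul_exp_le M0') => //; apply: le_trans (hA _ (vN _)) _; move: n216 M4; clear; lra.
have hG : `|Gt| <= e + e + e + e + (216 * N%:R)^-1.
  rewrite /Gt; apply: ler_norm_add5 => //; apply: gb;
    rewrite /= ?expr0 ?expr1 ?mulr1 // mulrC //.
have hC : `|Ct| <= 16^-1 + 16^-1 + 19 / 216 + 7 / 216 + 1 / 216.
  rewrite /Ct; apply: ler_norm_add5 => //; apply: gb';
    rewrite /= ?expr0 ?expr1 ?mulr1 // mulrC //.
have small : `|n%:~R * Gt + Ct| < 1.
  apply: le_lt_trans (ler_normD _ _) _; rewrite normrM.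
  apply: (@le_lt_trans _ _ (N%:R * (e + e + e + e + (216 * N%:R)^-1) +
     (16^-1 + 16^-1 + 19 / 216 + 7 / 216 + 1 / 216))).
    by apply: lerD => //; apply: ler_pM => //; apply: hA.
  have -> : N%:R * (e + e + e + e + (216 * N%:R)^-1) = 4^-1 + 216^-1.
    by rewrite /e; field; rewrite gt_eqF.
  by clear; lra.
(* [P |w|^4] is below [b^4 <= |w|^4] in absolute value, so the integer [P] is zero. *)
apply: (@int_small_eq0 F P ((a ^+ 2 + b ^+ 2)%:~R ^+ 2)).
  by rewrite exprn_gt0 // ltr0z ltr_wpDl ?sqr_ge0 // exprn_gt0.
rewrite E normrM ger0_norm ?exprn_ge0 ?(ltW bR) //.
apply: (@lt_le_trans _ _ (b%:~R ^+ 4)).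
  by rewrite gtr_pMr // exprn_gt0.
rewrite (_ : 4 = 2 * 2)%N // exprM lerXn2r ?nnegrE ?exprn_ge0 ?(ltW bR) ?ler0z ?addr_ge0 ?sqr_ge0 //.
by rewrite -rmorphXn /= ler_int lerDr sqr_ge0.
Qed.

(* The analogue of [rows6] for linear forms: [G] in degrees 0 to 2 and [K] in degree 0. *)
Definition rows4 (F : realFieldType) (t : F) : seq (seq F) :=
 [:: [:: t ^+ 3 - t; t ^+ 2 - 1; - 2 * t ^+ 2; - 2 * t];
     [:: 3 * t ^+ 2 - 1; 2 * t; - 4 * t; - 2];
     [:: 3 * t; 1; - 2; 0];
     [:: 2 * t ^+ 2; 2 * t; t ^+ 3 - t; t ^+ 2 - 1]].

Lemma rows4_bound (F : realFieldType) (t : F) (i j : 'I_4) : `|t| <= 1 ->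
  `|nth 0 (nth [::] (rows4 t) i) j| <= 4.
Proof.
case/slope_pow_bounds; rewrite /rows4.
move: (t ^+ 4) (t ^+ 3) (t ^+ 2) => t4 t3 t2.
move=> /andP[? ?] /andP[? ?] /andP[? ?] /andP[? ?].
case: i => -[|[|[|[|i]]]] //= _;
  by case: j => -[|[|[|[|j]]]] //= _; rewrite ler_norml; apply/andP; split; lra.
Qed.

(** For [|w| >= be] linear forms suffice: [n G + K] now carries the factor [b^3], and
    [|w|^4 >= b^3 be], so all four scales gain a factor [be]. The coefficients have size [be Y], and
    [76 Y <= M] keeps the terms outside the pigeonhole small, from degree 1 of [K] on. *)
Lemma bilinear_relation (F : archiRealFieldType) (N M : nat) (k : int) (be Y : nat) :
  (0 < N)%N -> (0 < M)%N -> `|k| <= M%:Z -> (0 < be)%N -> (0 < Y)%N ->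
  (5 * 16 * 16) ^+ 4 * N%:R ^+ 3 <= be%:R ^+ 4 * M%:R ^+ 3 :> F ->
  M%:R ^+ 2 <= 192 * N%:R * Y%:R :> F -> 76 * Y%:R <= M%:R :> F -> N%:R <= M%:R ^+ 2 :> F ->
  M%:R <= N%:R :> F ->
  exists p1 q1 p2 q2 : int,
    [/\ ~~ [&& p1 == 0, q1 == 0, p2 == 0 & q2 == 0],
        [/\ `|p1| <= (be * Y)%N%:Z & `|q1| <= (be * Y)%N%:Z],
        [/\ `|p2| <= (be * Y)%N%:Z & `|q2| <= (be * Y)%N%:Z] &
    forall a b u v : int, 0 < b -> im_form a b u v = 1 -> `|re_form a b u v| <= N%:Z ->
      be%:Z ^+ 2 <= a ^+ 2 + b ^+ 2 ->
      k * b <= a * M%:Z -> a * M%:Z < (k + 1) * b ->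
      u * (p1 * a + q1 * b) + v * (p2 * a + q2 * b) = 0].
Proof.
move=> N0 M0 kM be0 Y0 hprod hM2 hYM hNM hMN.
pose t : F := k%:~R / (M%:Z)%:~R.
have MR : (0 : F) < (M%:Z)%:~R by rewrite ltr0z.
have NR : (0 : F) < N%:R by rewrite ltr0n.
have ht : `|t| <= 1.
  by rewrite normrM normfV (gtr0_norm MR) ler_pdivrMr // mul1r -intr_norm ler_int.
have [t1 t2 t3 t4] := slope_pow_bounds ht.
have N1 : (1 : F) <= N%:R by rewrite ler1n.
have M1 : (1 : F) <= M%:R by rewrite ler1n.
have B0 : (0 : F) < be%:R by rewrite ltr0n.
have Y1 : (1 : F) <= Y%:R by rewrite ler1n.
have M0' : (0 : F) < M%:R by [].
have N16 : (0 : F) < 16 * N%:R by rewrite mulr_gt0.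
pose sc : seq F := [:: be%:R / (16 * N%:R); be%:R * M%:R / (16 * N%:R);
  be%:R * M%:R ^+ 2 / (16 * N%:R); be%:R / 16].
pose lam (i j : 'I_4) := nth 0 (nth [::] (rows4 t) i) j.
have c16 : (0 : F) < 16 by rewrite ltr0n.
have X0 : (0 < be * Y)%N by rewrite muln_gt0 be0.
have BY : (be%:R : F) <= (be * Y)%:R by rewrite natrM ler_peMr // ltW.
have [||||v [[j0 vj0] vN vs]] :=
  @small_values_pigeonhole F 4 (be * Y) lam (fun i => sc`_i) 16 isT X0 c16.
- by case=> -[|[|[|[|i]]]] //= _; rewrite ?divr_gt0 ?mulr_gt0 ?exprn_gt0.
- move=> i; apply: (@le_trans _ _ (\sum_(j < 4) 4)).
    by apply: ler_sum => j _; exact: rows4_bound.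
  by rewrite sumr_const card_ord -mulr_natr; clear; lra.
- case=> -[|[|[|[|i]]]] //= _.
  + rewrite ler_pdivrMr //; apply: le_trans BY _; rewrite -[X in X <= _]mulr1 -mulrA mulrCA.
    by apply: ler_wpM2l; rewrite ?ler0n //; move: N1; clear; lra.
  + rewrite ler_pdivrMr //; apply: (@le_trans _ _ ((be * Y)%:R * N%:R)).
      by rewrite ler_pM // ltW.
    rewrite -mulrA mulrCA; apply: ler_wpM2l; rewrite ?ler0n //.
    by move: N1; clear; lra.
  + have -> : 16 * (be * Y)%:R = be%:R * (16 * Y%:R) :> F by rewrite natrM; ring.
    rewrite ler_pdivrMr // -mulrA; apply: ler_wpM2l; rewrite ?ler0n //.
    by move: hM2 Y1 N1; clear; move: (M%:R ^+ 2) => m; nra.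
  + by rewrite ler_pdivrMr //; apply: le_trans BY _; have := ler0n F (be * Y); clear; lra.
- rewrite !big_ord_recl big_ord0 /= /bump /=.
  have -> : be%:R / (16 * N%:R) * (be%:R * M%:R / (16 * N%:R) *
     (be%:R * M%:R ^+ 2 / (16 * N%:R) * (be%:R / 16 * 1))) =
     be%:R ^+ 4 * M%:R ^+ 3 / (16 ^+ 4 * N%:R ^+ 3) :> F by field; rewrite gt_eqF.
  by rewrite ler_pdivlMr ?mulr_gt0 ?exprn_gt0 // mulrA -exprMn.
pose i0 : 'I_4 := ord0; pose i1 : 'I_4 := lift ord0 ord0.
pose i2 : 'I_4 := lift ord0 (lift ord0 ord0).
pose i3 : 'I_4 := lift ord0 (lift ord0 (lift ord0 ord0)).
pose p1 := v i0; pose q1 := v i1; pose p2 := v i2; pose q2 := v i3.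
exists p1, q1, p2, q2; split; [| by split; apply: vN | by split; apply: vN |].
  apply/negP => /and4P[z1 z2 z3 z4]; case/negP: vj0.
  case: j0 => -[|[|[|[|i]]]] // hi.
  - by rewrite (_ : Ordinal hi = i0) //; apply: val_inj.
  - by rewrite (_ : Ordinal hi = i1) //; apply: val_inj.
  - by rewrite (_ : Ordinal hi = i2) //; apply: val_inj.
  - by rewrite (_ : Ordinal hi = i3) //; apply: val_inj.
move=> a b u w b0 him hre hbe hk1 hk2.
have Mz : 0 < M%:Z by [].
have [h0 hM aE] := slope_offset F b0 Mz hk1 hk2.
set h := a%:~R / b%:~R - _ in h0 hM aE; rewrite -/t in aE.
have bR : (0 : F) < b%:~R by rewrite ltr0z.
pose g (i : 'I_4) : F := \sum_j lam i j * (v j)%:~R.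
pose r1 : F := 4 * t * p1%:~R + 2 * q1%:~R + (3 * t ^+ 2 - 1) * p2%:~R + 2 * t * q2%:~R + 0.
pose r2 : F := 2 * p1%:~R + 3 * t * p2%:~R + 1 * q2%:~R.
pose Gt : F := g i0 * h ^+ 0 + g i1 * h ^+ 1 + g i2 * h ^+ 2 + p1%:~R * h ^+ 3 + 0.
pose Ct : F := g i3 * h ^+ 0 + r1 * h ^+ 1 + r2 * h ^+ 2 + p2%:~R * h ^+ 3 + 0.
set P := u * _ + w * _; set n := re_form a b u w in hre.
have E : P%:~R * ((a ^+ 2 + b ^+ 2)%:~R) ^+ 2 = b%:~R ^+ 3 * (n%:~R * Gt + Ct) :> F.
  have EZ : P * (a ^+ 2 + b ^+ 2) ^+ 2 =
     n * ((a ^+ 2 - b ^+ 2) * (p1 * a + q1 * b) - 2 * a * b * (p2 * a + q2 * b))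
     + im_form a b u w * (2 * a * b * (p1 * a + q1 * b) + (a ^+ 2 - b ^+ 2) * (p2 * a + q2 * b)).
    by rewrite /P /n /im_form /re_form; ring.
  rewrite him mul1r in EZ.
  move/(congr1 (fun x : int => x%:~R : F)): EZ.
  rewrite intrM rmorphXn /= => ->.
  rewrite /Gt /Ct /g !big_ord_recl !big_ord0 /lam /rows4 /= /r1 /r2.
  rewrite !(rmorphD, rmorphB, rmorphM, rmorphXn, rmorphN) /= aE /p1 /q1 /p2 /q2.
  by ring.
pose X : F := (be * Y)%:R; pose e : F := be%:R / (16 * N%:R).
have XM : 76 * X <= be%:R * M%:R by rewrite /X natrM mulrCA ler_wpM2l ?ler0n.
have X0' : 0 <= X by rewrite ler0n.
have nb (x : F) (A : int) (c : F) : `|x| <= c -> `|A| <= (be * Y)%N%:Z -> `|x * A%:~R| <= c * X.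
  by move=> h1 h2; rewrite normrM ler_pM // -intr_norm -[X]/(((be * Y)%N%:Z)%:~R) ler_int.
have hA (A : int) : `|A| <= (be * Y)%N%:Z -> `|A%:~R| <= X :> F.
  by move=> h1; rewrite -intr_norm -[X]/(((be * Y)%N%:Z)%:~R) ler_int.
have leM (i : nat) : be%:R * M%:R <= be%:R * M%:R ^+ i.+1 :> F.
  by rewrite ler_pM2l // exprS ler_peMr ?exprn_ege1 // ltW.
have gb (i : nat) (j : 'I_4) : sc`_j = e * M%:R ^+ i -> `|g j * h ^+ i| <= e.
  move=> hs; apply: (norm_mul_exp_le M0') => //; rewrite -hs; exact: ltW (vs j).
have tt1 : `|t| <= 1 by rewrite ler_norml.
have tt2 : `|t ^+ 2| <= 1 by rewrite normrX exprn_ile1.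
have hr1 : `|r1| <= 4 * X + 2 * X + 4 * X + 2 * X + 0.
  rewrite /r1; apply: ler_norm_add5; rewrite ?normr0 //;
    apply: nb; rewrite ?vN //; rewrite ler_norml; apply/andP; split; move: t1 t2; clear; lra.
have hr2 : `|r2| <= 2 * X + 3 * X + 1 * X.
  rewrite /r2; apply: ler_norm_add3;
    apply: nb; rewrite ?vN //; rewrite ler_norml; apply/andP; split; move: t1 t2; clear; lra.
have B3 : `|p1%:~R * h ^+ 3| <= be%:R / (76 * N%:R).
  apply: (norm_mul_exp_le M0') => //; apply: le_trans (hA _ (vN _)) _.
  rewrite mulrAC ler_pdivlMr ?mulr_gt0 // mulrA [X * 76]mulrC.
  apply: (@le_trans _ _ (be%:R * M%:R * M%:R ^+ 2)); last by rewrite -mulrA -exprS.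
  by apply: ler_pM => //; rewrite ?mulr_ge0 // ltW.
have C1 : `|r1 * h ^+ 1| <= be%:R * (12 / 76).
  apply: (norm_mul_exp_le M0') => //; apply: le_trans hr1 _; rewrite expr1.
  by rewrite mulrAC; move: XM; clear; lra.
have C2 : `|r2 * h ^+ 2| <= be%:R * (6 / 76).
  apply: (norm_mul_exp_le M0') => //; apply: le_trans hr2 _.
  by rewrite mulrAC; have := leM 1%N; move: XM; clear; lra.
have C3 : `|p2%:~R * h ^+ 3| <= be%:R * (1 / 76).
  apply: (norm_mul_exp_le M0') => //; apply: le_trans (hA _ (vN _)) _.
  by rewrite mulrAC; have := leM 2%N; move: XM; clear; lra.
have C0 : `|g i3 * h ^+ 0| <= be%:R / 16.
  by rewrite expr0 mulr1; exact: ltW (vs i3).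
have hG : `|Gt| <= e + e + e + be%:R / (76 * N%:R) + 0.
  rewrite /Gt; apply: ler_norm_add5; rewrite ?normr0 //; apply: gb;
    rewrite /= ?expr0 ?expr1 ?mulr1 // /e mulrAC //.
have hC : `|Ct| <= be%:R / 16 + be%:R * (12 / 76) + be%:R * (6 / 76) + be%:R * (1 / 76) + 0.
  by rewrite /Ct; apply: ler_norm_add5; rewrite ?normr0.
have small : `|n%:~R * Gt + Ct| < be%:R.
  apply: le_lt_trans (ler_normD _ _) _; rewrite normrM.
  have hn : `|n%:~R| <= N%:R :> F by rewrite -intr_norm -[N%:R]/((N%:Z)%:~R) ler_int.
  apply: (@le_lt_trans _ _ (N%:R * (e + e + e + be%:R / (76 * N%:R) + 0) +
     (be%:R / 16 + be%:R * (12 / 76) + be%:R * (6 / 76) + be%:R * (1 / 76) + 0))).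
    by apply: lerD => //; apply: ler_pM.
  have -> : N%:R * (e + e + e + be%:R / (76 * N%:R) + 0) = be%:R * (3 / 16 + 1 / 76).
    by rewrite /e; field; rewrite gt_eqF.
  by move: B0; clear; lra.
apply: (@int_small_eq0 F P ((a ^+ 2 + b ^+ 2)%:~R ^+ 2)).
  by rewrite exprn_gt0 // ltr0z ltr_wpDl ?sqr_ge0 // exprn_gt0.
rewrite E normrM ger0_norm ?exprn_ge0 ?(ltW bR) //.
apply: (@lt_le_trans _ _ (b%:~R ^+ 3 * be%:R)).
  by rewrite ltr_pM2l // exprn_gt0.
have d0 : (0 : F) <= (a ^+ 2 + b ^+ 2)%:~R by rewrite ler0z addr_ge0 ?sqr_ge0.
have bd : b%:~R ^+ 2 <= (a ^+ 2 + b ^+ 2)%:~R :> F by rewrite -rmorphXn /= ler_int lerDr sqr_ge0.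
have bed : be%:R ^+ 2 <= (a ^+ 2 + b ^+ 2)%:~R :> F.
  by rewrite -[be%:R]/((be%:Z)%:~R) -rmorphXn /= ler_int.
have bb : b%:~R * be%:R <= (a ^+ 2 + b ^+ 2)%:~R :> F.
  rewrite -(@ler_pXn2r _ 2) ?nnegrE ?mulr_ge0 ?(ltW bR) ?(ltW B0) // exprMn [X in _ <= X]expr2.
  by rewrite ler_pM // ?exprn_ge0 // ltW.
by rewrite exprSr -mulrA expr2; apply: ler_pM; rewrite ?exprn_ge0 ?mulr_ge0 ?(ltW bR) ?(ltW B0).
Qed.

(** * Counting pairs with a large square divisor *)

Definition int_range (m : nat) : seq int := [seq k%:Z - m%:Z | k <- iota 0 (2 * m).+1].

Lemma mem_int_range m (k : int) : (k \in int_range m) = (`|k| <= m%:Z).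
Proof.
apply/mapP/idP => [[j]|h]; first by rewrite mem_iota => h ->; lia.
by exists (absz (k + m%:Z)); [rewrite mem_iota|]; lia.
Qed.

Lemma size_int_range m : size (int_range m) = (2 * m).+1.
Proof. by rewrite size_map size_iota. Qed.

Lemma card_le1 (T : finType) (S : {set T}) :
  (forall x y, x \in S -> y \in S -> x = y) -> (#|S| <= 1)%N.
Proof. by move=> h; apply/card_le1_eqP => x y xS yS; apply: h. Qed.

(** * Points near lines of small height *)

Lemma orient_direction (e1 e2 x y : int) (C : int) : coprimez e1 e2 -> e1 != 0 ->
  `|e2| <= `|e1| -> `|x * e2 - y * e1| <= C ->
  exists e : int, [/\ coprimez (absz e1) e, `|e| <= (absz e1)%:Z
                    & `|x * e - y * (absz e1)%:Z| <= C].
Proof.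
move=> cop e10 h21 hc; have [s1|s1] : 0 <= e1 \/ e1 < 0 by case: (ltrP e1 0); [right|left].
  by rewrite (gez0_abs s1); exists e2; rewrite -{2}(ger0_norm s1).
rewrite (ltz0_abs s1); exists (- e2); rewrite normrN -{2}(ltr0_norm s1); split => //.
  by rewrite coprimezN coprimeNz.
by rewrite (_ : x * - e2 - y * - e1 = - (x * e2 - y * e1)) ?normrN //; ring.
Qed.

(** [(m, e)] is the direction and [c = a e - b m] the offset. Points with the same [e] and [c] have
    [a] in one class modulo [m], so the quotient of [a] by [m] separates them; this gives on the
    order of [m C (be / m + 1)] points. *)
Lemma one_direction_count (T : finType) (a b : T -> int)
    (inj_ab : forall x y, a x = a y -> b x = b y -> x = y) (S : {set T}) (m C be : nat) :
  (0 < m)%N -> (0 < C)%N ->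
  (forall x, x \in S -> `|a x| <= be%:Z /\ exists e : int,
     [/\ coprimez m e, `|e| <= m%:Z & `|a x * e - b x * m%:Z| <= C%:Z]) ->
  (#|S| <= 27 * C * (be + m))%N.
Proof.
move=> m0 C0 hS.
have /choice[f hf] : forall x, exists e : int, x \in S ->
    [/\ coprimez m e, `|e| <= m%:Z & `|a x * e - b x * m%:Z| <= C%:Z].
  move=> x; case: (boolP (x \in S)) => [/hS[_ [e he]]|_]; first by exists e.
  by exists 0.
pose F x := (f x, a x * f x - b x * m%:Z, (a x %/ m%:Z)%Z).
pose cs := [seq (p, q) | p <- [seq (e, c) | e <- int_range m, c <- int_range C],
                         q <- int_range (be %/ m).+1].
have mz : 0 < m%:Z by [].
have m0' : (m%:Z != 0) by lia.
apply: (@leq_trans (1 * size cs)).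
  apply: (@card_fibers _ _ F) => [x xS|[[e c] q] _].
    have [ax _] := hS x xS; have [h1 h2 h3] := hf x xS.
    apply: allpairs_f; first by apply: allpairs_f; rewrite mem_int_range.
    rewrite mem_int_range.
    have hb : (be < (be %/ m).+1 * m)%N by rewrite ltn_ceil.
    have := divz_eq (a x) m; have := modz_ge0 (a x) m0'; have := ltz_pmod (a x) mz.
    move: (a x %/ m)%Z (a x %% m)%Z (be %/ m).+1 hb ax m0; clear; nia.
  apply: card_le1 => x y; rewrite !inE => /andP[xS /eqP[ex cx qx]] /andP[yS /eqP[ey cy qy]].
  have [h1 h2 h3] := hf x xS; rewrite ex in h1 cx; rewrite ey in cy.
  have E : (a x - a y) * e = (b x - b y) * m%:Z.
    have : a x * e - b x * m%:Z = a y * e - b y * m%:Z by rewrite cx cy.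
    by move=> h; apply/eqP; rewrite -subr_eq0; move/eqP: h; rewrite -subr_eq0 => /eqP h;
      apply/eqP; rewrite -[RHS]h; ring.
  have /dvdzP[k hk] : (m%:Z %| a x - a y)%Z.
    by rewrite -(Gauss_dvdzl _ h1) E dvdz_mull.
  have axy : a x = a y.
    have := divz_eq (a x) m; have := modz_ge0 (a x) m0'; have := ltz_pmod (a x) mz.
    have := divz_eq (a y) m; have := modz_ge0 (a y) m0'; have := ltz_pmod (a y) mz.
    rewrite qx qy; move: (a x %% m)%Z (a y %% m)%Z hk => r s hk s1 s2 s3 r1 r2 r3.
    have hrs : r - s = k * m%:Z by rewrite -hk r3 s3; ring.
    suff k0 : k = 0 by move: hk; rewrite k0 mul0r => /subr0_eq.
    by move: hrs s1 s2 r1 r2; clear; nia.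
  apply: inj_ab => //; apply: (mulIf m0').
  by move: E; rewrite axy subrr mul0r mulrBl => /esym/subr0_eq.
rewrite mul1n !size_allpairs !size_int_range.
have hd : (be %/ m * m <= be)%N by apply: leq_trunc_div.
move: (be %/ m)%N hd => q hd.
apply: (@leq_trans (3 * m * (3 * C) * (2 * q.+1).+1)).
  by rewrite leq_mul2r leq_mul ?orbT //; lia.
have -> : (3 * m * (3 * C) * (2 * q.+1).+1 = 9 * C * (2 * (q * m) + 3 * m))%N by ring.
apply: (@leq_trans (9 * C * (3 * (be + m)))); last by rewrite leq_eqVlt; apply/orP; left; apply/eqP; ring.
by rewrite leq_mul2l; apply/orP; right; lia.
Qed.

(** The larger coordinate [m <= Em] of the direction costs a factor [Em], and which coordinate is
    larger a factor 2. Grouping the directions by [m] avoids a factor [Em^2]. *)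
Lemma near_line_count (T : finType) (a b : T -> int)
    (inj_ab : forall x y, a x = a y -> b x = b y -> x = y) (S : {set T}) (E C be Em : nat) :
  (0 < C)%N -> (E <= Em ^ 2)%N ->
  (forall x, x \in S -> `|a x| <= be%:Z) -> (forall x, x \in S -> `|b x| <= be%:Z) ->
  (forall x, x \in S -> near_line E%:Z C%:Z (a x) (b x)) ->
  (#|S| <= 54 * C * Em * (be + Em))%N.
Proof.
move=> C0 hE ha hb hS.
have hE' e1 e2 : e1 ^+ 2 + e2 ^+ 2 <= E%:Z -> `|e1| <= Em%:Z /\ `|e2| <= Em%:Z.
  move=> h; have hEm : E%:Z <= Em%:Z ^+ 2 by rewrite expr2 -PoszM mulnn lez_nat.
  split; rewrite -(@ler_pXn2r _ 2) ?nnegrE // real_normK ?num_real //;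
    apply: le_trans hEm; apply: le_trans h; first by rewrite lerDl sqr_ge0.
  by rewrite lerDr sqr_ge0.
pose wit (p q : T -> int) x (m : nat) := (0 < m <= Em)%N /\ exists e : int,
     [/\ coprimez m e, `|e| <= m%:Z & `|p x * e - q x * m%:Z| <= C%:Z].
have hw x : x \in S -> exists m, wit a b x m \/ wit b a x m.
  move=> xS; have [e1 [e2 [cop hE2 _ hc]]] := hS x xS; have [h1 h2] := hE' _ _ hE2.
  have [n0|] := boolP ((e1 == 0) && (e2 == 0)).
    by move: n0 cop => /andP[/eqP-> /eqP->]; rewrite /coprimez gcdz0.
  move=> nz; case: (lerP `|e2| `|e1|) => h21.
    have e10 : e1 != 0 by move: nz h21; clear; lia.
    exists (absz e1); left; split; last exact: orient_direction cop e10 h21 hc.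
    by move: e10 h1; clear; lia.
  have e20 : e2 != 0 by move: h21; clear; lia.
  have cop' : coprimez e2 e1 by rewrite coprimez_sym.
  have hc' : `|b x * e1 - a x * e2| <= C by rewrite distrC.
  exists (absz e2); right; split; last exact: orient_direction cop' e20 (ltW h21) hc'.
  by move: e20 h2; clear; lia.
have /choice[g hg] : forall x, exists m : nat, x \in S -> wit a b x m \/ wit b a x m.
  by move=> x; case: (boolP (x \in S)) => [/hw[m hm]|_]; [exists m | exists 0%N].
apply: (@leq_trans (54 * C * (be + Em) * size (iota 1 Em))); last first.
  by rewrite size_iota leq_eqVlt; apply/orP; left; apply/eqP; ring.
apply: (@card_fibers _ _ g) => [x xS|m].
  by rewrite mem_iota add1n ltnS; case: (hg x xS) => -[].
rewrite mem_iota add1n ltnS => /andP[m0 mE]; set S' := [set x in S | _].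
pose S1 := [set x in S' | `[< wit a b x m >]].
have inj_ba x y : b x = b y -> a x = a y -> x = y by move=> h1 h2; apply: inj_ab.
have c1 : (#|S' :&: S1| <= 27 * C * (be + m))%N.
  apply: (@one_direction_count T a b inj_ab) => // x; rewrite !inE => /andP[/andP[xS _]].
  by case/andP=> _ /asboolP[_ hx]; split; [apply: ha | apply: hx].
have c2 : (#|S' :\: S1| <= 27 * C * (be + m))%N.
  apply: (@one_direction_count T b a inj_ba) => // x; rewrite !inE => /andP[hx /andP[xS /eqP gx]].
  split; first exact: hb.
  case: (hg x xS); rewrite gx => hx'; last by case: hx'.
  by move: hx; rewrite xS gx eqxx /= => /asboolP.
rewrite -(cardsID S1 S') (leq_trans (leq_add c1 c2)) //.
rewrite addnn -mul2n !mulnA; apply: leq_mul => //; lia.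
Qed.

Lemma PoszX (m k : nat) : (m ^ k)%N%:Z = m%:Z ^+ k.
Proof. by elim: k => // k IH; rewrite expnS exprS PoszM IH. Qed.

Definition square_pair (N M : nat) (x : 'I_N.+1 * 'I_N.+1) : bool :=
  [&& (0 < x.1)%N, (M <= x.2)%N & (x.2 ^ 2 %| x.1 ^ 2 + 1)%N].

(** [H = 8 N^6] because coefficients are bounded by [X = N^2] and [relation_count] asks for
    [8 X^3 <= H]. *)
Definition interval_bound (N tb : nat) : nat :=
  let H := (8 * N ^ 6)%N in
  2 + (2 * ncol H 2 + ncol H 3 * (2 * tb) + 2 * ncol H 4 * tb * (2 * tb)).

Section SquarePairs.
Variables (F : archiRealFieldType) (N M be Y Em Rm tb : nat).
Hypotheses (N_gt0 : (0 < N)%N) (M_gt0 : (0 < M)%N) (be_gt0 : (0 < be)%N) (Y_gt0 : (0 < Y)%N).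
Hypothesis h1 : (5 * 42 * 16) ^+ 6 * N%:R ^+ 4 <= M%:R ^+ 7 :> F.
Hypothesis h2 : (216 * N <= M ^ 2)%N.
Hypothesis h3 : (M ^ 3 <= N ^ 2)%N.
Hypothesis h4 : (5 * 16 * 16) ^+ 4 * N%:R ^+ 3 <= be%:R ^+ 4 * M%:R ^+ 3 :> F.
Hypothesis h5 : (M ^ 2 <= 192 * N * Y)%N.
Hypothesis h6 : (76 * Y <= M)%N.
Hypothesis h7 : (M <= N)%N.
Hypothesis h8 : (M <= be ^ 2)%N.
Hypothesis h9 : (be * Y <= N ^ 2)%N.
Hypothesis hEm : (9 * (be ^ 2 %/ M) * (N %/ M) <= Em ^ 2)%N.
Hypothesis hRm : (2 * N < Rm.+1 ^ 3)%N.
Hypothesis htb : forall m, (0 < m)%N -> (m <= 8 * N ^ 12)%N -> (size (divisors m) <= tb)%N.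

Let T : finType := {x : 'I_N.+1 * 'I_N.+1 | square_pair M x}.
Let n (x : T) : nat := (val x).1.
Let d (x : T) : nat := (val x).2.

Let n_gt0 x : (0 < n x)%N. Proof. by have /and3P[] := valP x. Qed.
Let d_ge x : (M <= d x)%N. Proof. by have /and3P[] := valP x. Qed.
Let n_le x : (n x <= N)%N. Proof. by rewrite -ltnS ltn_ord. Qed.
Let d_le x : (d x <= N)%N. Proof. by rewrite -ltnS ltn_ord. Qed.
Let d_gt0 x : (0 < d x)%N. Proof. exact: leq_trans M_gt0 (d_ge x). Qed.
Let d_dvd x : (d x ^ 2 %| n x ^ 2 + 1)%N. Proof. by have /and3P[] := valP x. Qed.
Let eq_nd x y : n x = n y -> d x = d y -> x = y.
Proof.
rewrite /n /d => e1 e2; apply: val_inj; move: e1 e2.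
by case: (val x) (val y) => [p q] [p' q'] /= e1 e2; congr pair; apply: val_inj.
Qed.

Lemma square_pair_param : exists f : T -> int * int * int * int, forall x,
  let: (a, b, u, v) := f x in
  [/\ (d x)%:Z = a ^+ 2 + b ^+ 2, im_form a b u v = 1, re_form a b u v = (n x)%:Z,
      `|a| <= b & 0 < b].
Proof.
suff /choice[f hf] : forall x : T, exists w : int * int * int * int,
    let: (a, b, u, v) := w in
    [/\ (d x)%:Z = a ^+ 2 + b ^+ 2, im_form a b u v = 1, re_form a b u v = (n x)%:Z,
      `|a| <= b & 0 < b] by exists f.
move=> x.
have [||a [b [u [v h]]]] := @square_divisor_param (n x) (d x).
- by have := d_gt0 x.
- have -> : ((n x)%:Z ^+ 2 + 1 : int) = (n x ^ 2 + 1)%N%:Z by rewrite PoszD -mulnn PoszM expr2.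
  by rewrite dvdzE abszX /= d_dvd.
by exists (a, b, u, v).
Qed.

Section Param.
Variables a b u v : T -> int.
Hypothesis dE : forall x, (d x)%:Z = a x ^+ 2 + b x ^+ 2.
Hypothesis im1 : forall x, im_form (a x) (b x) (u x) (v x) = 1.
Hypothesis reE : forall x, re_form (a x) (b x) (u x) (v x) = (n x)%:Z.
Hypothesis ab : forall x, `|a x| <= b x.
Hypothesis b_gt0 : forall x, 0 < b x.

Let C := (be ^ 2 %/ M)%N.
Let V := (N %/ M)%N.
Let H := (8 * N ^ 6)%N.

Let V_gt0 : (0 < V)%N. Proof. by rewrite divn_gt0. Qed.
Let C_gt0 : (0 < C)%N. Proof. by rewrite divn_gt0. Qed.

Lemma b_sqr_le x : b x ^+ 2 <= (d x)%:Z.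
Proof. by rewrite dE lerDr sqr_ge0. Qed.

Lemma b_le x : b x <= N%:Z.
Proof.
apply: (@le_trans _ _ (b x ^+ 2)); last by apply: le_trans (b_sqr_le x) _; rewrite lez_nat.
by rewrite expr2 ler_peMl ?(ltW (b_gt0 x)) // -gtz0_ge1.
Qed.

(** From [|w|^4 |z|^2 = n^2 + 1 < (n + 1)^2] one gets [|t| d < n + 1], hence [|t| d <= n <= N] for
    integers. *)
Lemma uv_bound x (t : int) : t ^+ 2 <= u x ^+ 2 + v x ^+ 2 -> `|t| * M%:Z <= N%:Z.
Proof.
move=> ht; have key : (d x)%:Z ^+ 2 * (u x ^+ 2 + v x ^+ 2) = (n x)%:Z ^+ 2 + 1.
  transitivity (re_form (a x) (b x) (u x) (v x) ^+ 2 + im_form (a x) (b x) (u x) (v x) ^+ 2).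
    by rewrite dE /re_form /im_form; ring.
  by rewrite reE im1 expr1n.
have d0 : 0 < (d x)%:Z by have := d_gt0 x.
have lt1 : (`|t| * (d x)%:Z) ^+ 2 < ((n x)%:Z + 1) ^+ 2.
  rewrite exprMn real_normK ?num_real // mulrC.
  apply: (@le_lt_trans _ _ ((n x)%:Z ^+ 2 + 1)); first by rewrite -key ler_wpM2l // sqr_ge0.
  by have := n_gt0 x; rewrite sqrrD expr1n; clear; lia.
rewrite ltr_pXn2r ?nnegrE ?mulr_ge0 ?(ltW d0) ?addr_ge0 // in lt1.
have le1 : `|t| * M%:Z <= `|t| * (d x)%:Z by rewrite ler_wpM2l // lez_nat d_ge.
by have := n_le x; move: lt1 le1; clear; lia.
Qed.

Lemma uM x : `|u x| * M%:Z <= N%:Z.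
Proof. by apply: (@uv_bound x); rewrite lerDl sqr_ge0. Qed.

Lemma vM x : `|v x| * M%:Z <= N%:Z.
Proof. by apply: (@uv_bound x); rewrite lerDr sqr_ge0. Qed.

Lemma quot_le (t : int) : `|t| * M%:Z <= N%:Z -> `|t| <= V%:Z.
Proof.
move=> h; rewrite -abszE lez_nat /V leq_divRL // -lez_nat PoszM abszE //.
Qed.

Lemma V_le : (V <= N)%N. Proof. exact: leq_div. Qed.

(** Besides [d], the pair [(a, b)] determines [n] modulo [d^2], and [d^2 >= M^2 > N] then determines
    [n]. *)
Lemma inj_ab x y : a x = a y -> b x = b y -> x = y.
Proof.
move=> ea eb; have ed : d x = d y by apply/eqP; rewrite -eqz_nat !dE ea eb.
apply: eq_nd => //.
have ix := im1 x; have iy := im1 y; have rx := reE x; have ry := reE y.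
rewrite ea eb in ix rx.
have dv : (((d y) ^ 2)%N%:Z %| (n x)%:Z - (n y)%:Z)%Z.
  apply/dvdzP; exists ((u x - u y) * v y - (v x - v y) * u y).
  rewrite -mulnn PoszM dE -rx -ry.
  transitivity ((re_form (a y) (b y) (u x) (v x) - re_form (a y) (b y) (u y) (v y))
    * im_form (a y) (b y) (u y) (v y)); first by rewrite iy mulr1.
  transitivity (((u x - u y) * v y - (v x - v y) * u y) * ((a y ^+ 2 + b y ^+ 2) * (a y ^+ 2 + b y ^+ 2))
    + (im_form (a y) (b y) (u x) (v x) - im_form (a y) (b y) (u y) (v y)) * re_form (a y) (b y) (u y) (v y)).
    by rewrite /re_form /im_form; ring.
  by rewrite ix iy subrr mul0r addr0.
have hM : (M ^ 2 <= d y ^ 2)%N by rewrite leq_exp2r.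
have := n_le x; have := n_le y; have := n_gt0 x; have := n_gt0 y.
move: dv => /dvdzP[k hk]; move: hk h2 N_gt0 hM; clear.
move: (d y ^ 2)%N (M ^ 2)%N => D M2 hk hM2 N0 hM n1 n2 n3 n4.
have hD : (N < D)%N by lia.
have k0 : k = 0 by nia.
by move: hk; rewrite k0; lia.
Qed.

Definition interval_index (x : T) : int := (a x * M%:Z %/ b x)%Z.

Lemma interval_indexP x : interval_index x * b x <= a x * M%:Z < (interval_index x + 1) * b x.
Proof.
have b0 := b_gt0 x; have bn0 : b x != 0 by rewrite gt_eqF.
have := divz_eq (a x * M%:Z) (b x); have := modz_ge0 (a x * M%:Z) bn0.
have := ltz_pmod (a x * M%:Z) b0; rewrite /interval_index.
move: (_ %/ _)%Z (_ %% _)%Z => q r r1 r0 E; rewrite E mulrDl mul1r lerDl r0 ltrD2l //.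
Qed.

Lemma interval_index_range x : interval_index x \in int_range M.
Proof.
rewrite mem_int_range; have /andP[i1 i2] := interval_indexP x.
have b0 := b_gt0 x; have M0' : 0 < M%:Z by [].
have := ab x; rewrite ler_norml => /andP[a1 a2].
have l1 : interval_index x * b x <= M%:Z * b x.
  by apply: le_trans i1 _; rewrite mulrC ler_pM2l.
rewrite ler_pM2r // in l1.
have l2 : - M%:Z * b x < (interval_index x + 1) * b x.
  by apply: le_lt_trans i2; rewrite mulNr -mulrN mulrC ler_pM2r.
rewrite ltr_pM2r // in l2.
by move: l1 l2; clear; lia.
Qed.

(** Two slopes in one interval differ by at most [1 / M], and the determinant is this difference
    times the product of the two [b], each at most [be]. *)
Lemma dt_bound x y : interval_index x = interval_index y ->
  (d x < be ^ 2)%N -> (d y < be ^ 2)%N -> `|dt a b x y| <= C%:Z.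
Proof.
move=> e hx hy.
have bb z : (d z < be ^ 2)%N -> b z <= be%:Z.
  move=> hz; rewrite -(@ler_pXn2r _ 2) ?nnegrE ?(ltW (b_gt0 z)) //.
  by apply: le_trans (b_sqr_le z) _; rewrite expr2 -PoszM mulnn lez_nat ltnW.
have /andP[x1 x2] := interval_indexP x; have /andP[y1 y2] := interval_indexP y.
rewrite -e in y1 y2; move: (interval_index x) x1 x2 y1 y2 => k x1 x2 y1 y2.
have bx := bb x hx; have by_ := bb y hy; have bx0 := b_gt0 x; have by0 := b_gt0 y.
pose rx := a x * M%:Z - k * b x; pose ry := a y * M%:Z - k * b y.
have rx0 : 0 <= rx by rewrite subr_ge0.
have ry0 : 0 <= ry by rewrite subr_ge0.
have rxb : rx <= be%:Z.
  by apply: le_trans bx; rewrite lerBlDl; move: x2; rewrite mulrDl mul1r => /ltW.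
have ryb : ry <= be%:Z.
  by apply: le_trans by_; rewrite lerBlDl; move: y2; rewrite mulrDl mul1r => /ltW.
have key : dt a b x y * M%:Z = rx * b y - b x * ry by rewrite /dt /rx /ry; ring.
have hb : `|dt a b x y| * M%:Z <= (be ^ 2)%N%:Z.
  have -> : `|dt a b x y| * M%:Z = `|dt a b x y * M%:Z| by rewrite normrM.
  rewrite key -mulnn PoszM ler_norml; apply/andP; split.
    rewrite lerBrDr addrC lerBlDr.
    apply: (@le_trans _ _ (be%:Z * be%:Z)); last first.
      by rewrite lerDr // mulr_ge0 // ltW.
    by apply: ler_pM => //; rewrite ltW.
  rewrite lerBlDr; apply: (@le_trans _ _ (be%:Z * be%:Z)); last first.
    by rewrite lerDl mulr_ge0 // ltW.
  by apply: ler_pM => //; rewrite ltW.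
by rewrite -abszE lez_nat /C leq_divRL // -lez_nat PoszM abszE.
Qed.

Let bad3 := [set x : T | `[< cubic_value (n x)%:Z >]].
Let small := [set x : T | (d x < be ^ 2)%N].
Let bad4 := [set x in small | `[< near_line (9 * C * V)%N%:Z C%:Z (a x) (b x) >]].

(** The exceptional [n] come from [r >= 0] with [r^3 <= 2 N], so there are at most [Rm + 1] of them,
    and each is paired only with divisors [d] of [n^2 + 1]. *)
Lemma bad3_card : (#|bad3| <= tb * Rm.+1)%N.
Proof.
rewrite -[X in (_ * X)%N](size_iota 0).
pose g (x : T) := find (fun r : nat => 2 * (n x)%:Z == r%:Z ^+ 3 + 3 * r%:Z :> int) (iota 0 Rm.+1).
have hg x : x \in bad3 -> (g x < Rm.+1)%N /\ 2 * (n x)%:Z = (g x)%:Z ^+ 3 + 3 * (g x)%:Z.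
  rewrite inE => /asboolP[r hr].
  have r0 : 0 <= r.
    rewrite leNgt; apply/negP => r0; have := n_gt0 x.
    have : r ^+ 3 + 3 * r < 0.
      have -> : r ^+ 3 + 3 * r = - ((- r) * (r ^+ 2 + 3)) by ring.
      by rewrite oppr_lt0 mulr_gt0 ?oppr_gt0 // ltr_wpDl // sqr_ge0.
    by rewrite -hr; clear; lia.
  have rE : r = (absz r)%:Z by rewrite gez0_abs.
  have rR : (absz r < Rm.+1)%N.
    rewrite -(@ltn_exp2r _ _ 3) //; apply: leq_ltn_trans hRm.
    rewrite -lez_nat PoszX -rE.
    apply: (@le_trans _ _ (2 * (n x)%:Z)); first by rewrite hr lerDl mulr_ge0.
    by have := n_le x; clear; lia.
  have hh : has (fun r : nat => 2 * (n x)%:Z == r%:Z ^+ 3 + 3 * r%:Z :> int) (iota 0 Rm.+1).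
    by apply/hasP; exists (absz r); rewrite ?mem_iota // -rE hr.
  have gl : (g x < Rm.+1)%N by move: hh; rewrite has_find size_iota.
  split => //; have := nth_find 0%N hh; rewrite -/(g x) nth_iota // add0n => /eqP //.
apply: (@card_fibers _ _ g) => [x /hg[h _]|r _]; first by rewrite mem_iota.
set S := [set x in bad3 | _]; case: (set_0Vmem S) => [->|[x0 x0S]]; first by rewrite cards0.
have inS x : x \in S -> x \in bad3 /\ g x = r by rewrite /S in_set => /andP[-> /eqP].
have eqn x : x \in S -> n x = n x0.
  move=> /inS[/hg[_ hx] gx]; have [/hg[_ h0] g0] := inS _ x0S.
  by move: h0 hx; rewrite g0 gx => <-; clear; lia.
apply: leq_trans (htb (_ : 0 < n x0 ^ 2 + 1)%N _); last 2 first.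
- by rewrite addn1.
- have := n_le x0 => hn; apply: (@leq_trans (N ^ 2 + N ^ 2)).
    by rewrite leq_add ?leq_exp2r // expn_gt0 N_gt0.
  rewrite addnn -mul2n leq_mul // leq_pexp2l //.
rewrite -[size _]mul1n.
apply: (@card_fibers _ _ d) => [x xS|c _].
  rewrite -dvdn_divisors ?addn1 // -addn1 -(eqn x xS).
  by apply: dvdn_trans (d_dvd x); rewrite expnS dvdn_mulr.
have inS2 x : x \in [set x in S | d x == c] -> x \in S /\ d x = c.
  by rewrite in_set => /andP[-> /eqP].
apply: card_le1 => x y /inS2[xS dx] /inS2[yS dy].
by apply: eq_nd; [rewrite (eqn x) ?(eqn y) | rewrite dx dy].
Qed.

Lemma bad4_card : (#|bad4| <= 54 * C * Em * (be + Em))%N.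
Proof.
apply: (@near_line_count _ a b inj_ab _ (9 * C * V)) => //.
- move=> x; rewrite !inE => /andP[hx _]; apply: le_trans (ab x) _.
  rewrite -(@ler_pXn2r _ 2) ?nnegrE ?(ltW (b_gt0 x)) //.
  by apply: le_trans (b_sqr_le x) _; rewrite expr2 -PoszM mulnn lez_nat ltnW.
- move=> x; rewrite !inE => /andP[hx _]; rewrite gtr0_norm //.
  rewrite -(@ler_pXn2r _ 2) ?nnegrE ?(ltW (b_gt0 x)) //.
  by apply: le_trans (b_sqr_le x) _; rewrite expr2 -PoszM mulnn lez_nat ltnW.
- by move=> x; rewrite !inE => /andP[_ /asboolP].
Qed.

Let N6 : (N <= H)%N.
Proof.
rewrite /H -[X in (X <= _)%N]mul1n leq_mul // -[X in (X <= _)%N]expn1; exact: leq_pexp2l.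
Qed.
Let aH x : `|a x| <= H%:Z.
Proof. by apply: le_trans (ab x) _; apply: le_trans (b_le x) _; rewrite lez_nat. Qed.
Let bH x : `|b x| <= H%:Z.
Proof. by rewrite gtr0_norm //; apply: le_trans (b_le x) _; rewrite lez_nat. Qed.
Let H_gt0 : (0 < H)%N. Proof. by rewrite muln_gt0 expn_gt0 N_gt0. Qed.
Let uN x : `|u x| <= N%:Z.
Proof. by apply: le_trans (quot_le (uM x)) _; rewrite lez_nat V_le. Qed.
Let vN x : `|v x| <= N%:Z.
Proof. by apply: le_trans (quot_le (vM x)) _; rewrite lez_nat V_le. Qed.
Let uH x : `|u x| *+ 2 <= H%:Z.
Proof.
have h : (2 * N <= H)%N by rewrite /H leq_mul // -[X in (X <= _)%N]expn1 leq_pexp2l.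
by have := uN x; move: h; clear; lia.
Qed.
Let vH x : `|v x| <= H%:Z. Proof. by apply: le_trans (vN x) _; rewrite lez_nat. Qed.
Let X : int := (N ^ 2)%N%:Z.
Let X_gt0 : 0 < X. Proof. by rewrite ltz_nat expn_gt0 N_gt0. Qed.
Let XH : 8 * X ^+ 3 <= H%:Z.
Proof. by rewrite /H /X PoszM !PoszX -exprM. Qed.
Let tbX (m : int) : m != 0 -> `|m| <= 8 * X ^+ 6 -> (num_div m <= tb)%N.
Proof.
move=> m0 hm; apply: htb; first by rewrite absz_gt0.
by rewrite -lez_nat abszE PoszM PoszX; move: hm; rewrite /X PoszX -exprM.
Qed.
Let NX : N%:Z <= X. Proof. by rewrite lez_nat -[X in (X <= _)%N]expn1 leq_pexp2l. Qed.
Let reN x : `|re_form (a x) (b x) (u x) (v x)| <= N%:Z.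
Proof. by rewrite reE ger0_norm // lez_nat. Qed.

Let not_bad3 x : x \notin bad3 -> ~ cubic_value (re_form (a x) (b x) (u x) (v x)).
Proof. by rewrite inE reE => /asboolP. Qed.

Lemma small_interval_card (k : int) :
  (#|[set x in small :\: (bad3 :|: bad4) | interval_index x == k]| <= interval_bound N tb)%N.
Proof.
set S := [set x in _ | _].
case: (set_0Vmem S) => [->|[x0 x0S]]; first by rewrite cards0.
have kM : `|k| <= M%:Z.
  by move: x0S; rewrite inE => /andP[_ /eqP <-]; rewrite -mem_int_range interval_index_range.
have h2' : 216 * N%:R <= M%:R ^+ 2 :> F by rewrite -natrM -natrX ler_nat.
have h3' : M%:R ^+ 3 <= N%:R ^+ 2 :> F by rewrite -!natrX ler_nat.
have [A1 [B1 [C1 [A2 [B2 [C2 [nz [a1 b1 c1] [a2 b2 c2] hrel]]]]]]] :=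
  @quadratic_relation F N M k N_gt0 M_gt0 kM h1 h2' h3'.
have le3 (m : int) : `|m| <= N%:Z -> `|m| <= X by move=> h; apply: le_trans h NX.
have inS x : x \in S -> [/\ (d x < be ^ 2)%N, x \notin bad3, x \notin bad4 & interval_index x = k].
  by rewrite !(in_set, in_setD, in_setU) negb_or => /andP[/andP[/andP[-> ->] ->] /eqP ->].
apply: (@relation_count _ a b u v H b_gt0 im1 inj_ab aH bH H_gt0 S A1 B1 C1 A2 B2 C2 X tb C%:Z V%:Z) => //.
- by split; apply: le3.
- by split; apply: le3.
- move=> x /inS[_ _ _ ek]; have /andP[k1 k2] := interval_indexP x.
  by apply: hrel => //; rewrite -ek.
- by move=> x /inS[_ h _ _]; apply: not_bad3.
- move=> _; split => //.
  + by move=> x y /inS[hx _ _ ex] /inS[hy _ _ ey]; apply: dt_bound => //; rewrite ex ey.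
  + by move=> x _; apply: quot_le (uM x).
  + by move=> x _; apply: quot_le (vM x).
  + move=> x /inS[hx _ h _] hn; move/negP: h; apply; rewrite in_set; apply/andP; split.
      by rewrite in_set.
    by apply/asboolP; rewrite !PoszM.
Qed.

Lemma large_interval_card (k : int) :
  (#|[set x in ~: small :\: bad3 | interval_index x == k]| <= interval_bound N tb)%N.
Proof.
set S := [set x in _ | _].
case: (set_0Vmem S) => [->|[x0 x0S]]; first by rewrite cards0.
have kM : `|k| <= M%:Z.
  by move: x0S; rewrite inE => /andP[_ /eqP <-]; rewrite -mem_int_range interval_index_range.
have h5' : M%:R ^+ 2 <= 192 * N%:R * Y%:R :> F by rewrite -!natrM -natrX ler_nat.
have h6' : 76 * Y%:R <= M%:R :> F by rewrite -natrM ler_nat.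
have hNM : N%:R <= M%:R ^+ 2 :> F by rewrite -natrX ler_nat (leq_trans _ h2) // leq_pmull.
have h7' : M%:R <= N%:R :> F by rewrite ler_nat.
have [p1 [q1 [p2 [q2 [nz [hp1 hq1] [hp2 hq2] hrel]]]]] :=
  @bilinear_relation F N M k be Y N_gt0 M_gt0 kM be_gt0 Y_gt0 h4 h5' h6' hNM h7'.
have le3 (m : int) : `|m| <= (be * Y)%N%:Z -> `|m| <= X.
  by move=> h; apply: le_trans h _; rewrite lez_nat.
have inS x : x \in S -> [/\ (be ^ 2 <= d x)%N, x \notin bad3 & interval_index x = k].
  by rewrite !(in_set, in_setD, in_setC) -leqNgt => /andP[/andP[-> ->] /eqP ->].
(* A linear relation is fed to [relation_count] after multiplication by [b]: the quadratic forms
   then have no [a^2] term, the resultant is zero and the quartic case cannot occur. *)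
apply: (@relation_count _ a b u v H b_gt0 im1 inj_ab aH bH H_gt0 S 0 p1 q1 0 p2 q2 X tb C%:Z V%:Z) => //.
- by split; rewrite ?normr0 ?(ltW X_gt0) // le3.
- by split; rewrite ?normr0 ?(ltW X_gt0) // le3.
- move=> x /inS[hd _ ek]; have /andP[k1 k2] := interval_indexP x.
  transitivity (b x * (u x * (p1 * a x + q1 * b x) + v x * (p2 * a x + q2 * b x))).
    by rewrite /quad; ring.
  rewrite hrel ?mulr0 // -?ek //.
  by rewrite -dE expr2 -PoszM mulnn lez_nat.
- by move=> x /inS[_ h _]; apply: not_bad3.
- by rewrite /resq /Mac !(mul0r, mulr0, subrr, expr0n) eqxx.
Qed.

Lemma square_pair_card_param :
  (#|T| <= tb * Rm.+1 + 54 * C * Em * (be + Em) + 2 * (interval_bound N tb * (2 * M).+1))%N.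
Proof.
rewrite -cardsT.
have cov : [set: T] \subset bad3 :|: bad4 :|:
    ((small :\: (bad3 :|: bad4)) :|: (~: small :\: bad3)).
  apply/subsetP => x _; rewrite !(in_setU, in_setD, in_setC) !negb_or.
  by case: (x \in bad3); case: (x \in bad4); case: (x \in small).
apply: leq_trans (subset_leq_card cov) _.
apply: leq_trans (leq_card_setU _ _).1 _; apply: leq_add.
  by apply: leq_trans (leq_card_setU _ _).1 _; apply: leq_add; [exact: bad3_card | exact: bad4_card].
apply: leq_trans (leq_card_setU _ _).1 _; rewrite mul2n -addnn -(size_int_range M).
apply: leq_add; apply: (@card_fibers _ _ interval_index) => [x _|k _].
- exact: interval_index_range.
- exact: small_interval_card.
- exact: interval_index_range.
- exact: large_interval_card.
Qed.

End Param.

Lemma square_pair_card :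
  (#|[pred x : 'I_N.+1 * 'I_N.+1 | square_pair M x]| <=
   tb * Rm.+1 + 54 * (be ^ 2 %/ M) * Em * (be + Em)
   + 2 * (interval_bound N tb * (2 * M).+1))%N.
Proof.
rewrite -card_sig -/T; have [f hf] := square_pair_param.
pose a x := (f x).1.1.1; pose b x := (f x).1.1.2; pose u x := (f x).1.2; pose v x := (f x).2.
have {}hf x : [/\ (d x)%:Z = a x ^+ 2 + b x ^+ 2, im_form (a x) (b x) (u x) (v x) = 1,
   re_form (a x) (b x) (u x) (v x) = (n x)%:Z, `|a x| <= b x & 0 < b x].
  by have := hf x; rewrite /a /b /u /v; case: (f x) => [[[]]].
by apply: (@square_pair_card_param a b u v) => x; case: (hf x).
Qed.

End SquarePairs.

Lemma truncnS_bounds (F : archiRealFieldType) (x : F) : 1 <= x ->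
  x < (Num.truncn x).+1%:R <= 2 * x.
Proof.
move=> x1; have x0 : 0 <= x by apply: le_trans x1.
have /andP[h1 h2] := truncn_itv x0; rewrite h2 /= -natr1.
by move: h1 x1; clear; lra.
Qed.

(* In terms of [g = N^(1/48)] and a factor [e = N^o(1)] the parameters are
   [M ~ N^(7/12)], [be ~ N^(5/16) e], [Em ~ 6 N^(11/48) e] and [Rm ~ 2 N^(1/3)]. *)
Lemma square_pair_count (F : archiRealFieldType) (N tb : nat) (g e : F) :
  (0 < N)%N -> N%:R = g ^+ 48 -> (5 * 42 * 16) ^+ 6 <= g -> 5 * 16 * 16 <= e -> e <= g ->
  (forall m, (0 < m)%N -> (m <= 8 * N ^ 12)%N -> (size (divisors m) <= tb)%N) ->
  #|[pred x : 'I_N.+1 * 'I_N.+1 | square_pair (Num.truncn (g ^+ 28)).+1 x]|%:R <=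
  (3 * tb%:R + 54 * 4 * 12 * 14 * e ^+ 4 + 10 * (interval_bound N tb)%:R) * g ^+ 28 :> F.
Proof.
move=> N0 NE hg he eg htb.
have e1 : 1 <= e by apply: le_trans he; clear; lra.
have g1 : 1 <= g by apply: le_trans eg.
have g0 : 0 < g by apply: lt_le_trans g1.
have e0 : 0 < e by apply: lt_le_trans e1.
have en := ltW e0; have gn1 := ltW g0.
have gX i j : (i <= j)%N -> g ^+ i <= g ^+ j by move=> ij; rewrite ler_weXn2l.
have gp i : 0 < g ^+ i by rewrite exprn_gt0.
have gn i := ltW (gp i).
have g1X i : 1 <= g ^+ i by rewrite exprn_ege1.
have gbig : 216 <= g by apply: le_trans eg; apply: le_trans he; clear; lra.
have gmul i j (c : F) : (i < j)%N -> 0 <= c -> c <= 216 -> c * g ^+ i <= g ^+ j.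
  move=> ij c0 c216; apply: le_trans (gX i.+1 j ij); rewrite exprS ler_pM2r //.
  exact: le_trans c216 gbig.
set M := (Num.truncn (g ^+ 28)).+1.
have /andP[M1 M2] := truncnS_bounds (g1X 28%N); rewrite -/M in M1 M2.
pose be := (Num.truncn (g ^+ 15 * e)).+1.
have be1 : 1 <= g ^+ 15 * e by rewrite mulr_ege1.
have /andP[B1 B2] := truncnS_bounds be1; rewrite -/be in B1 B2.
pose Em := (Num.truncn (6 * g ^+ 11 * e)).+1.
have em1 : 1 <= 6 * g ^+ 11 * e.
  by rewrite -mulrA; have := mulr_ege1 (g1X 11%N) e1; clear; lra.
have /andP[E1 E2] := truncnS_bounds em1; rewrite -/Em in E1 E2.
pose Rm := Num.truncn (2 * g ^+ 16).
have rm0 : 0 <= 2 * g ^+ 16 by rewrite mulr_ge0 // ltW.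
have /andP[R1 R2] := truncn_itv rm0.
rewrite -/Rm in R1 R2.
(* The largest value allowed by [76 Y <= M]; from [M <= 152 Y] and [M <= N] it also satisfies
   [M^2 <= 192 N Y]. *)
pose Y := (M %/ 76)%N.
have M0 : (0 : F) < M%:R by rewrite ltr0n.
have MN : (M <= N)%N.
  by rewrite -(ler_nat F) NE; apply: le_trans M2 _; apply: gmul => //; clear; lra.
have M76 : (76 <= M)%N.
  rewrite -(ler_nat F); apply: le_trans (ltW M1).
  by have := gmul 0%N 28%N 76; rewrite expr0 mulr1; apply => //; clear; lra.
have Y0 : (0 < Y)%N by rewrite divn_gt0.
have MY : (M <= 152 * Y)%N.
  have := ltn_ceil M (isT : (0 < 76)%N); move: Y0; rewrite -/Y; clear; lia.
have BE (i : nat) : (g ^+ 15 * e) ^+ i <= be%:R ^+ i.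
  by rewrite lerXn2r ?nnegrE ?ler0n ?mulr_ge0 ?(ltW B1).
have Mp (i : nat) : (g ^+ 28) ^+ i <= M%:R ^+ i.
  by rewrite lerXn2r ?nnegrE ?ler0n ?(ltW M1).
have C2 : (be ^ 2 %/ M)%:R <= 4 * g ^+ 2 * e ^+ 2.
  apply: (@le_trans _ _ (be%:R ^+ 2 / M%:R)).
    by rewrite ler_pdivlMr // -natrM -natrX ler_nat leq_trunc_div.
  rewrite ler_pdivrMr //; apply: (@le_trans _ _ ((2 * (g ^+ 15 * e)) ^+ 2)).
    by rewrite lerXn2r ?nnegrE ?ler0n ?mulr_ge0 //.
  have -> : (2 * (g ^+ 15 * e)) ^+ 2 = 4 * g ^+ 2 * e ^+ 2 * g ^+ 28 by ring.
  by apply: ler_wpM2l; rewrite ?(ltW M1) ?mulr_ge0 ?exprn_ge0 //.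
have V2 : (N %/ M)%:R <= g ^+ 20.
  apply: (@le_trans _ _ (N%:R / M%:R)).
    by rewrite ler_pdivlMr // -natrM ler_nat leq_trunc_div.
  rewrite ler_pdivrMr // NE (_ : 48 = 20 + 28)%N // exprD ler_wpM2l ?(ltW M1) //.
have := @square_pair_card F N M be Y Em Rm tb N0 isT isT Y0.
set S := #|_|; move=> hS.
have {hS} : (S <= tb * Rm.+1 + 54 * (be ^ 2 %/ M) * Em * (be + Em)
   + 2 * (interval_bound N tb * (2 * M).+1))%N.
  apply: hS => //.
  - apply: le_trans (Mp 7%N); rewrite NE.
    have -> : (g ^+ 28) ^+ 7 = g * g ^+ 3 * (g ^+ 48) ^+ 4 by ring.
    rewrite ler_pM2r ?exprn_gt0 //; apply: le_trans hg _.
    by rewrite ler_peMr ?(ltW g0) //.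
  - rewrite -(ler_nat F) natrM natrX NE; apply: le_trans (Mp 2%N); rewrite -exprM.
    by apply: gmul => //; clear; lra.
  - rewrite -(ler_nat F) !natrX NE; apply: (@le_trans _ _ ((2 * g ^+ 28) ^+ 3)).
      by rewrite lerXn2r ?nnegrE ?ler0n ?mulr_ge0 //.
    rewrite exprMn -!exprM (_ : 2 ^+ 3 = 8 :> F); last by clear; ring.
    by apply: gmul => //; clear; lra.
  - apply: (@le_trans _ _ ((g ^+ 15 * e) ^+ 4 * (g ^+ 28) ^+ 3)); last first.
      by apply: ler_pM; rewrite ?exprn_ge0 ?mulr_ge0 ?BE ?Mp //.
    rewrite NE; have -> : (g ^+ 15 * e) ^+ 4 * (g ^+ 28) ^+ 3 = e ^+ 4 * (g ^+ 48) ^+ 3 by ring.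
    rewrite ler_pM2r ?exprn_gt0 // lerXn2r ?nnegrE ?(ltW e0) //.
    by clear; lra.
  - apply: (@leq_trans (M * (152 * Y))%N); first by rewrite expnS expn1 leq_mul2l MY orbT.
    apply: (@leq_trans (N * (152 * Y))%N); first by rewrite leq_mul2r MN orbT.
    by rewrite mulnA [(N * 152)%N]mulnC leq_mul // leq_mul.
  - by rewrite mulnC leq_trunc_div.
  - rewrite -(ler_nat F) natrX; apply: le_trans M2 _; apply: le_trans (BE 2%N).
    have -> : (g ^+ 15 * e) ^+ 2 = g ^+ 30 * e ^+ 2 by ring.
    apply: (@le_trans _ _ (g ^+ 30)); first by apply: gmul => //; clear; lra.
    by rewrite ler_peMr ?exprn_ege1.
  - rewrite -(ler_nat F) natrM natrX NE; apply: (@le_trans _ _ (2 * (g ^+ 15 * e) * (2 * g ^+ 28))).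
      apply: ler_pM => //; apply: le_trans M2; rewrite ler_nat.
      by apply: leq_div.
    apply: (@le_trans _ _ (4 * g ^+ 44)).
      have -> : 4 * g ^+ 44 = 2 * (g ^+ 15 * g) * (2 * g ^+ 28) by ring.
      by rewrite ler_pM2r ?mulr_gt0 // ler_pM2l // ler_pM2l.
    by rewrite -exprM; apply: gmul => //; clear; lra.
  - rewrite -(ler_nat F) natrX natrM natrM; apply: (@le_trans _ _ ((6 * g ^+ 11 * e) ^+ 2)).
      have -> : (6 * g ^+ 11 * e) ^+ 2 = 9 * (4 * g ^+ 2 * e ^+ 2) * g ^+ 20 by ring.
      by apply: ler_pM => //; rewrite ?mulr_ge0 // ler_pM2l.
    by rewrite lerXn2r ?nnegrE ?ler0n ?mulr_ge0 ?(ltW E1) //.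
  - rewrite -(ltr_nat F) natrX natrM NE.
    apply: (@lt_le_trans _ _ ((2 * g ^+ 16) ^+ 3)).
      have -> : (2 * g ^+ 16) ^+ 3 = 8 * g ^+ 48 by ring.
      by rewrite ltr_pM2r //; clear; lra.
    by rewrite lerXn2r ?nnegrE ?ler0n ?mulr_ge0 ?(ltW R2) //.
have T1 : (tb * Rm.+1)%:R <= 3 * tb%:R * g ^+ 28 :> F.
  rewrite natrM; apply: (@le_trans _ _ (tb%:R * (3 * g ^+ 28))).
    apply: ler_wpM2l; rewrite ?ler0n //; apply: (@le_trans _ _ (3 * g ^+ 16)).
      by rewrite -natr1; have := g1X 16%N; move: R1; clear; lra.
    by rewrite ler_pM2l // gX.
  by rewrite mulrCA mulrA.
(* Here the balance is exact: [g^2] from [be^2 / M], [g^11] from [Em] and [g^15] from [be] multiply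
   to [g^28], together with four factors [e]. *)
have T2 : (54 * (be ^ 2 %/ M) * Em * (be + Em))%:R <= 54 * 4 * 12 * 14 * e ^+ 4 * g ^+ 28 :> F.
  rewrite (natrM F _ (be + Em)) (natrM F _ Em) (natrM F 54) (natrD F be Em).
  apply: (@le_trans _ _ (54 * (4 * g ^+ 2 * e ^+ 2) * (2 * (6 * g ^+ 11 * e))
     * (2 * (g ^+ 15 * e) + 2 * (6 * g ^+ 15 * e)))).
    apply: ler_pM; rewrite ?mulr_ge0 ?addr_ge0 ?ler0n //.
      apply: ler_pM => //; rewrite ?mulr_ge0 ?ler0n //.
      by rewrite ler_pM2l // ltr0n.
    apply: lerD => //; apply: le_trans E2 _.
    by rewrite ler_pM2l // ler_pM2r // ler_pM2l // gX.
  by rewrite le_eqVlt; apply/orP; left; apply/eqP; ring.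
have T3 : (2 * (interval_bound N tb * (2 * M).+1))%:R <=
    10 * (interval_bound N tb)%:R * g ^+ 28 :> F.
  move: (interval_bound N tb) => IB.
  rewrite (natrM F 2) (natrM F IB) -[(2 * M).+1%:R]natr1 (natrM F 2 M).
  apply: (@le_trans _ _ (2 * (IB%:R * (5 * g ^+ 28)))).
    rewrite ler_pM2l // ler_wpM2l ?ler0n //.
    by have := g1X 28%N; move: M2; clear; lra.
  by rewrite le_eqVlt; apply/orP; left; apply/eqP; ring.
have natrD3 (x y z : nat) : (x + y + z)%N%:R = x%:R + y%:R + z%:R :> F by rewrite !natrD.
rewrite -(ler_nat F) natrD3 => /le_trans; apply.
by apply: le_trans (lerD (lerD T1 T2) T3) _; rewrite -!mulrDl.
Qed.

(** * Square roots of minus one *)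

Section SquareRoots.
Local Open Scope nat_scope.

Definition sq_roots (q : nat) : nat := \sum_(0 <= i < q) (q %| i ^ 2 + 1).

Lemma window_sum (f : nat -> nat) q m : (forall n, f (n + q) = f n) ->
  \sum_(m <= i < m + q) f i = \sum_(0 <= i < q) f i.
Proof.
move=> fq; elim: m => [|m IH]; first by rewrite add0n.
rewrite -IH; apply: (@addnI (f m)).
rewrite -big_ltn ?addSn ?ltnS ?leq_addr // big_nat_recr ?leq_addr //= fq.
exact: addnC.
Qed.

Lemma windows_sum (f : nat -> nat) q m k : (forall n, f (n + q) = f n) ->
  \sum_(m <= i < m + k * q) f i = k * \sum_(0 <= i < q) f i.
Proof.
move=> fq; elim: k => [|k IH]; first by rewrite mul0n addn0 big_geq.
rewrite (@big_cat_nat _ _ _ (m + k * q)) /= ?leq_add2l ?leq_mul2r ?leqnSn ?orbT ?leq_addr //.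
by rewrite IH mulSnr addnA window_sum // mulSnr.
Qed.

Lemma periodic_sum (f : nat -> nat) q N : (0 < q)%N -> (forall n, f (n + q) = f n) ->
  (N %/ q * \sum_(0 <= i < q) f i <= \sum_(1 <= n < N.+1) f n
    <= (N %/ q).+1 * \sum_(0 <= i < q) f i)%N.
Proof.
move=> q0 fq; have mono a b : (a <= b)%N ->
    (\sum_(1 <= n < 1 + a) f n <= \sum_(1 <= n < 1 + b) f n)%N.
  move=> ab; rewrite [leqRHS](@big_cat_nat _ _ _ (1 + a)) ?leq_add2l ?leq_addr //=.
have h1 : (N %/ q * q <= N)%N by apply: leq_trunc_div.
have h2 : (N <= (N %/ q).+1 * q)%N by apply: ltnW; apply: ltn_ceil.
by rewrite -!(windows_sum 1 _ fq) -[N.+1]add1n !mono.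
Qed.

Lemma dvdn_sq1_mod q n : (q %| (n %% q) ^ 2 + 1) = (q %| n ^ 2 + 1).
Proof. by rewrite /dvdn -modnDml modnXm modnDml. Qed.

Lemma dvdn_sq1_per q n : (q %| (n + q) ^ 2 + 1) = (q %| n ^ 2 + 1).
Proof. by rewrite -dvdn_sq1_mod modnDr dvdn_sq1_mod. Qed.

Lemma sq_roots_coprime a b : (0 < a)%N -> (0 < b)%N -> coprime a b ->
  sq_roots (a * b) = (sq_roots a * sq_roots b)%N.
Proof.
move=> a0 b0 cab; have ab0 : (0 < a * b)%N by rewrite muln_gt0 a0.
pose h (x : 'I_a * 'I_b) : 'I_(a * b) := Ordinal (ltn_pmod (chinese a b x.1 x.2) ab0).
have h1 x : (h x %% a)%N = x.1.
  by rewrite /= modn_dvdm ?dvdn_mulr // chinese_modl // modn_small.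
have h2 x : (h x %% b)%N = x.2.
  by rewrite /= modn_dvdm ?dvdn_mull // chinese_modr // modn_small.
have hI : injective h.
  move=> [i j] [i' j'] e; have := h1 (i, j); have := h2 (i, j).
  by rewrite e h1 h2 /= => /val_inj-> /val_inj->.
have hb : bijective h by apply: inj_card_bij; rewrite // card_prod !card_ord.
rewrite /sq_roots !big_mkord (reindex h) /=; last exact: onW_bij.
rewrite big_distrlr /= pair_bigA; apply: eq_bigr => x _ /=.
rewrite Gauss_dvd // -(dvdn_sq1_mod a) -(dvdn_sq1_mod b).
by rewrite -[X in (X %% a)%N]/(nat_of_ord (h x)) -[X in (X %% b)%N]/(nat_of_ord (h x)) h1 h2 mulnb.
Qed.

Lemma dvdn_sq1_Fp p n : prime p -> (p %| n ^ 2 + 1)%N = ((n%:R : 'F_p) ^+ 2 == -1)%R.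
Proof.
move=> pp; rewrite (dvdn_pcharf (pchar_Fp pp)) natrD natrX.
by rewrite -[RHS]subr_eq0 opprK.
Qed.

Lemma fermat_Fp p k (x : 'F_p) : prime p -> p = k.+1 -> x != 0%R -> (x ^+ k = 1)%R.
Proof.
move=> pp pk x0; have := expf_card x; rewrite card_Fp //.
have -> : (x ^+ p = x * x ^+ k)%R by rewrite -exprS -pk.
by move=> e; apply: (mulfI x0); rewrite e mulr1.
Qed.

(** A solution of [x^2 = -1] gives [(-1)^((p - 1)/2) = 1] by Fermat, so [(p - 1) / 2] is even. *)
Lemma prime_dvd_sq1_mod4 p n : prime p -> p != 2%N -> (p %| n ^ 2 + 1)%N -> p == 1 %[mod 4].
Proof.
move=> pp p2; rewrite dvdn_sq1_Fp // => /eqP hx.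
have podd : odd p by case: (even_prime pp) => // p2'; rewrite p2' in p2.
have [h ph] : exists h, p = (h.*2).+1 by exists p./2; rewrite -[LHS]odd_double_half podd.
have x0 : (n%:R : 'F_p)%R != 0%R.
  by apply/eqP => x0; move: hx; rewrite x0 expr0n /= => /eqP; rewrite eq_sym oppr_eq0 oner_eq0.
have := fermat_Fp pp ph x0; rewrite -mul2n exprM hx.
rewrite -signr_odd; case ho: (odd h) => /=; last by move=> _; rewrite ph; apply/eqP; lia.
rewrite expr1 => /eqP; rewrite eq_sym -subr_eq0 opprK -(natrD _ 1 1).
rewrite -(dvdn_pcharf (pchar_Fp pp)) => /dvdn_leq -/(_ isT).
by move: p2 (prime_gt1 pp); clear; lia.
Qed.

(** With [p = 4 k + 1], the polynomial [X^(2k) - 1] has too few roots to vanish at all nonzero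
    residues; for a nonroot [x] Fermat forces [x^(2k) = -1], and [x^k] is the required root. *)
Lemma sqrt_minus1_mod_prime p : prime p -> p == 1 %[mod 4] -> exists n, (p %| n ^ 2 + 1)%N.
Proof.
move=> pp /eqP p4; have p1 := prime_gt1 pp.
have [k pk] : exists k, p = ((4 * k).+1)%N by exists (p %/ 4); lia.
have k0 : (0 < k)%N by lia.
pose q : {poly 'F_p} := ('X^(2 * k) - 1)%R.
have qs : size q = (2 * k).+1 by rewrite /q size_XnsubC // muln_gt0.
have q0 : q != 0%R by rewrite -size_poly_eq0 qs.
case: (boolP [forall x : 'F_p, (x != 0%R) ==> root q x]) => [/forallP allq|].
  have := max_poly_roots q0 (rs := enum (predC1 (0%R : 'F_p))) _ (enum_uniq _).
  rewrite qs -cardE cardC1 card_Fp //.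
  have ha : all (root q) (enum (predC1 (0%R : 'F_p))).
    by apply/allP => x; rewrite mem_enum inE => x0; have := allq x; rewrite x0.
  by move=> /(_ ha); rewrite pk; clear -k0; lia.
rewrite negb_forall => /existsP[x]; rewrite negb_imply => /andP[x0 nr].
have e := fermat_Fp pp pk x0.
have {}e : ((x ^+ (2 * k) - 1) * (x ^+ (2 * k) + 1) = 0)%R.
  by rewrite -subr_sqr_1 -exprM -mulnA [(k * 2)%N]mulnC mulnA e subrr.
have e1 : (x ^+ (2 * k) = -1)%R.
  move/eqP: e; rewrite mulf_eq0 => /orP[/eqP e|]; last by rewrite addr_eq0 => /eqP.
  by move: nr; rewrite /root /q !hornerE e eqxx.
exists (nat_of_ord (x ^+ k)%R).
by rewrite dvdn_sq1_Fp // natr_Zp -exprM mulnC e1.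
Qed.

(** Newton step: [(p + 1) / 2] inverts 2 and [- n] inverts [n] modulo [p], so with [n^2 + 1 = k p]
    the correction is [t = n k / 2] modulo [p]. *)
Lemma hensel_sq1 p n : odd p -> (p %| n ^ 2 + 1)%N -> exists m, (p ^ 2 %| m ^ 2 + 1)%N.
Proof.
move=> po /dvdnP[k hk]; pose t := (n * k * (p.+1)./2)%N.
have ht : (2 * t = n * k * p.+1)%N by rewrite /t; have := odd_double_half p.+1; rewrite /= po; nia.
exists (n + p * t)%N; apply/dvdnP; exists (k ^ 2 + n ^ 2 * k + t ^ 2)%N.
have -> : ((n + p * t) ^ 2 + 1 = n ^ 2 + 1 + p * n * (2 * t) + p ^ 2 * t ^ 2)%N by ring.
rewrite ht hk.
have -> : (k * p + p * n * (n * k * p.+1) = k * p * (n ^ 2 + 1) + n ^ 2 * k * p ^ 2)%N.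
  by rewrite -[p.+1]addn1; ring.
by rewrite hk; ring.
Qed.

(** The roots are [r] and [q - r]. For any root [i], [p^2] divides [(i + r) (i - r)], and [p] cannot
    divide both factors, as it would divide [2 i]; so [p^2] divides one of them. The factor [i - r]
    is written [i + q - r] to stay in the natural numbers. *)
Lemma sq_roots_prime p : prime p -> p == 1 %[mod 4] -> sq_roots (p ^ 2) = 2.
Proof.
have small_mul (q j t : nat) : (t = j * q -> 0 < t -> t < q + q -> t = q)%N.
  case: j => [|[|j]]; rewrite ?mul0n ?mul1n ?mulSn; first by lia.
    by lia.
  by move: (j * q)%N => s; lia.
have sub_sq (r q : nat) : (r < q -> 2 * r * q + ((q - r) ^ 2 + 1) = r ^ 2 + 1 + q * q)%N.
  move=> rq; have {rq} : (q = (q - r) + r)%N by lia.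
  by move: (q - r)%N => s ->; ring.
have mul_sq (r q i : nat) :
    (r < q -> r ^ 2 + 1 + (i + r) * (i + q - r) = i ^ 2 + 1 + q * (i + r))%N.
  move=> rq; have {rq} : (q = (q - r) + r)%N by lia.
  by move: (q - r)%N => s ->; rewrite addnA addnK; ring.
move=> pp p4; have p1 := prime_gt1 pp.
have po : odd p by move/eqP: p4; clear; lia.
have [n0 /(hensel_sq1 po)[m hm]] := sqrt_minus1_mod_prime pp p4.
pose q := (p ^ 2)%N; have q0 : (0 < q)%N by rewrite expn_gt0 prime_gt0.
pose r := (m %% q)%N; have rq : (r < q)%N by rewrite ltn_mod.
have hr : (q %| r ^ 2 + 1)%N by rewrite dvdn_sq1_mod.
have np i : (q %| i ^ 2 + 1)%N -> ~~ (p %| i)%N.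
  move=> hi; apply/negP => /(dvdn_exp (isT : (0 < 2)%N)) pi.
  have : (p %| i ^ 2 + 1)%N by apply: dvdn_trans hi; rewrite /q expnS dvdn_mulr.
  by rewrite dvdn_addr // dvdn1; move: p1; clear; lia.
have r0 : (0 < r)%N by rewrite lt0n; apply/eqP => e; move: (np _ hr); rewrite e dvdn0.
have rq' : (q - r < q)%N by rewrite -subn_gt0 subKn // ltnW.
have p2r : coprime q (2 * r).
  rewrite /q coprime_pexpl // prime_coprime // Euclid_dvdM // negb_or (np _ hr) andbT.
  by apply/negP => /dvdn_leq -/(_ isT); move: p1 po; case: (p) => [|[|[|?]]].
rewrite /sq_roots big_mkord.
transitivity #|[set Ordinal rq; Ordinal rq']|; last first.
  rewrite cards2; case: eqP => // /(congr1 val) /= e.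
  have : (q %| 2 * r)%N by rewrite mul2n -addnn {2}e subnKC // ltnW.
  by rewrite /coprime in p2r; move/eqP: p2r => p2r /gcdn_idPl; rewrite p2r /q; move: p1; clear; nia.
rewrite -sum1_card [RHS]big_mkcond; apply: eq_bigr => i _ /=.
rewrite !inE -[RHS]/(nat_of_bool _) -!val_eqE /=; congr nat_of_bool.
apply/idP/orP => [hi|[/eqP->//|/eqP->]]; last first.
  rewrite -(dvdn_addr (m := 2 * r * q)); last exact: dvdn_mull.
  by rewrite sub_sq // dvdn_addl // dvdn_mulr.
have iq : (i < q)%N by [].
have : (q %| (i + r) * (i + q - r))%N.
  rewrite -(dvdn_addr (m := r ^ 2 + 1)) //.
  by rewrite mul_sq // dvdn_addl // dvdn_mulr.
case: (boolP (p %| i + r)%N) => [d1|d1].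
  rewrite Gauss_dvdl; last first.
    rewrite /q coprime_pexpl // prime_coprime //; apply/negP => d2.
    have : (p %| 2 * i)%N.
      rewrite -(dvdn_addl (2 * i) (n := q)); last by rewrite /q expnS dvdn_mulr.
      have -> : (2 * i + q = (i + r) + (i + q - r))%N by move: rq; clear; lia.
      exact: dvdn_add.
    rewrite Euclid_dvdM // (negPf (np _ hi)) orbF => /dvdn_leq -/(_ isT).
    by move: p1 po; case: (p) => [|[|[|?]]].
  move=> /dvdnP[j hj]; right; apply/eqP.
  have := small_mul _ _ _ hj; move: rq iq r0; move: (nat_of_ord i); clear; clearbody r q; lia.
rewrite Gauss_dvdr; last by rewrite /q coprime_pexpl // prime_coprime.
move=> /dvdnP[j hj]; left; apply/eqP.
have := small_mul _ _ _ hj; move: rq iq r0; move: (nat_of_ord i); clear; clearbody r q; lia.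
Qed.

End SquareRoots.

From mathcomp Require Import all_classical all_reals all_analysis.
Import numFieldNormedType.Exports.

(** * Functions of [N] bounded by every positive power of [N] *)

Definition subpoly (R : realType) (f : nat -> nat) : Prop :=
  forall eta : R, 0 < eta -> exists2 C : R, 0 < C &
    forall N, (0 < N)%N -> (f N)%:R <= C * N%:R `^ eta.

Section Subpoly.
Variable R : realType.

Lemma natr_ge1 (N : nat) : (0 < N)%N -> (1 : R) <= N%:R.
Proof. by move=> N0; rewrite ler1n. Qed.

Lemma powR_ge1 (x r : R) : 1 <= x -> 0 <= r -> 1 <= x `^ r.
Proof. by move=> x1 r0; rewrite -(powRr0 x); apply: ler_powR. Qed.

Lemma subpoly_le f h : (forall N, (0 < N)%N -> (f N <= h N)%N) -> subpoly R h -> subpoly R f.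
Proof.
move=> fh sh eta e0; have [C C0 hC] := sh eta e0; exists C => // N N0.
by apply: le_trans (hC N N0); rewrite ler_nat fh.
Qed.

Lemma subpoly_cst c : subpoly R (fun=> c).
Proof.
move=> eta e0; exists (c.+1%:R) => // N N0.
apply: (@le_trans _ _ (c.+1%:R * 1)); first by rewrite mulr1 ler_nat.
by rewrite ler_wpM2l // powR_ge1 ?natr_ge1 // ltW.
Qed.

Lemma subpolyD f h : subpoly R f -> subpoly R h -> subpoly R (fun N => (f N + h N)%N).
Proof.
move=> sf sh eta e0; have [C C0 hC] := sf eta e0; have [D D0 hD] := sh eta e0.
exists (C + D) => [|N N0]; first exact: addr_gt0.
by rewrite natrD mulrDl lerD ?hC ?hD.
Qed.

Lemma subpolyM f h : subpoly R f -> subpoly R h -> subpoly R (fun N => (f N * h N)%N).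
Proof.
move=> sf sh eta e0; have e2 : 0 < eta / 2 by rewrite divr_gt0.
have [C C0 hC] := sf _ e2; have [D D0 hD] := sh _ e2.
exists (C * D) => [|N N0]; first exact: mulr_gt0.
have n0 : (N%:R : R) != 0 by rewrite pnatr_eq0 -lt0n.
rewrite natrM (splitr eta) powRD; last by rewrite n0 implybT.
by rewrite mulrACA ler_pM ?hC ?hD.
Qed.

Lemma subpolyX f s : subpoly R f -> subpoly R (fun N => (f N ^ s)%N).
Proof.
move=> sf; elim: s => [|s IH]; first exact: subpoly_cst.
have := subpolyM sf IH; apply: subpoly_le => N _; by rewrite expnS.
Qed.

(** The [k]-th root of the hypothesis bounds [f N] by a constant times [N^(j/k)]; [k] is chosen with
    [j / k <= eta]. *)
Lemma subpoly_pow f j :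
  (forall k, (0 < k)%N -> exists C, forall N, (0 < N)%N -> (f N ^ k <= C * N ^ j)%N) ->
  subpoly R f.
Proof.
move=> hf eta e0; pose k := (Num.truncn (j%:R / eta)).+1.
have hk : j%:R <= eta * k%:R.
  have q0 : 0 <= j%:R / eta by rewrite divr_ge0 // ltW.
  by have /andP[_ /ltW] := truncn_itv q0; rewrite ler_pdivrMr // mulrC.
have [C hC] := hf k isT; exists C.+1%:R => // N N0.
have n1 := natr_ge1 N0; have n0 : 0 <= N%:R :> R by [].
rewrite -(@ler_pXn2r _ k) ?nnegrE ?mulr_ge0 ?powR_ge0 //.
apply: (@le_trans _ _ (C.+1%:R * N%:R ^+ j)).
  rewrite -!natrX -natrM ler_nat (leq_trans (hC N N0)) //.
  by rewrite leq_mul2r leqnSn orbT.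
rewrite exprMn; apply: ler_pM => //; rewrite ?exprn_ge0 //.
  by rewrite ler_eXnr // ler1n.
by rewrite -[X in _ <= X]powR_mulrn ?powR_ge0 // -powRrM -powR_mulrn // ler_powR.
Qed.

(** The range [8 N^12] covers the resultants and determinants, bounded by [8 X^6] with [X = N^2],
    and also [n^2 + 1]. *)
Definition max_divisors (N : nat) : nat := \max_(m < (8 * N ^ 12).+1) size (divisors m).

Lemma subpoly_max_divisors : subpoly R max_divisors.
Proof.
apply: (@subpoly_pow _ 12) => k k0; have [C C0 hC] := divisor_bound k0.
exists (C * 8)%N => N N0; rewrite /max_divisors.
have [|i ->] := @bigop.eq_bigmax _ (fun m : 'I_(8 * N ^ 12).+1 => size (divisors m)).
  by rewrite card_ord.
case: (posnP i) => [->|i0]; first by rewrite exp1n muln_gt0 muln_gt0 C0 expn_gt0 N0.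
apply: leq_trans (hC _ i0) _; rewrite -mulnA leq_mul2l -ltnS ltn_ord orbT //.
Qed.

Lemma max_divisorsP N m : (m <= 8 * N ^ 12)%N -> (size (divisors m) <= max_divisors N)%N.
Proof.
move=> hm; have hm' : (m < (8 * N ^ 12).+1)%N by [].
exact: (leq_bigmax (Ordinal hm')).
Qed.

Lemma subpoly_ncol s : subpoly R (fun N => ncol (8 * N ^ 6) s).
Proof.
rewrite /ncol; apply: subpolyX; apply: subpolyM (subpoly_cst _).
apply: subpolyM (subpoly_cst _); rewrite /log_range.
have hl : subpoly R (fun N => (up_log 2 (8 * N ^ 6 + 2)).+1).
  apply: (@subpoly_pow _ 6) => k k0; have [C C0 hC] := log_bound k0.
  exists (C * 10)%N => N N0; apply: leq_trans (hC _ _) _; first by rewrite addn2.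
  rewrite -mulnA leq_mul2l; apply/orP; right.
  have : (0 < N ^ 6)%N by rewrite expn_gt0 N0.
  by move: (N ^ 6)%N => X; lia.
apply: subpoly_le (subpolyM (subpoly_cst 17) hl) => N _; lia.
Qed.

Lemma subpoly_interval_bound : subpoly R (fun N => interval_bound N (max_divisors N)).
Proof.
rewrite /interval_bound.
have h2 := subpoly_ncol 2; have h3 := subpoly_ncol 3; have h4 := subpoly_ncol 4.
have ht := subpoly_max_divisors; have h2t := subpolyM (subpoly_cst 2) ht.
apply: subpolyD (subpoly_cst _) _; apply: subpolyD.
  by apply: subpolyD (subpolyM h3 h2t); apply: subpolyM (subpoly_cst _) h2.
apply: subpolyM h2t; apply: subpolyM ht; exact: subpolyM (subpoly_cst _) h4.
Qed.

Definition cutoff (N : nat) : nat := (Num.truncn ((N%:R : R) `^ (7 / 12))).+1.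

Lemma square_pair_bound (eps : R) : 0 < eps -> exists2 C : R, 0 < C &
  forall N, (0 < N)%N ->
    #|[pred x : 'I_N.+1 * 'I_N.+1 | square_pair (cutoff N) x]|%:R <= C * N%:R `^ (7 / 12 + eps).
Proof.
move=> e0.
have [C1 C10 h1] := subpoly_max_divisors e0; have [C2 C20 h2] := subpoly_interval_bound e0.
(* [e = N^del] enters to the fourth power, hence [del <= eps / 4]; [del <= 1/48] ensures
   [e <= g]. *)
pose del : R := Num.min (eps / 4) 48^-1.
have del0 : 0 < del by rewrite lt_min divr_gt0 // invr_gt0 ltr0n.
have del1 : 4 * del <= eps by rewrite mulrC -ler_pdivlMr // ge_min lexx.
have del2 : del <= 48^-1 by rewrite ge_min lexx orbT.
pose K : R := (5 * 42 * 16) ^+ 6; pose L : R := 5 * 16 * 16.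
have K1 : 1 <= K by rewrite exprn_ege1 //; clear; lra.
have L1 : 1 <= L by rewrite /L; clear; lra.
(* From [B] on, both lower bounds [K <= g] and [L <= e] hold; below [B] the trivial bound
   [(N + 1)^2] is absorbed by the constant. *)
pose B := K ^+ 48 + L `^ (del^-1).
have B0 : 0 <= B by rewrite addr_ge0 ?powR_ge0 ?exprn_ge0 // (le_trans _ K1).
exists (3 * C1 + 54 * 4 * 12 * 14 + 10 * C2 + (B + 1) ^+ 2).
  by rewrite !addr_gt0 ?mulr_gt0 ?exprn_gt0 ?ltr0n // ltr_wpDl.
move=> N N0; have n1 := natr_ge1 N0.
have nn0 : (N%:R : R) != 0 by rewrite pnatr_eq0 -lt0n.
have n0 : 0 <= N%:R :> R by [].
have P1 : 1 <= N%:R `^ (7 / 12 + eps) :> R.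
  by rewrite powR_ge1 // addr_ge0 ?(ltW e0) // divr_ge0.
have A0 : 0 <= 3 * C1 + 54 * 4 * 12 * 14 + 10 * C2.
  by rewrite !addr_ge0 ?mulr_ge0 ?(ltW C10) ?(ltW C20) ?ler0n.
have [nB|nB] := lerP B N%:R; last first.
  apply: (@le_trans _ _ ((B + 1) ^+ 2 * N%:R `^ (7 / 12 + eps))); last first.
    by rewrite ler_wpM2r ?powR_ge0 // lerDr.
  apply: (@le_trans _ _ ((B + 1) ^+ 2 * 1)); last by rewrite ler_wpM2l // sqr_ge0.
  rewrite mulr1; apply: (@le_trans _ _ (N.+1%:R ^+ 2)).
    by rewrite -natrX ler_nat (leq_trans (max_card _)) // card_prod card_ord expnS expn1.
  rewrite -natr1; apply: lerXn2r; rewrite ?nnegrE.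
  - by rewrite addr_ge0.
  - by rewrite addr_ge0.
  - by rewrite lerD2r ltW.
pose g : R := N%:R `^ 48^-1; pose e : R := N%:R `^ del.
have gE : N%:R = g ^+ 48.
  by rewrite /g -powR_mulrn ?powR_ge0 // -powRrM mulVf ?powRr1 // pnatr_eq0.
have g28 : g ^+ 28 = N%:R `^ (7 / 12).
  rewrite /g -powR_mulrn ?powR_ge0 // -powRrM; congr (_ `^ _).
  by field.
have hK : K <= g.
  rewrite -(@ler_pXn2r _ 48) ?nnegrE ?powR_ge0 ?(le_trans _ K1) // -gE.
  by apply: le_trans nB; rewrite lerDl powR_ge0.
have hL : L <= e.
  have L0 : 0 <= L by apply: le_trans L1.
  have -> : L = (L `^ del^-1) `^ del by rewrite -powRrM mulVf ?powRr1 // gt_eqF.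
  rewrite /e; apply: ge0_ler_powR; rewrite ?nnegrE ?powR_ge0 ?(ltW del0) //.
  by apply: le_trans nB; rewrite lerDr exprn_ge0 // (le_trans _ K1).
have eg : e <= g by apply: ler_powR.
have tbP m : (0 < m)%N -> (m <= 8 * N ^ 12)%N -> (size (divisors m) <= max_divisors N)%N.
  by move=> _; apply: max_divisorsP.
have := @square_pair_count R N (max_divisors N) g e N0 gE hK hL eg tbP.
rewrite /cutoff -g28 => /le_trans; apply.
have -> : N%:R `^ (7 / 12 + eps) = N%:R `^ eps * g ^+ 28.
  by rewrite addrC powRD ?nn0 ?implybT // g28.
rewrite mulrA; apply: ler_wpM2r; first by rewrite exprn_ge0 // powR_ge0.
apply: (@le_trans _ _ ((3 * C1 + 54 * 4 * 12 * 14 + 10 * C2) * N%:R `^ eps)); last first.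
  by rewrite ler_wpM2r ?powR_ge0 // lerDl sqr_ge0.
rewrite !(mulrDl _ _ (N%:R `^ eps)); apply: lerD; first apply: lerD.
- by rewrite -mulrA ler_pM2l ?ltr0n // h1.
- apply: ler_wpM2l; first by rewrite !mulr_ge0 ?ler0n.
  rewrite /e -powR_mulrn ?powR_ge0 // -powRrM ler_powR // mulrC //.
- by rewrite -mulrA ler_pM2l ?ltr0n // h2.
Qed.

End Subpoly.

(** * Inclusion-exclusion over the primes *)

Section SplitPrimes.
Local Open Scope nat_scope.

Definition split_prime (p : nat) : bool := prime p && (p == 1 %[mod 4])%N.

Lemma prime_prod_coprime (s : seq nat) p : prime p -> all prime s -> p \notin s ->
  coprime p (\prod_(q <- s) q).
Proof.
move=> pp; elim: s => [|q s IH]; first by rewrite big_nil coprimen1.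
rewrite big_cons /= inE negb_or => /andP[pq ps] /andP[npq nps].
by rewrite coprimeMr IH // andbT prime_coprime // dvdn_prime2.
Qed.

Lemma prod_sq_dvdn (s : seq nat) x : uniq s -> all prime s ->
  ((\prod_(p <- s) p) ^ 2 %| x)%N = all (fun p => p ^ 2 %| x)%N s.
Proof.
elim: s => [|p s IH]; first by rewrite big_nil /= dvd1n.
rewrite big_cons /= => /andP[ps us] /andP[pp aps].
rewrite expnMn Gauss_dvd ?IH //.
by rewrite coprime_pexpl // coprime_pexpr // prime_prod_coprime.
Qed.

Lemma sq_roots_prod (s : seq nat) : uniq s -> all split_prime s ->
  sq_roots ((\prod_(p <- s) p) ^ 2) = (2 ^ size s)%N.
Proof.
elim: s => [|p s IH] /=; first by rewrite big_nil /sq_roots big_nat1.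
rewrite big_cons => /andP[ps us] /andP[/andP[pp p4] aps].
have hs : all prime s by apply: sub_all aps => q /andP[].
rewrite expnMn sq_roots_coprime ?(sq_roots_prime pp p4) ?IH //.
- by rewrite -expnS.
- by rewrite expn_gt0 prime_gt0.
- rewrite expn_gt0 orbF; elim: (s) hs => [|q t IHt]; rewrite ?big_nil // big_cons muln_gt0.
  by move=> /andP[/prime_gt0->/IHt].
- by rewrite coprime_pexpl // coprime_pexpr // prime_prod_coprime.
Qed.

Section SetProducts.
Variable m : nat.
Implicit Types A B : {set 'I_m}.

Definition split_primes : {set 'I_m} := [set p : 'I_m | split_prime p].

Definition set_prod A : nat := \prod_(p in A) nat_of_ord p.

Lemma set_prodE A : set_prod A = \prod_(p <- [seq nat_of_ord p | p <- enum A]) p.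
Proof. by rewrite big_map big_enum. Qed.

Lemma uniq_set_seq A : uniq [seq nat_of_ord p | p <- enum A].
Proof. by rewrite map_inj_uniq ?enum_uniq //; apply: val_inj. Qed.

Lemma split_primes_seq A : A \subset split_primes ->
  all split_prime [seq nat_of_ord p | p <- enum A].
Proof.
move=> /fintype.subsetP AG; apply/allP => _ /mapP[p + ->]; rewrite mem_enum => /AG.
by rewrite inE.
Qed.

Lemma prime_seq A : A \subset split_primes -> all prime [seq nat_of_ord p | p <- enum A].
Proof. by move/split_primes_seq; apply: sub_all => p /andP[]. Qed.

Lemma sq_roots_set_prod A : A \subset split_primes -> sq_roots (set_prod A ^ 2) = (2 ^ #|A|)%N.
Proof.
move=> AG; rewrite set_prodE sq_roots_prod ?uniq_set_seq ?split_primes_seq //.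
by rewrite size_map -cardE.
Qed.

Lemma set_prod_sq_dvdn A x : A \subset split_primes ->
  (set_prod A ^ 2 %| x)%N = [forall (p | p \in A), (p ^ 2 %| x)%N].
Proof.
move=> AG; rewrite set_prodE prod_sq_dvdn ?uniq_set_seq ?prime_seq // all_map.
apply/allP/forallP => [h p|h p].
  by apply/implyP => pA; apply: h; rewrite mem_enum.
by rewrite mem_enum => pA; move/implyP: (h p); apply.
Qed.

Lemma set_prod_gt0 A : A \subset split_primes -> (0 < set_prod A)%N.
Proof.
move=> /fintype.subsetP AG; apply: (big_ind (fun n => 0 < n)%N) => // [a b|p /AG].
  by rewrite muln_gt0 => -> .
by rewrite inE => /andP[/prime_gt0].
Qed.

Lemma dvdn_set_prod A p : A \subset split_primes -> p \in split_primes ->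
  (p %| set_prod A)%N = (p \in A).
Proof.
move=> AG; rewrite inE => /andP[pp _]; rewrite set_prodE; apply/idP/idP; last first.
  move=> pA; rewrite -set_prodE /set_prod (bigD1 p) //= dvdn_mulr //.
apply: contraTT => pA; rewrite -prime_coprime // prime_prod_coprime ?prime_seq //.
by rewrite (mem_map val_inj) mem_enum.
Qed.

Lemma set_prod_inj A B : A \subset split_primes -> B \subset split_primes ->
  set_prod A = set_prod B -> A = B.
Proof.
move=> AG BG e; apply/finset.setP => p.
case: (boolP (p \in split_primes)) => pG.
  by rewrite -(dvdn_set_prod AG) // e dvdn_set_prod.
have nP (C : {set 'I_m}) : C \subset split_primes -> (p \in C) = false.
  by move=> /fintype.subsetP CG; apply: contraNF pG => /CG.
by rewrite !nP.
Qed.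

Lemma set_prodS A B : A \subset B -> (set_prod A %| set_prod B)%N.
Proof.
by move=> AB; rewrite /set_prod [X in (_ %| X)%N](big_setID A) /= (finset.setIidPr AB) dvdn_mulr.
Qed.

(** Distinct subsets of [A] give distinct divisors. Thus the number [2^#|A|] of square roots of -1
    modulo [set_prod A ^ 2] is controlled by the divisor function. *)
Lemma card_divisors_set_prod A : A \subset split_primes ->
  (2 ^ #|A| <= size (divisors (set_prod A)))%N.
Proof.
move=> AG; rewrite -card_powerset cardE -(size_map set_prod).
apply: uniq_leq_size.
  rewrite map_inj_in_uniq ?enum_uniq // => B C; rewrite !mem_enum !powersetE => BA CA.
  by apply: set_prod_inj; apply: fintype.subset_trans AG.
move=> _ /mapP[B + ->]; rewrite mem_enum powersetE => BA.
by rewrite -dvdn_divisors ?set_prod_gt0 // set_prodS.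
Qed.

Lemma sum_set_prod_le (F : numDomainType) (f : nat -> F) : (forall n, 0 <= f n)%R ->
  (\sum_(A : {set 'I_m} | A \subset split_primes) f (set_prod A) <=
   \sum_(0 <= d < (set_prod split_primes).+1) f d)%R.
Proof.
move=> f0; set D := set_prod _.
pose h A : 'I_D.+1 := inord (set_prod A).
have hD A : A \subset split_primes -> (set_prod A < D.+1)%N.
  by move=> AG; rewrite ltnS dvdn_leq ?set_prod_gt0 // set_prodS.
have hE A : A \subset split_primes -> h A = set_prod A :> nat.
  by move=> AG; rewrite inordK // hD.
pose X := [set A : {set 'I_m} | A \subset split_primes].
have hI : {in X &, injective h}.
  move=> A B; rewrite !inE => AG BG /(congr1 val); rewrite /= !hE // => e.
  by apply: set_prod_inj.
rewrite (eq_bigr (fun A => f (h A))); last by move=> A AG; rewrite hE.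
rewrite (eq_bigl (fun A => A \in X)); last by move=> A; rewrite inE.
rewrite -(big_imset (fun d : 'I_D.+1 => f d) hI) /=.
rewrite big_mkord [leRHS](bigID (mem (h @: X))) /= lerDl.
by apply: sumr_ge0.
Qed.

End SetProducts.

End SplitPrimes.

(** [d > n] would give [(n + 1)^2 <= n^2 + 1]. *)
Lemma dvdn_sq_sq1_le d n : (0 < n)%N -> (d ^ 2 %| n ^ 2 + 1)%N -> (d <= n)%N.
Proof.
move=> n0 /dvdn_leq; rewrite addn1 => /(_ isT) h; rewrite leqNgt; apply/negP => nd.
have : (n.+1 ^ 2 <= d ^ 2)%N by rewrite leq_exp2r.
by move: h n0; rewrite !expnS !expn0 !muln1; move: (d * d)%N => x; clear; nia.
Qed.

Lemma prime_sq_dvd_sq1 p n : prime p -> (p ^ 2 %| n ^ 2 + 1)%N -> split_prime p.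
Proof.
move=> pp h; rewrite /split_prime pp /=; apply: (@prime_dvd_sq1_mod4 p n) => //; last first.
  by apply: dvdn_trans h; rewrite expnS dvdn_mulr.
apply/eqP => p2; move: h; rewrite p2 => /dvdnP[k].
have [->|->] : n = ((n %/ 2).*2)%N \/ n = ((n %/ 2).*2).+1 by lia.
  by move: (n %/ 2)%N => j; rewrite -mul2n !expnS; lia.
by move: (n %/ 2)%N => j; rewrite -mul2n -addn1 !expnS; lia.
Qed.

(** A prime whose square divides [n^2 + 1] is at most [n < m] and is 1 modulo 4, so the split primes
    below [m] detect it. *)
Lemma squarefree_indicator (F : comNzRingType) m n : (0 < n)%N -> (n < m)%N ->
  (`[< squarefree (n ^ 2 + 1) >] : nat)%:R =
  \prod_(p in split_primes m) (1 - (p ^ 2 %| n ^ 2 + 1)%N%:R) :> F.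
Proof.
move=> n0 nm; case: asboolP => [sf|/existsNP[p /not_implyP[pp /negP]]].
  rewrite big1 // => p; rewrite inE => /andP[pp _].
  by rewrite (negPf (sf _ pp)) subr0.
rewrite negbK => pn; have pm : (p < m)%N by rewrite (leq_ltn_trans (dvdn_sq_sq1_le n0 pn)).
rewrite (bigD1 (Ordinal pm)) /=; first by rewrite pn subrr mul0r.
by rewrite inE (prime_sq_dvd_sq1 pp pn).
Qed.

Lemma prod_1sub_expand (F : comNzRingType) (I : finType) (G : {set I}) (f : I -> F) :
  \prod_(p in G) (1 - f p) =
  \sum_(A : {set I} | A \subset G) (-1) ^+ #|A| * \prod_(p in A) f p.
Proof.
pose g p := if p \in G then - f p else 0.
rewrite big_mkcond (eq_bigr (fun p => g p + 1)); last first.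
  by move=> p _; rewrite /g; case: ifP => _; rewrite ?add0r // addrC.
rewrite bigA_distr /= [RHS]big_mkcond; apply: eq_bigr => A _.
case: ifP => [/fintype.subsetP AG|/negbT/subsetPn[p pA pG]]; last first.
  by rewrite (bigD1 p) //= pA /g (negPf pG) mul0r.
rewrite -big_mkcond /= -prodrN; apply: eq_bigr => p pA.
by rewrite /g AG.
Qed.

Lemma prodr_nat_of_bool (F : comNzRingType) (I : finType) (A : {set I}) (P : I -> bool) :
  \prod_(p in A) (P p : nat)%:R = ([forall (p | p \in A), P p] : nat)%:R :> F.
Proof.
case: forallP => [h|/forallP]; last first.
  rewrite negb_forall => /existsP[p]; rewrite negb_imply => /andP[pA nP].
  by rewrite (bigD1 p) //= (negPf nP) mul0r.
by rewrite big1 // => p pA; have := h p; rewrite pA /= => ->.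
Qed.

Definition sq1_count (q N : nat) : nat := \sum_(1 <= n < N.+1) (q %| n ^ 2 + 1)%N.

Lemma sq1_count_approx (F : realFieldType) q N : (0 < q)%N ->
  `|(sq1_count q N)%:R - N%:R * ((sq_roots q)%:R / q%:R)| <= (sq_roots q)%:R :> F.
Proof.
move=> q0; have /andP[] := @periodic_sum (fun n => (q %| n ^ 2 + 1)%N : nat) q N q0
  (fun n => congr1 nat_of_bool (dvdn_sq1_per q n)).
rewrite -/(sq_roots q) -/(sq1_count q N) -!(ler_nat F) !natrM -natr1.
set k := (N %/ q)%N; set r := (sq_roots q)%:R; set E := (sq1_count q N)%:R => h1 h2.
have r0 : 0 <= r :> F by [].
have qF : 0 < q%:R :> F by rewrite ltr0n.
have a1 : k%:R <= N%:R / q%:R :> F by rewrite ler_pdivlMr // -natrM ler_nat leq_trunc_div.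
have a2 : N%:R / q%:R <= k%:R + 1 :> F.
  by rewrite ler_pdivrMr // natr1 -natrM ler_nat ltnW // ltn_ceil.
have -> : N%:R * (r / q%:R) = N%:R / q%:R * r by rewrite mulrA mulrAC.
have b1 := ler_wpM2r r0 a1; have b2 := ler_wpM2r r0 a2.
rewrite ler_norml; apply/andP; split; move: h1 h2 b1 b2; clear; rewrite mulrDl mul1r; lra.
Qed.

Lemma count_below M K : (\sum_(0 <= d < K) (d < M) <= M)%N.
Proof.
have : (\sum_(0 <= d < K) (d < M) <= minn K M)%N.
  elim: K => [|K IH]; first by rewrite big_geq.
  by rewrite big_nat_recr //=; move: IH; lia.
lia.
Qed.

Lemma sum_nat_support (g : nat -> nat) K L : (forall d, (L <= d)%N -> g d = 0%N) ->
  (\sum_(0 <= d < K) g d <= \sum_(0 <= d < L) g d)%N.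
Proof.
move=> g0; case: (leqP K L) => h.
  by rewrite [leqRHS](@big_cat_nat _ _ _ K) //= leq_addr.
rewrite (@big_cat_nat _ _ _ L) ?(ltnW h) //=.
have -> : (\sum_(L <= d < K) g d = 0)%N.
  by rewrite big_nat_cond big1 // => d /andP[/andP[/g0]].
by rewrite addn0.
Qed.

Lemma sum_sq1_count_le N M K :
  (\sum_(0 <= d < K) (M <= d) * sq1_count (d ^ 2) N <=
   #|[pred x : 'I_N.+1 * 'I_N.+1 | square_pair M x]|)%N.
Proof.
apply: leq_trans (@sum_nat_support _ K N.+1 _) _ => [d Nd|].
  rewrite /sq1_count big_nat_cond big1 ?muln0 // => n /andP[/andP[n0 nN] _].
  by apply/eqP; rewrite eqb0; apply/negP => /(dvdn_sq_sq1_le n0); lia.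
have -> : #|[pred x : 'I_N.+1 * 'I_N.+1 | square_pair M x]| = (\sum_(n < N.+1) \sum_(d < N.+1)
    if [&& 0 < n, M <= d & d ^ 2 %| n ^ 2 + 1] then 1 else 0)%N.
  by rewrite pair_bigA /= -sum1_card big_mkcond.
rewrite exchange_big big_mkord; apply: leq_sum => d _ /=.
rewrite /sq1_count -(big_mkord xpredT (fun n => if [&& 0 < n, M <= d & d ^ 2 %| n ^ 2 + 1] then 1 else 0)%N).
rewrite [leqRHS]big_ltn // add0n big_distrr /=; apply/eq_leq/eq_big_nat.
by move=> n /andP[n0 _]; rewrite n0 /= mulnb; case: ifP.
Qed.

(** As [m > N], inclusion-exclusion over the split primes below [m] is exact, and the truncated
    Euler product expands over the same sets. A set with product [d < M] contributes a rounding
    error of at most [2^#|A| <= T]; for [d >= M] the count and the main term are bounded separately,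
    by square pairs and by the tail of a divisor sum. *)
Lemma sieve_error (F : realFieldType) N M m T : (N < m)%N ->
  (forall d, (d < M)%N -> (size (divisors d) <= T)%N) ->
  exists D, `|(\sum_(1 <= n < N.+1 | `[< squarefree (n ^ 2 + 1) >]) 1)%N%:R -
     N%:R * \prod_(0 <= p < m | prime p && (p == 1 %[mod 4])%N) (1 - 2 / p%:R ^+ 2)|
   <= (M * T)%N%:R + #|[pred x : 'I_N.+1 * 'I_N.+1 | square_pair M x]|%:R
      + N%:R * \sum_(M <= d < D) (size (divisors d))%:R / d%:R ^+ 2 :> F.
Proof.
move=> Nm hT; pose G := split_primes m.
pose s (A : {set 'I_m}) : F := (-1) ^+ #|A|.
have -> : (\sum_(1 <= n < N.+1 | `[< squarefree (n ^ 2 + 1) >]) 1)%N%:R =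
    \sum_(A : {set 'I_m} | A \subset G) s A * (sq1_count (set_prod A ^ 2) N)%:R.
  rewrite big_mkcond /= natr_sum.
  rewrite (eq_big_nat _ _ (F2 := fun n => \sum_(A : {set 'I_m} | A \subset G)
      s A * (set_prod A ^ 2 %| n ^ 2 + 1)%N%:R)); last first.
    move=> n /andP[n0 nN]; transitivity ((`[< squarefree (n ^ 2 + 1) >] : nat)%:R : F).
      by case: asboolP.
    rewrite (@squarefree_indicator F m n) ?(leq_trans nN) // prod_1sub_expand.
    apply: eq_bigr => A AG; rewrite prodr_nat_of_bool set_prod_sq_dvdn //.
  rewrite exchange_big /=; apply: eq_bigr => A AG.
  by rewrite -mulr_sumr /sq1_count natr_sum.
have -> : N%:R * \prod_(0 <= p < m | prime p && (p == 1 %[mod 4])%N) (1 - 2 / p%:R ^+ 2) =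
    \sum_(A : {set 'I_m} | A \subset G)
      s A * (N%:R * ((2 ^ #|A|)%N%:R / (set_prod A ^ 2)%N%:R)) :> F.
  rewrite big_mkord (eq_bigl (fun p => p \in G)); last by move=> p; rewrite inE.
  rewrite prod_1sub_expand mulr_sumr; apply: eq_bigr => A AG.
  rewrite mulrCA; congr (_ * (_ * _)); rewrite big_split /= prodr_const -natrX; congr (_ * _).
  by rewrite prodfV natrX /set_prod natr_prod -prodrXl.
rewrite -sumrB; exists (set_prod G).+1.
pose H d : F := ((d < M) * T)%N%:R + ((M <= d) * sq1_count (d ^ 2) N)%N%:R
   + N%:R * (if (M <= d)%N then (size (divisors d))%:R / d%:R ^+ 2 else 0).
have H0 d : 0 <= H d.
  by rewrite /H !addr_ge0 // mulr_ge0 //; case: ifP.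
apply: (@le_trans _ _ (\sum_(A : {set 'I_m} | A \subset G) H (set_prod A))).
  apply: (le_trans (ler_norm_sum _ _ _)); apply: ler_sum => A AG.
  rewrite -mulrBr normrM /s normrX normrN1 expr1n mul1r.
  have d0 := set_prod_gt0 AG; have q0 : (0 < set_prod A ^ 2)%N by rewrite expn_gt0 d0.
  have tA : (2 ^ #|A|)%N%:R <= (size (divisors (set_prod A)))%:R :> F.
    by rewrite ler_nat card_divisors_set_prod.
  rewrite /H; case: (ltnP (set_prod A) M) => dM.
    rewrite mul0n addr0 mulr0 addr0 mul1n -(sq_roots_set_prod AG).
    apply: (le_trans (sq1_count_approx F N q0)); rewrite sq_roots_set_prod //.
    by rewrite (le_trans tA) // ler_nat hT.
  rewrite mul0n add0r mul1n (natrX _ (set_prod A) 2); apply: (le_trans (ler_normB _ _)).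
  rewrite ger0_norm // ger0_norm; last by rewrite mulr_ge0 ?divr_ge0 ?exprn_ge0.
  by rewrite lerD2l; apply: ler_wpM2l => //; apply: ler_wpM2r.
apply: (le_trans (sum_set_prod_le m H0)).
rewrite /H !big_split /= -!natr_sum; apply: lerD; first apply: lerD.
- by rewrite ler_nat -big_distrl /= leq_mul2r count_below orbT.
- by rewrite ler_nat sum_sq1_count_le.
- rewrite -mulr_sumr ler_wpM2l // -big_mkcond /=.
  case: (leqP M (set_prod (split_primes m)).+1) => MD; last first.
    rewrite big_nat_cond big1; last by move=> d /andP[/andP[_ dD] Md]; lia.
    by rewrite big_geq // ltnW.
  rewrite (@big_cat_nat _ _ _ M) //= big_nat_cond big1; last first.
    by move=> d /andP[/andP[_ dM] Md]; lia.
  rewrite add0r big_nat_cond [leRHS]big_nat_cond.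
  rewrite (eq_bigl (fun i => (M <= i < (set_prod (split_primes m)).+1)%N && true)) //.
  by move=> d; case: (leqP M d).
Qed.

Local Open Scope classical_set_scope.

(** * The Euler product and the conclusion *)

Section DivisorTail.
Variable R : realType.

(** Fourth roots make the tail estimate algebraic: with [t = root4 d], the divisor bound turns the
    terms into multiples of [t^-7], and the telescoping quantity is [t^-3]. *)
Definition root4 (d : nat) : R := d%:R `^ 4^-1.

Lemma root4X d : root4 d ^+ 4 = d%:R.
Proof. by rewrite /root4 -powR_mulrn ?powR_ge0 // -powRrM mulVf ?powRr1 // pnatr_eq0. Qed.

Lemma root4_gt0 d : (0 < d)%N -> 0 < root4 d.
Proof. by move=> d0; rewrite powR_gt0 // ltr0n. Qed.

Lemma divisors_le_root4 : exists2 C : R, 0 < C &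
  forall d, (0 < d)%N -> (size (divisors d))%:R <= C * root4 d.
Proof.
have [C C0 hC] := @divisor_bound 4 isT; exists C%:R; rewrite ?ltr0n // => d d0.
rewrite -(@ler_pXn2r _ 4) ?nnegrE ?mulr_ge0 ?powR_ge0 //.
rewrite exprMn root4X -!natrX -natrM ler_nat (leq_trans (hC d d0)) //.
by rewrite leq_mul2r -{1}[C]expn1 leq_pexp2l ?orbT.
Qed.

(** Discrete form of the derivative of the power [-3/4]: with [a^4 = d + 1] and [b^4 = d] it bounds
    [(d + 1)^(-7/4)] by a telescoping difference. *)
Lemma inv_cube_diff (a b : R) : 0 < a -> 0 < b -> a ^+ 4 = b ^+ 4 + 1 -> (a ^+ 7)^-1 <= 2 * (b ^- 3 - a ^- 3).
Proof.
move=> a0 b0 ab; have h : 1 <= 2 * a * (a ^+ 3 - b ^+ 3).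
  have e1 : 1 = (a - b) * (a ^+ 3 + a ^+ 2 * b + a * b ^+ 2 + b ^+ 3).
    by rewrite -[LHS](addKr (b ^+ 4)) -ab; ring.
  have ba : b <= a by rewrite -(@ler_pXn2r _ 4) ?nnegrE ?ab ?lerDl // ltW.
  have -> : 2 * a * (a ^+ 3 - b ^+ 3) = (a - b) * (2 * (a ^+ 3 + a ^+ 2 * b + a * b ^+ 2)).
    by ring.
  rewrite {1}e1; apply: ler_wpM2l; first by rewrite subr_ge0.
  have c1 : b ^+ 3 <= a ^+ 3 by rewrite lerXn2r // nnegrE ltW.
  have c2 : 0 <= a ^+ 2 * b + a * b ^+ 2 by rewrite addr_ge0 ?mulr_ge0 ?exprn_ge0 // ltW.
  by move: c1 c2; clear; lra.
have a3 : 0 < a ^+ 3 by rewrite exprn_gt0.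
have b3 : 0 < b ^+ 3 by rewrite exprn_gt0.
have ab3 : b ^+ 3 <= a ^+ 3.
  by rewrite lerXn2r ?nnegrE ?ltW // -(@ltr_pXn2r _ 4) ?nnegrE ?ab ?ltrDl // ltW.
have -> : 2 * (b ^- 3 - a ^- 3) = 2 * a * (a ^+ 3 - b ^+ 3) / (a ^+ 4 * b ^+ 3).
  by field; rewrite ?gt_eqF.
have -> : (a ^+ 7)^-1 = (b ^+ 3 / a ^+ 3) / (a ^+ 4 * b ^+ 3) by field; rewrite ?gt_eqF.
rewrite ler_wpM2r ?invr_ge0 ?mulr_ge0 ?exprn_ge0 ?(ltW a0) ?(ltW b0) //.
by apply: le_trans h; rewrite ler_pdivrMr // mul1r.
Qed.

Lemma divisor_tail : exists2 C : R, 0 < C & forall M D, (0 < M)%N ->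
  \sum_(M.+1 <= d < D) (size (divisors d))%:R / d%:R ^+ 2 <= C / root4 M ^+ 3.
Proof.
have [C C0 hC] := divisors_le_root4; exists (C * 2); rewrite ?mulr_gt0 // => M D M0.
have h0 : 0 <= C * 2 / root4 M ^+ 3 by rewrite divr_ge0 ?mulr_ge0 ?exprn_ge0 // ltW // root4_gt0.
case: (leqP D M) => DM; first by rewrite big_geq // (leq_trans DM).
have [k ->] : exists k, D = (M + k).+1 by exists (D - M.+1)%N; lia.
suff : \sum_(M.+1 <= d < (M + k).+1) (size (divisors d))%:R / d%:R ^+ 2 <=
    C * 2 * (root4 M ^- 3 - root4 (M + k) ^- 3).
  move=> /le_trans; apply; apply: ler_wpM2l; first by rewrite mulr_ge0 // ltW.
  by rewrite gerBl invr_ge0 exprn_ge0 // ltW // root4_gt0 // addn_gt0 M0.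
elim: k => [|k IH]; first by rewrite addn0 big_geq // subrr mulr0.
rewrite addnS big_nat_recr /=; last by rewrite ltnS leq_addr.
have k0 : (0 < M + k)%N by rewrite addn_gt0 M0.
have -> : C * 2 * (root4 M ^- 3 - root4 (M + k).+1 ^- 3) =
  C * 2 * (root4 M ^- 3 - root4 (M + k) ^- 3) + C * (2 * (root4 (M + k) ^- 3 - root4 (M + k).+1 ^- 3)).
  by ring.
apply: lerD => //.
have a0 : 0 < root4 (M + k).+1 by rewrite root4_gt0.
apply: (@le_trans _ _ (C * (root4 (M + k).+1 ^+ 7)^-1)); last first.
  by rewrite ler_pM2l //; apply: inv_cube_diff; rewrite ?root4_gt0 // !root4X natr1.
rewrite ler_pdivrMr; last by rewrite exprn_gt0 // ltr0n.
apply: (le_trans (hC _ _)) => //; rewrite -mulrA ler_pM2l //.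
have -> : (M + k).+1%:R ^+ 2 = root4 (M + k).+1 * root4 (M + k).+1 ^+ 7.
  by rewrite -root4X -exprM -exprS.
rewrite mulrC mulfK //.
by rewrite expf_neq0 // gt_eqF.
Qed.

End DivisorTail.

Section EulerProduct.
Variable R : realType.

Definition euler_prod (m : nat) : R :=
  \prod_(0 <= p < m | prime p && (p == 1 %[mod 4])%N) (1 - 2 / p%:R ^+ 2).

Lemma euler_factor p : prime p && (p == 1 %[mod 4])%N -> 0 <= 1 - 2 / p%:R ^+ 2 :> R.
Proof.
move=> /andP[/prime_gt1 p1 _]; rewrite subr_ge0 ler_pdivrMr; last first.
  by rewrite exprn_gt0 // ltr0n ltnW.
by rewrite mul1r -natrX ler_nat (leq_trans p1) // -{1}[p]expn1 leq_pexp2l // ltnW.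
Qed.

Lemma euler_prod_ge0 m : 0 <= euler_prod m.
Proof. by apply: prodr_ge0 => p; apply: euler_factor. Qed.

Lemma euler_prod_noninc : {homo euler_prod : m n / (m <= n)%N >-> n <= m}.
Proof.
apply/nonincreasing_seqP => m; rewrite /euler_prod big_mkcond big_nat_recr //=.
by rewrite -big_mkcond /= ler_piMr ?euler_prod_ge0 //; case: ifP => // _; rewrite gerBl divr_ge0.
Qed.

Lemma euler_prod_cvg : cvgn euler_prod.
Proof.
apply: nonincreasing_is_cvgn; first exact: euler_prod_noninc.
by exists 0 => _ [m _ <-]; apply: euler_prod_ge0.
Qed.

Lemma c0_ge (y : R) n : (forall m, (n <= m)%N -> y <= euler_prod m) -> y <= c0 R.
Proof.
move=> h; apply: limr_ge; first exact: euler_prod_cvg.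
by exists n => // m /=; apply: h.
Qed.

Lemma c0_le (y : R) n : (forall m, (n <= m)%N -> euler_prod m <= y) -> c0 R <= y.
Proof.
move=> h; apply: limr_le; first exact: euler_prod_cvg.
by exists n => // m /=; apply: h.
Qed.

End EulerProduct.

Lemma squarefree_count_nat (R : realType) (eps : R) : 0 < eps -> exists2 K : R, 0 < K &
  forall N, (0 < N)%N ->
   `|(\sum_(1 <= n < N.+1 | `[< squarefree (n ^ 2 + 1) >]) 1)%N%:R - c0 R * N%:R|
   <= K * N%:R `^ (7 / 12 + eps).
Proof.
move=> e0; have [C1 C10 h1] := square_pair_bound e0.
have [C2 C20 h2] := subpoly_max_divisors e0; have [C3 C30 h3] := divisor_tail R.
exists (2 * C2 + C1 + 2 * C3) => [|N N0]; first by rewrite !addr_gt0 ?mulr_gt0.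
have n1 := natr_ge1 R N0; have n0 : 0 <= N%:R :> R by [].
have np : 0 < N%:R :> R by rewrite ltr0n.
have nn0 : (N%:R : R) != 0 by rewrite gt_eqF.
set S := (\sum_(_ <= _ < _ | _) 1)%N.
set P := N%:R `^ (7 / 12 + eps).
pose x : R := N%:R `^ (7 / 12); pose t := Num.truncn x.
have x1 : 1 <= x by rewrite powR_ge1.
have /andP[tx xt] := truncn_itv (le_trans ler01 x1).
rewrite -/t in tx xt.
have t1 : (1 <= t)%N by rewrite /t -(truncn1 R); apply: le_truncn.
have t2 : x <= 2 * t%:R.
  have t1' : (1 : R) <= t%:R by rewrite ler1n.
  by move: xt t1'; rewrite -natr1; clear; lra.
have xN : x <= N%:R by rewrite -[leRHS]powRr1 // ler_powR //; lra.
have tN : (t <= N)%N by rewrite -(ler_nat R) (le_trans tx).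
have hT d : (d < t.+1)%N -> (size (divisors d) <= max_divisors N)%N.
  rewrite ltnS => dt; apply: max_divisorsP; apply: leq_trans dt (leq_trans tN _).
  by rewrite -[leqLHS]mul1n leq_mul // -{1}[N]expn1 leq_pexp2l.
(* The bound is uniform in [m], so after division by [N] it passes to the limit through [c0_ge] and
   [c0_le]. *)
have err m : (N < m)%N -> `|S%:R - N%:R * euler_prod R m| <= (2 * C2 + C1 + 2 * C3) * P.
  move=> Nm; have [D hD] := sieve_error R Nm hT; apply: (le_trans hD).
  rewrite !(mulrDl _ _ P); apply: lerD; first apply: lerD.
  - rewrite natrM; have -> : 2 * C2 * P = (2 * x) * (C2 * N%:R `^ eps).
      by rewrite /P powRD ?nn0 ?implybT // -/x; ring.
    apply: ler_pM => //; last exact: h2.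
    by rewrite -natr1; move: tx x1; clear; lra.
  - exact: h1.
  - apply: (@le_trans _ _ (N%:R * (C3 / root4 R t ^+ 3))); first by rewrite ler_wpM2l // h3.
    have t0 : (0 : R) < t%:R by rewrite ltr0n.
    have r0 : 0 < root4 R t ^+ 3 by rewrite exprn_gt0 // root4_gt0.
    rewrite mulrCA [2 * C3]mulrC -[leRHS]mulrA ler_pM2l // ler_pdivrMr //.
    (* [N = x^(12/7)] and [t >= x / 2], so [t^(3/4) >= x^(3/4) / 2], where [12/7 - 3/4 < 1] *)
    have hx : x `^ (3 / 4) <= 2 * root4 R t ^+ 3.
      have -> : root4 R t ^+ 3 = t%:R `^ (3 / 4).
        by rewrite /root4 -powR_mulrn ?powR_ge0 // -powRrM mulrC.
      apply: (@le_trans _ _ ((2 * t%:R) `^ (3 / 4))).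
        by apply: ge0_ler_powR; rewrite ?nnegrE ?mulr_ge0 // (le_trans _ x1).
      rewrite powRM // ler_wpM2r ?powR_ge0 // -[leRHS]powRr1 // ler_powR //; lra.
    apply: (@le_trans _ _ (P * x `^ (3 / 4))); last first.
      by rewrite [2 * P]mulrC -mulrA ler_wpM2l ?powR_ge0.
    rewrite /P /x -powRrM -powRD ?nn0 ?implybT // -[leLHS]powRr1 // ler_powR //.
    by move: e0; clear; lra.
move: err; set B := (_ * P) => err.
rewrite ler_distlC; apply/andP; split.
  rewrite -ler_pdivrMr //; apply: (@c0_ge _ _ N.+1) => m Nm; rewrite ler_pdivrMr //.
  by have := err m Nm; rewrite ler_norml => /andP[]; clear; rewrite mulrC; lra.
rewrite -ler_pdivlMr //; apply: (@c0_le _ _ N.+1) => m Nm; rewrite ler_pdivlMr //.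
by have := err m Nm; rewrite ler_norml => /andP[]; clear; rewrite mulrC; lra.
Qed.

Theorem theorem1 (R : realType) (eps : R) (heps : 0 < eps) :
  exists2 C : R, 0 < C &
    forall x : R, 2 <= x ->
      `|(Ncount x)%:R - c0 R * x| <= C * x `^ (7 / 12 + eps).
Proof.
have [K K0 hK] := squarefree_count_nat heps; exists (K + 1) => [|x x2]; first exact: addr_gt0.
have x0 : 0 <= x by lra.
have x1 : 1 <= x by lra.
set N := Num.truncn x; have /andP[Nx xN] := truncn_itv x0; rewrite -/N in Nx xN.
have N0 : (0 < N)%N by rewrite /N -(truncn1 R); apply: le_truncn.
have th0 : 0 <= 7 / 12 + eps by rewrite addr_ge0 ?(ltW heps) // divr_ge0.
have c0_0 : 0 <= c0 R by apply: (@c0_ge _ _ 0) => m _; apply: euler_prod_ge0.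
have c0_1 : c0 R <= 1.
  apply: (@c0_le _ _ 0) => m _; have := euler_prod_noninc R (leq0n m).
  by rewrite [X in _ <= X]/euler_prod big_geq.
(* [c0] lies in [[0, 1]] and [x - N < 1], so replacing [x] by its integer part costs at most 1. *)
have -> : (Ncount x)%:R - c0 R * x = ((Ncount x)%:R - c0 R * N%:R) + c0 R * (N%:R - x) by ring.
apply: (le_trans (ler_normD _ _)); rewrite mulrDl mul1r; apply: lerD.
  apply: (le_trans (hK N N0)); rewrite ler_pM2l //; apply: ge0_ler_powR => //.
  by rewrite nnegrE.
apply: (@le_trans _ _ 1); last exact: powR_ge1.
rewrite normrM ger0_norm // -[leRHS]mulr1; apply: ler_pM => //.
rewrite distrC ger0_norm ?subr_ge0 //; move: xN; rewrite -natr1; clear; lra.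
Qed.
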